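(* Let $N\ge 2$. Let $a\in C^2_0(\mathbb{R}^N)$ and $b\in C^3_0(\mathbb{R}^N)$ be radially symmetric with $b\ge 0$ and $b=1$ in a neighborhood of $0$. Let $V\in C^2((0,+\infty))$ satisfy $\liminf_{r\to+\infty}\frac{V(r)}{\log r}\in(1-N,+\infty]$, $V(|x|)\in L^q_{loc}(\mathbb{R}^N)$ for some $q>N$, and $\liminf_{r\to+\infty}V(r)>-\infty$. Set $$G(r)=V(r)+\frac{(N-1)(N-3)}{4r^2}+(N-1)\log r,\quad r>0,$$ and assume: if $N=2$ or $3$, then $G'>0$ in $(0,+\infty)$ and $\liminf_{r\to0^+}G'(r)>0$; if $N\ge4$, then $\limsup_{r\to0^+}r^3G'(r)<0$ and $r^3G'(r)$ has a unique simple zero in $(0,+\infty)$. Then there is $\delta_0>0$ such that for every $\delta\in[0,\delta_0]$ the following problem has a unique solution: $$\begin{cases}u''+\frac{N-1}{r}u'-(V+\delta a)u+(1+\delta b)u\log u^2=0,\quad u>0\quad\text{in }(0,+\infty),\\ u'(0)=0,\quad \lim_{r\to+\infty}u(r)=0.\end{cases}$$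
   Context: $C^k_0(\mathbb{R}^N)$ denotes $C^k$ functions with compact support. Radial functions are identified with functions of $r=|x|$. Solutions of the ODE problem are understood to be $C^1$ on $[0,\infty)$ and $C^2$ on $(0,\infty)$. A simple zero of a $C^1$ function is a zero at which its derivative is nonzero. *)

(* Defs.v *)
From HB Require Import structures.
From mathcomp Require Import all_boot all_order all_algebra.
From mathcomp Require Import all_classical all_reals all_analysis.

Set Implicit Arguments.
Unset Strict Implicit.
Unset Printing Implicit Defensive.

Import Order.TTheory GRing.Theory Num.Theory.
Import numFieldNormedType.Exports.

Local Open Scope classical_set_scope.
Local Open Scope ring_scope.

(* The library norm of a row vector is the sup norm, hence a separate name for
   the Euclidean one. *)
Definition enorm {R : realType} {N : nat} (x : 'rV[R]_N) : R :=
  Num.sqrt (\sum_(i < N) x ord0 i ^+ 2).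

(* x |-> f |x|. Only f on [0, +oo[ matters; for a profile given on ]0, +oo[,
   f 0 is an arbitrary value taken on the null set {0}. *)
Definition radial {R : realType} (N : nat) (f : R -> R) : 'rV[R]_N -> R :=
  fun x => f (enorm x).
Arguments radial {R} N f x.

Definition basis_vec {R : realType} {N : nat} (i : 'I_N) : 'rV[R]_N :=
  delta_mx ord0 i.

Fixpoint C_k {R : realType} {N : nat} (k : nat) (f : 'rV[R]_N -> R) : Prop :=
  if k is k'.+1 then
    continuous f /\
    forall i : 'I_N, (forall x, derivable f x (basis_vec i)) /\
                     C_k k' (fun x => 'D_(basis_vec i) f x)
  else continuous f.

Definition compactly_supported {R : realType} {N : nat} (f : 'rV[R]_N -> R) :=
  compact (closure [set x | f x != 0]).

Definition C_k0 {R : realType} {N : nat} (k : nat) (f : 'rV[R]_N -> R) :=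
  C_k k f /\ compactly_supported f.

Section product_step.
Context {d} {T : measurableType d} {R : realType} {n : nat}.
Variable m : {sigma_finite_measure set T -> \bar R}.
Variable mu : {sigma_finite_measure set (n.-tuple T) -> \bar R}.
Local Open Scope ereal_scope.

Definition tcons (z : T * n.-tuple T) : n.+1.-tuple T := [tuple of z.1 :: z.2].

Lemma measurable_tcons : measurable_fun [set: T * n.-tuple T] tcons.
Proof. exact: measurable_cons. Qed.

Definition product_step : set (n.+1.-tuple T) -> \bar R :=
  pushforward (m \x mu) tcons.

HB.instance Definition _ := Measure.copy product_step
  (measure_function_pushforward__canonical__measure_function_Measure
     (m \x mu) measurable_tcons).

Lemma product_stepE (A : set T) (B : set (n.-tuple T)) :
  measurable A -> measurable B ->
  product_step [set t | A (thead t) /\ B [tuple of behead t]] = m A * mu B.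
Proof.
move=> mA mB; rewrite -product_measure1E//; congr (_ \x _).
apply/funext => -[x t]/=; rewrite /tcons/= theadE.
set t' := (X in B X); suff -> : t' = t by [].
exact/val_inj.
Qed.

Let product_step_sigma_finite : sigma_finite setT product_step.
Proof.
have /sigma_finiteP[F [TF ndF Foo]] := sigma_finiteT m.
have /sigma_finiteP[H [TH ndH Hoo]] := sigma_finiteT mu.
exists (fun k => [set t | F k (thead t) /\ H k [tuple of behead t]]).
  apply/seteqP; split => // t _.
  have [i _ Fi] : (\bigcup_k F k) (thead t) by rewrite -TF.
  have [j _ Hj] : (\bigcup_k H k) [tuple of behead t] by rewrite -TH.
  exists (maxn i j) => //; split.
  - by move: Fi; exact/subsetPset/ndF/leq_maxl.
  - by move: Hj; exact/subsetPset/ndH/leq_maxr.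
move=> k; have [mF Fk] := Foo k; have [mH Hk] := Hoo k; split.
  apply: measurableI; rewrite -[X in measurable X]setTI.
  - exact: (measurable_tnth ord0).
  - exact: measurable_behead.
by rewrite product_stepE// lte_mul_pinfty// ge0_fin_numE.
Qed.

HB.instance Definition _ := Measure_isSigmaFinite.Build _ _ _ product_step
  product_step_sigma_finite.

End product_step.

Section product_power.
Context {d} {T : measurableType d} {R : realType}.
Variable m : {sigma_finite_measure set T -> \bar R}.
Local Open Scope ereal_scope.

Fixpoint product_power (n : nat) : {sigma_finite_measure set (n.-tuple T) -> \bar R} :=
  if n is n'.+1 then product_step m (product_power n') else \d_([tuple] : 0.-tuple T).

Lemma product_powerE (n : nat) (A : 'I_n -> set T) :
  (forall i, measurable (A i)) ->
  product_power n [set t | forall i, A i (tnth t i)] = \prod_(i < n) m (A i).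
Proof.
elim: n A => [|n IH] A mA.
  by rewrite big_ord0 /= diracE mem_set// => -[].
rewrite big_ord_recl -IH// -product_stepE//; last first.
  rewrite (_ : mkset _ = \bigcap_i ((@tnth n _ ^~ i) @^-1` A (lift ord0 i))).
    apply: fin_bigcap_measurable => // i _.
    by rewrite -[X in measurable X]setTI; exact: measurable_tnth.
  by apply/seteqP; split => t /= At i; [move=> _|]; exact: At.
congr (product_step _ _ _); apply/seteqP; split => t /=.
  move=> At; split => [|i]; first exact: At.
  by move: (At (lift ord0 i)); rewrite {1}[t]tuple_eta tnthS.
move=> [A0 At] i; have [->//|] := eqVneq i ord0.
by rewrite eq_sym => /unlift_some [j -> _]; rewrite [t]tuple_eta tnthS.
Qed.

End product_power.

(* N-dimensional Lebesgue measure, characterized by [product_powerE]. Tuples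
   model R^N because they carry the library's product sigma-algebra. *)
Definition lebesgue {R : realType} (N : nat) :
    {sigma_finite_measure set (N.-tuple (measurableTypeR R)) -> \bar R} :=
  product_power (@lebesgue_measure R) N.

Definition row_of_tuple {R : realType} {N : nat}
    (t : N.-tuple (measurableTypeR R)) : 'rV[R]_N :=
  \row_(i < N) tnth t i.

Definition Lq_loc {R : realType} {N : nat} (q : R) (f : 'rV[R]_N -> R) :=
  forall K : set 'rV[R]_N, compact K ->
    (f \_ K) \o row_of_tuple \in Lfun (lebesgue N) q%:E.

Definition C2_pos {R : realType} (f : R -> R) :=
  forall r, 0 < r ->
    [/\ derivable f r 1, derivable (derive1 f) r 1 & {for r, continuous (derive1 (derive1 f))}].

Definition right_quotient0 {R : realType} (u : R -> R) (h : R) : R :=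
  h^-1 * (u h - u 0).

(* Derivative of a function on [0, +oo[, one-sided at 0. *)
Definition deriv_halfline {R : realType} (u : R -> R) (r : R) : R :=
  if r == 0 then lim (right_quotient0 u h @[h --> 0^'+]) else derive1 u r.

Definition C1_halfline {R : realType} (u : R -> R) :=
  [/\ cvg (right_quotient0 u h @[h --> 0^'+]),
      forall r, 0 < r -> derivable u r 1 &
      {within `[0, +oo[, continuous (deriv_halfline u)}].

Definition G {R : realType} (N : nat) (V : R -> R) (r : R) : R :=
  V r + (N%:R - 1) * (N%:R - 3) / (4 * r ^+ 2) + (N%:R - 1) * ln r.

Definition r3G' {R : realType} (N : nat) (V : R -> R) (r : R) : R :=
  r ^+ 3 * derive1 (G N V) r.

Definition unique_simple_zero_pos {R : realType} (f : R -> R) :=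
  exists r0, [/\ 0 < r0, f r0 = 0, derive1 f r0 != 0 &
    forall r, 0 < r -> f r = 0 -> r = r0].

Definition is_solution {R : realType} (N : nat) (V a b : R -> R) (delta : R)
    (u : R -> R) :=
  [/\ C1_halfline u /\ C2_pos u,
      forall r, 0 < r ->
        derive1 (derive1 u) r + (N%:R - 1) / r * derive1 u r - (V r + delta * a r) * u r
        + (1 + delta * b r) * u r * ln (u r ^+ 2) = 0,
      forall r, 0 < r -> 0 < u r,
      deriv_halfline u 0 = 0 &
      u r @[r --> +oo] --> 0].

(* Main.v *)
Require Import Defs.
From mathcomp Require Import all_boot all_order all_algebra.
From mathcomp Require Import all_classical all_reals all_analysis.
From mathcomp Require Import measurable_realfun ring lra.
Import Order.TTheory GRing.Theory Num.Theory.
Import numFieldNormedType.Exports.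
Local Open Scope classical_set_scope.
Local Open Scope ring_scope.

(** With [n = N - 1], [Q = V + d a], [K = 1 + d b] and [k = sqrt K], the substitution
    [t = ln u + (n / 2) ln r + (ln K) / 4], [p = t' / k] turns the equation into the flow
    [t' = k p], [p' = k (H - 2 t - p^2)], where [H = G] for [d = 0]. Its energy
    [E = exp (2 t) (p^2 + 2 t - H - 1)] satisfies [E' = - H' exp (2 t)].

    Existence is by shooting in [u(0)]: for large [u(0)] the solution reaches zero, for
    small [u(0)] the energy becomes negative where [H] increases. Both sets of initial
    values are open, they are disjoint, and a value in neither of them gives a positive
    solution that decays.

    For uniqueness, first [E >= 0] along every decaying solution. Where [H' > 0] this holds
    because [E] decreases and gets arbitrarily small at infinity. If [N >= 4], [E] increases
    before the zero [r0] of [G'], and it starts from 0 since [V(|x|)] in [L^q] makes [V]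
    integrable near 0; near [r0], a negative energy would persist across a short window,
    to the right or to the left of it according to the sign of [p]. Now let
    [u(0) < v(0)] and [eta = ln u - ln v]. Then [eta' > 0], so that
    [Y = E_v - exp (- 2 eta) E_u], whose derivative is [2 eta' exp (- 2 eta) E_u], is
    nondecreasing and starts from 0; but [Y <= E_v] gets arbitrarily small, hence [Y = 0],
    which contradicts [H' > 0] far out. *)

(** * Calculus on the half-line *)

(* [lra] reifies every hypothesis of the context, which is slow. [slra] first tries
   to chain order hypotheses, and then drops the hypotheses which are not linear on
   the nose. Section variables cannot be cleared: inside sections, a hypothesis of
   type [keep_above] protects them. *)
Ltac order_chain n := match goal with
  | |- is_true (?x <= ?x) => exact (lexx x)
  | H : is_true ?g |- is_true ?g => exact H
  | H : is_true (?a < ?b) |- is_true (?a <= ?b) => exact (ltW H)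
  | H : is_true (1 <= ?b) |- is_true (0 < ?b) => exact (lt_le_trans ltr01 H)
  | H : is_true (?a < ?c) |- is_true (?a < ?b) =>
      lazymatch n with S ?m => apply (lt_le_trans H); order_chain m end
  | H : is_true (?a <= ?c) |- is_true (?a < ?b) =>
      lazymatch n with S ?m => apply (le_lt_trans H); order_chain m end
  | H : is_true (?a <= ?c) |- is_true (?a <= ?b) =>
      lazymatch n with S ?m => apply (le_trans H); order_chain m end
  | H : is_true (?a < ?c) |- is_true (?a <= ?b) =>
      lazymatch n with S ?m => apply (le_trans (ltW H)); order_chain m end
  end.
Ltac chain :=
  repeat match goal with H : is_true (_ && _) |- _ => case/andP: H => ? ? end;
  repeat (lazymatch goal with |- is_true (_ && _) => apply/andP; split end);
  order_chain 2%N.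

Inductive keep_above : Prop := KeepAbove.
Ltac not_numeral x := lazymatch x with
  | _ *+ _ => fail | (_ *+ _)^-1 => fail | - (_ *+ _) => fail | _ => idtac end.
Ltac nonlinear b := match b with
  | context [?x * ?y] => not_numeral x; not_numeral y
  | context [_ ^+ _] => idtac
  | context [?x^-1] => not_numeral x
  end.
Ltac opaque_atoms b := match b with
  | context [expR _] => idtac
  | context [ `|_| ] => idtac
  | _ => nonlinear b
  end.
Ltac prune junk := repeat (progress match goal with
  | H : ?T |- _ => lazymatch T with
      | keep_above => idtac
      | is_true ?b => junk b; clear H
      | _ = _ => clear H
      | forall _, _ => clear H
      end
  end).
Ltac slra := first [ solve [chain]
  | solve [prune ltac:(fun b => opaque_atoms b); lra]
  | solve [prune ltac:(fun b => nonlinear b); lra]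
  | lra ].

(** In the variable s with ds = k dr, w = exp t is the Liouville transform K^(1/4) r^(n/2) u. It
    solves w_ss = (H - 2 ln w) w, and E is the mechanical energy of this equation. Multiplying w by
    a constant only shifts 2 t; hence the factor exp (- 2 eta) gives both energies the same weight
    exp (2 t_v), so that H, with its singularity at 0, cancels in Y and H' cancels in Y'. Two
    obstacles shape the rest. The function u ln u is not Lipschitz at 0: the local theory is done
    for a truncated nonlinearity, and the vanishing of u is replaced by a strict inequality at one
    radius, which forces it within length 3 and is clearly an open condition. Moreover V may be
    singular at 0: integrals from 0 become primitives with a limit at 0, dominated by a primitive of
    |V|, and the perturbed H' is uniformly close to G' only away from 0; near 0, where b = 1, an
    exact formula takes over. *)

Definition has_der {R : realType} (f : R -> R) (x l : R) : Prop :=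
  is_derive x (1 : R) f l.

Section Derivatives.
Context {R : realType}.
Implicit Types (f g : R -> R) (x a b l : R).

Lemma has_der_eq f x a b : has_der f x a -> a = b -> has_der f x b.
Proof. by move=> h <-. Qed.

Lemma has_derD f g x a b :
  has_der f x a -> has_der g x b -> has_der (fun y => f y + g y) x (a + b).
Proof. by move=> ? ?; exact: is_deriveD. Qed.

Lemma has_derN f x a : has_der f x a -> has_der (fun y => - f y) x (- a).
Proof. by move=> ?; exact: is_deriveN. Qed.

Lemma has_der_cst (c : R) x : has_der (fun=> c) x 0.
Proof. exact: is_derive_cst. Qed.

Lemma has_der_id x : has_der (fun y : R => y) x 1.
Proof. exact: is_derive_id. Qed.

Lemma has_derM f g x a b : has_der f x a -> has_der g x b ->
  has_der (fun y => f y * g y) x (a * g x + f x * b).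
Proof.
move=> hf hg; have h := @is_deriveM R R f g x 1 a b hf hg.
by apply: (has_der_eq _ _ _ _ h); rewrite /GRing.scale /=; ring.
Qed.

Lemma has_der_comp f g x a b :
  has_der g x b -> has_der f (g x) a -> has_der (fun y => f (g y)) x (a * b).
Proof. by move=> ? ?; exact: is_derive1_comp. Qed.

Lemma has_der_exp f x a : has_der f x a -> has_der (fun y => expR (f y)) x (expR (f x) * a).
Proof. by move=> h; apply: has_der_comp => //; exact: is_derive_expR. Qed.

Lemma has_der_ln f x a : 0 < f x -> has_der f x a ->
  has_der (fun y => ln (f y)) x ((f x)^-1 * a).
Proof. by move=> p h; apply: has_der_comp => //; exact: is_derive1_ln. Qed.

Lemma has_derV f x a : f x != 0 -> has_der f x a ->
  has_der (fun y => (f y)^-1) x (- a / f x ^+ 2).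
Proof.
move=> p [h <-]; apply: DeriveDef; first exact: derivableV.
by rewrite deriveV// /GRing.scale /= mulrC mulrN mulNr.
Qed.

Lemma has_derX f n x a : has_der f x a ->
  has_der (fun y => f y ^+ n) x (n%:R * f x ^+ n.-1 * a).
Proof.
by move=> h; have := @is_deriveX R R f n x 1 a h; rewrite exprfctE.
Qed.

Lemma has_der_sqrt f x a : 0 < f x -> has_der f x a ->
  has_der (fun y => Num.sqrt (f y)) x (a / (2 * Num.sqrt (f x))).
Proof.
move=> p h; apply: (has_der_eq _ _ _ _ (has_der_comp _ _ _ _ _ h (is_derive1_sqrt p))).
by rewrite mulrC.
Qed.

Lemma has_der_near f g x a :
  has_der f x a -> (\forall y \near x, f y = g y) -> has_der g x a.
Proof. by move=> h e; apply: (near_eq_is_derive e h). Qed.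

Lemma has_der_cont f x a : has_der f x a -> {for x, continuous f}.
Proof. by case=> h _; apply/differentiable_continuous/derivable1_diffP. Qed.

Lemma has_derE f x a : has_der f x a -> derive1 f x = a.
Proof. by case=> _ <-; exact: derive1E. Qed.

Lemma has_derP f x : derivable f x 1 -> has_der f x (derive1 f x).
Proof. by move=> h; rewrite derive1E; exact/derivableP. Qed.

Lemma has_der_derivable f x a : has_der f x a -> derivable f x 1.
Proof. by case. Qed.

Lemma has_der_within f (f' : R -> R) a b :
  (forall x, a <= x <= b -> has_der f x (f' x)) -> {within `[a, b], continuous f}.
Proof.
move=> h; apply: continuous_in_subspaceT => x; rewrite inE /= in_itv /= => xab.
exact: has_der_cont (h x xab).
Qed.

Lemma mean_value f (f' : R -> R) a b : a < b ->
  (forall x, a <= x <= b -> has_der f x (f' x)) ->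
  exists2 c, a < c < b & f b - f a = f' c * (b - a).
Proof.
move=> ab h; have [||c cab e] := @MVT R f f' a b ab.
- by move=> x; rewrite in_itv /= => /andP[? ?]; apply: h; rewrite !ltW.
- exact: has_der_within h.
by exists c => //; move: cab; rewrite in_itv.
Qed.

Lemma der_ge0_le f (f' : R -> R) a b : a <= b ->
  (forall x, a <= x <= b -> has_der f x (f' x)) ->
  (forall x, a < x < b -> 0 <= f' x) -> f a <= f b.
Proof.
rewrite le_eqVlt => /orP[/eqP->//|ab] h p.
have [c cab e] := mean_value _ _ _ _ ab h.
by rewrite -subr_ge0 e mulr_ge0 ?p// subr_ge0 ltW.
Qed.

Lemma der_gt0_lt f (f' : R -> R) a b : a < b ->
  (forall x, a <= x <= b -> has_der f x (f' x)) ->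
  (forall x, a < x < b -> 0 < f' x) -> f a < f b.
Proof.
move=> ab h p; have [c cab e] := mean_value _ _ _ _ ab h.
by rewrite -subr_gt0 e mulr_gt0 ?p// subr_gt0.
Qed.

Lemma der_le_le f g (f' g' : R -> R) a b : a <= b ->
  (forall x, a <= x <= b -> has_der f x (f' x)) ->
  (forall x, a <= x <= b -> has_der g x (g' x)) ->
  (forall x, a < x < b -> f' x <= g' x) -> f b - f a <= g b - g a.
Proof.
move=> ab hf hg p.
have := @der_ge0_le (fun x => g x + - f x) (fun x => g' x + - f' x) a b ab.
suff : forall P Q : Prop, P -> Q -> g a + - f a <= g b + - f b -> f b - f a <= g b - g a.
  move=> _ /(_ _ _) H; have {H} : g a + - f a <= g b + - f b.
    apply: H => x xab; first by apply: has_derD; [exact: hg|apply: has_derN; exact: hf].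
    by rewrite subr_ge0 p.
  by slra.
by move=> *; slra.
Qed.
End Derivatives.

(** The rules build the derivative in an existential variable; [der] then leaves its equality with
    the announced value, usually settled by [ring] or [field]. *)
Ltac der_step :=
  first [ eassumption
        | apply: has_der_cst | apply: has_der_id
        | match goal with H : forall _, _ |- has_der _ _ _ => eapply H end
        | eapply has_derD | eapply has_derN | eapply has_derM
        | eapply has_der_exp | eapply has_der_ln | eapply has_derV
        | eapply has_derX | eapply has_der_sqrt ].
Ltac der := eapply has_der_eq;
  [ repeat (lazymatch goal with |- has_der _ _ _ => der_step end)
  | cbv beta ].


(** * Right limits at 0, bootstrap and barrier arguments *)

Section Limits.
Context {R : realType}.
Implicit Types (f g : R -> R) (x a b l : R).

Lemma continuousP_dist f x : {for x, continuous f} <->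
  forall e, 0 < e -> exists2 d, 0 < d & forall y, `|y - x| < d -> `|f y - f x| < e.
Proof.
split.
- move=> /cvgrPdist_lt h e e0; have := h e e0.
  move=> /nbhs_ballP[d /= d0 hd]; exists d => // y yx.
  by rewrite distrC; apply: hd; rewrite /ball /= distrC.
- move=> h; apply/cvgrPdist_lt => e e0; have [d d0 hd] := h e e0.
  apply/nbhs_ballP; exists d => //= y; rewrite /ball /= distrC => /hd.
  by rewrite distrC.
Qed.

Lemma continuous_gt0 f x : {for x, continuous f} -> 0 < f x ->
  exists2 d, 0 < d & forall y, `|y - x| < d -> 0 < f y.
Proof.
move=> /continuousP_dist h p; have [d d0 hd] := h _ p; exists d => // y /hd.
by rewrite ltr_distl subrr => /andP[].
Qed.

Definition lim0 f l := f x @[x --> 0^'+] --> l.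

Lemma near0P (P : R -> Prop) : (\forall x \near 0^'+, P x) <->
  exists2 d, 0 < d & forall x, 0 < x < d -> P x.
Proof.
split.
- move=> /nbhs_ballP[d /= d0 hd]; exists d => // x /andP[x0 xd].
  by apply: hd => //; rewrite /ball /= sub0r normrN gtr0_norm.
- move=> [d d0 h]; apply/nbhs_ballP; exists d => //= x; rewrite /ball /= sub0r normrN.
  by move=> xd x0; apply: h; rewrite x0 /= -(gtr0_norm x0).
Qed.

Lemma lim0P f l : lim0 f l <->
  forall e, 0 < e -> exists2 d, 0 < d & forall x, 0 < x < d -> `|f x - l| < e.
Proof.
split=> [/cvgrPdist_lt h e e0|h].
- have /near0P[d d0 hd] := h e e0; exists d => // x /hd; by rewrite distrC.
- apply/cvgrPdist_lt => e e0; apply/near0P; have [d d0 hd] := h e e0.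
  by exists d => // x /hd; rewrite distrC.
Qed.

Lemma small_between (d T : R) : 0 < d -> 0 < T -> exists x, 0 < x < d /\ 0 < x < T.
Proof.
move=> d0 T0; case: (ltP d T) => h.
  by exists (d / 2); split; apply/andP; split; slra.
by exists (T / 2); split; apply/andP; split; slra.
Qed.

Lemma lim0_ge f l c T : 0 < T -> lim0 f l -> (forall x, 0 < x < T -> c <= f x) -> c <= l.
Proof.
move=> T0 /lim0P h p; rewrite leNgt; apply/negP => lc.
have [d d0 hd] := h (c - l) (ltac:(slra)).
have [x [/hd + /p]] := small_between _ _ d0 T0.
by rewrite ltr_distl => /andP[? ?] ?; slra.
Qed.

Lemma lim0_le f l c T : 0 < T -> lim0 f l -> (forall x, 0 < x < T -> f x <= c) -> l <= c.
Proof.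
move=> T0 h p; have : lim0 (fun x => - f x) (- l) by apply: cvgN.
move=> /(lim0_ge _ _ (- c) _ T0) H; rewrite -lerN2; apply: H => x /p; by rewrite lerN2.
Qed.

Lemma lim0_unique f l l' : lim0 f l -> lim0 f l' -> l = l'.
Proof. by move=> h h'; apply: (cvg_unique _ h h'). Qed.

Lemma lim0_ext f g l T : 0 < T -> (forall x, 0 < x < T -> f x = g x) -> lim0 f l -> lim0 g l.
Proof.
move=> T0 e /lim0P h; apply/lim0P => eps e0; have [d d0 hd] := h _ e0.
exists (Num.min d T); first by rewrite lt_min d0.
move=> x /andP[x0]; rewrite lt_min => /andP[xd xT]; rewrite -e ?x0//.
by apply: hd; rewrite x0.
Qed.

Lemma lim0_squeeze f g l T : 0 < T -> lim0 g 0 ->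
  (forall x, 0 < x < T -> `|f x - l| <= g x) -> lim0 f l.
Proof.
move=> T0 /lim0P h p; apply/lim0P => eps e0; have [d d0 hd] := h _ e0.
exists (Num.min d T); first by rewrite lt_min d0.
move=> x /andP[x0]; rewrite lt_min => /andP[xd xT].
have := hd x; rewrite x0 xd subr0 => /(_ isT) hx.
have := p x; rewrite x0 xT => /(_ isT) /le_lt_trans; apply.
exact: le_lt_trans (ler_norm _) hx.
Qed.

Lemma lim0_cst c : lim0 (fun=> c) c. Proof. exact: cvg_cst. Qed.
Lemma lim0_id : lim0 (fun x => x) 0.
Proof. by apply/lim0P => e e0; exists e => // x /andP[? ?]; rewrite subr0 gtr0_norm. Qed.
Lemma lim0D f g a b : lim0 f a -> lim0 g b -> lim0 (fun x => f x + g x) (a + b).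
Proof. exact: cvgD. Qed.
Lemma lim0N f a : lim0 f a -> lim0 (fun x => - f x) (- a).
Proof. exact: cvgN. Qed.
Lemma lim0M f g a b : lim0 f a -> lim0 g b -> lim0 (fun x => f x * g x) (a * b).
Proof. exact: cvgM. Qed.
Lemma lim0_eq f a b : lim0 f a -> a = b -> lim0 f b.
Proof. by move=> h <-. Qed.
Lemma lim0X f a n : lim0 f a -> lim0 (fun x => f x ^+ n) (a ^+ n).
Proof.
move=> h; elim: n => [|n ih]; first exact: lim0_cst.
rewrite exprS; under eq_fun do rewrite exprS; exact: lim0M.
Qed.
Lemma lim0_comp f g a : lim0 f a -> {for a, continuous g} -> lim0 (fun x => g (f x)) (g a).
Proof. by move=> h c; exact: (@cvg_comp _ _ _ f g _ _ _ h c). Qed.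

Lemma nondecreasing_lim0 f (f' : R -> R) l T : lim0 f l ->
  (forall x, 0 < x <= T -> has_der f x (f' x)) ->
  (forall x, 0 < x < T -> 0 <= f' x) ->
  forall x, 0 < x <= T -> l <= f x.
Proof.
move=> fl h p x /andP[x0 xT]; apply: (lim0_le f l (f x) x) => // y /andP[y0 yx].
apply: (der_ge0_le f f'); [exact: ltW| |] => z /andP[yz zx].
  by apply: h; rewrite (lt_le_trans y0)//= (le_trans zx).
by apply: p; rewrite (lt_trans y0)//= (lt_le_trans zx).
Qed.

Lemma der_le_lim0 f g (f' g' : R -> R) a b T : lim0 f a -> lim0 g b ->
  (forall x, 0 < x <= T -> has_der f x (f' x)) ->
  (forall x, 0 < x <= T -> has_der g x (g' x)) ->
  (forall x, 0 < x < T -> f' x <= g' x) ->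
  forall x, 0 < x <= T -> f x - a <= g x - b.
Proof.
move=> fa gb hf hg p x xT.
have := @nondecreasing_lim0 (fun x => g x + - f x) (fun x => g' x + - f' x) (b + - a) T.
move=> H; have : b + - a <= g x + - f x.
  apply: H => //.
  - exact: lim0D gb (lim0N _ _ fa).
  - by move=> y yT; apply: has_derD; [exact: hg|apply: has_derN; exact: hf].
  - by move=> y /p ?; slra.
by move=> ?; slra.
Qed.

(** Plays the role of bounding an integral from 0 by the integral of a dominating function. *)
Lemma der_norm_lim0 f g (f' g' : R -> R) a b T : lim0 f a -> lim0 g b ->
  (forall x, 0 < x <= T -> has_der f x (f' x)) ->
  (forall x, 0 < x <= T -> has_der g x (g' x)) ->
  (forall x, 0 < x < T -> `|f' x| <= g' x) ->
  forall x, 0 < x <= T -> `|f x - a| <= g x - b.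
Proof.
move=> fa gb hf hg p x xT; rewrite ler_norml; apply/andP; split; last first.
  apply: (der_le_lim0 f g f' g' a b T) => // y /p; exact: le_trans (ler_norm _).
have : (- f x) - (- a) <= g x - b.
  apply: (der_le_lim0 (fun x => - f x) g (fun x => - f' x) g' (- a) b T) => //.
  - exact: lim0N.
  - by move=> y yT; apply: has_derN; exact: hf.
  - move=> y /p; apply: le_trans; by rewrite -normrN ler_norm.
by move=> ?; slra.
Qed.

(** A bootstrap whose left end is open, because solutions are singular at 0. At the infimum of the
    points where f <= 0 the step hypothesis applies, so f is positive there, and continuity pushes
    the infimum further right. *)
Lemma continuity_induction f a b :
  (forall x, a < x <= b -> {for x, continuous f}) ->
  (exists2 d, 0 < d & forall x, a < x < a + d -> x <= b -> 0 < f x) ->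
  (forall t, a < t <= b -> (forall s, a < s < t -> 0 < f s) -> 0 < f t) ->
  forall t, a < t <= b -> 0 < f t.
Proof.
move=> cf [d d0 hd] step t /andP[at_ tb]; rewrite ltNge; apply/negP => ft.
pose A := [set s | a < s <= t /\ f s <= 0].
have At : A t by rewrite /A /= at_ lexx.
have lbA : lbound A (a + d).
  move=> s [/andP[as_ st] fs]; rewrite leNgt; apply/negP => sd.
  have := hd s; rewrite as_ sd => /(_ isT (le_trans st tb)); by rewrite ltNge fs.
have hiA : has_inf A by split; [exists t|exists (a + d)].
have id : a + d <= inf A by apply: lb_le_inf => //; exists t.
have it : inf A <= t by apply: ge_inf => //; exists (a + d).
have ii : a < inf A <= b by apply/andP; split; [slra|exact: le_trans it tb].
have below s : a < s < inf A -> 0 < f s.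
  move=> /andP[as_ si]; rewrite ltNge; apply/negP => fs.
  suff : inf A <= s by rewrite leNgt si.
  apply: ge_inf; first by exists (a + d).
  by split=> //; rewrite as_ (le_trans (ltW si)).
have fi := step _ ii below.
have [r r0 hr] := continuous_gt0 _ _ (cf _ ii) fi.
have : inf A + r <= inf A.
  apply: lb_le_inf; first by exists t.
  move=> s [/andP[as_ st] fs]; rewrite leNgt; apply/negP => sr.
  have si : inf A <= s by apply: ge_inf; [exists (a + d)|split=> //; rewrite as_ st].
  have : 0 < f s by apply: hr; rewrite ger0_norm; slra.
  by rewrite ltNge fs.
by slra.
Qed.

Lemma continuity_induction_cc f a b : 0 < f a ->
  (forall x, a <= x <= b -> {for x, continuous f}) ->
  (forall t, a < t <= b -> (forall s, a <= s < t -> 0 < f s) -> 0 < f t) ->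
  forall t, a <= t <= b -> 0 < f t.
Proof.
move=> fa cf step t /andP[at_ tb].
move: at_; rewrite le_eqVlt => /orP[/eqP<-//|at_].
apply: (continuity_induction f a b) => //; last by rewrite at_.
- by move=> x /andP[ax xb]; apply: cf; rewrite (ltW ax).
- have [||d d0 hd] := continuous_gt0 f a => //.
    by apply: cf; rewrite lexx (le_trans (ltW at_)).
  by exists d => // x /andP[ax xd] _; apply: hd; rewrite gtr0_norm; slra.
- move=> u /andP[au ub] h; apply: step; first by rewrite au.
  move=> s /andP[]; rewrite le_eqVlt => /orP[/eqP<-//|as_] su.
  by apply: h; rewrite as_.
Qed.

(* A function cannot become negative if it is nondecreasing while slightly
   negative. *)
Lemma barrier f (f' : R -> R) a b :
  (forall e, 0 < e -> exists2 d, 0 < d & forall x, a < x < a + d -> x <= b -> - e < f x) ->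
  (forall x, a < x <= b -> has_der f x (f' x)) ->
  (forall x, a < x <= b -> -1 < f x < 0 -> 0 <= f' x) ->
  forall x, a < x <= b -> 0 <= f x.
Proof.
move=> start hf p x xab; rewrite leNgt; apply/negP => fx.
(* With e <= 1/2, the points just before a first contact f = - e have f in ]-1, 0[, which is where
   monotonicity is assumed. *)
pose e := Num.min (- f x) (1/2).
have e0 : 0 < e by rewrite lt_min; apply/andP; split; slra.
have e12 : e <= 1/2 by rewrite ge_min lexx orbT.
have efx : e <= - f x by rewrite ge_min lexx.
suff : 0 < f x + e by slra.
have cf y : a < y <= b -> {for y, continuous (fun y => f y + e)}.
  move=> /hf /has_der_cont c; apply: continuousD => //; exact: cst_continuous.
apply: (continuity_induction (fun y => f y + e) a b) => //.
  by have [d d0 hd] := start e e0; exists d => // y ya yb; have := hd y ya yb; slra.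
move=> t tab ht; rewrite ltNge; apply/negP => ft.
have /andP[at_ tb] := tab.
have cNf : {for t, continuous (fun y => - f y)}.
  by apply: continuousN; exact: has_der_cont (hf _ tab).
have [|d d0 hd] := continuous_gt0 _ _ cNf; first by slra.
have [u [/andP[u0 ud] /andP[_ ut]]] := small_between _ _ d0 (ltac:(slra) : 0 < t - a).
have : f (t - u) <= f t.
  apply: (der_ge0_le f f'); first slra.
  - by move=> y /andP[? ?]; apply: hf; apply/andP; split; slra.
  - move=> y /andP[y1 y2]; apply: p; first by apply/andP; split; slra.
    have := ht y; have := hd y; rewrite ltr0_norm; last by slra.
    by move=> /(_ ltac:(slra)) ? /(_ ltac:(slra)) ?; slra.
have := ht (t - u) ltac:(slra); slra.
Qed.

Lemma barrier_cc f (f' : R -> R) a b : 0 <= f a ->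
  (forall x, a <= x <= b -> has_der f x (f' x)) ->
  (forall x, a <= x <= b -> -1 < f x < 0 -> 0 <= f' x) ->
  forall x, a <= x <= b -> 0 <= f x.
Proof.
move=> fa hf p x /andP[]; rewrite le_eqVlt => /orP[/eqP<-//|ax] xb.
apply: (barrier f f' a b) => //; last by rewrite ax.
- move=> e e0; have /continuousP_dist c : {for a, continuous f}.
    by apply: has_der_cont; apply: hf; slra.
  have [d d0 hd] := c e e0; exists d => // y /andP[ay yd] _.
  have := hd y; rewrite gtr0_norm ?subr_gt0// => /(_ ltac:(slra)).
  by rewrite ltr_distl => /andP[? ?]; slra.
- by move=> y /andP[? ?]; apply: hf; slra.
- by move=> y /andP[? ?]; apply: p; slra.
Qed.

End Limits.

(** * Bounds on compact intervals and primitives on the open half-line *)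

Section Primitives.
Context {R : realType}.
Implicit Types (f g : R -> R) (x a b l : R).

Lemma continuous_within f a b :
  (forall x, a <= x <= b -> {for x, continuous f}) -> {within `[a, b], continuous f}.
Proof.
move=> h; apply: continuous_in_subspaceT => x; rewrite inE /= in_itv /=; exact: h.
Qed.

Lemma continuous_bounded f a b : 
  (forall x, a <= x <= b -> {for x, continuous f}) ->
  exists2 C, 0 < C & forall x, a <= x <= b -> `|f x| <= C.
Proof.
move=> h; case: (leP a b) => ab; last first.
  by exists 1 => // x /andP[ax /(le_trans ax)]; rewrite leNgt ab.
have cn : {within `[a, b], continuous (fun x => `|f x|)}.
  apply: continuous_within => x xab; apply: continuous_comp; first exact: h.
  exact: norm_continuous.
have [c cab hc] := EVT_max ab cn.
exists (`|f c| + 1); first by rewrite ltr_wpDl.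
move=> x xab; apply: le_trans (hc x _) _; rewrite ?lerDl//.
Qed.

Lemma continuous_lower_bound f a b : 
  (forall x, a <= x <= b -> {for x, continuous f}) ->
  (forall x, a <= x <= b -> 0 < f x) ->
  exists2 c, 0 < c & forall x, a <= x <= b -> c <= f x.
Proof.
move=> h p; case: (leP a b) => ab; last first.
  by exists 1 => // x /andP[ax /(le_trans ax)]; rewrite leNgt ab.
have [c cab hc] := EVT_min ab (continuous_within _ _ _ h).
exists (f c); first exact: p.
by move=> x xab; apply: hc.
Qed.

Lemma primitive_itv f a b : a < 1 < b ->
  (forall x, a <= x <= b -> {for x, continuous f}) ->
  exists F, F 1 = 0 /\ forall x, a < x < b -> has_der F x (f x).
Proof.
move=> /andP[a1 b1] cf.
pose F y := (\int[lebesgue_measure]_(t in `[a, y]) f t)%R.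
have intf : (@lebesgue_measure R).-integrable `[a, b] (EFin \o f).
  apply: continuous_compact_integrable; first exact: segment_compact.
  exact: continuous_within.
exists (fun y => F y - F 1); rewrite subrr; split => // x /andP[ax xb].
have [|d e] := @continuous_FTC1_closed R f a x b xb intf ax.
  by apply: cf; rewrite !ltW.
apply: (has_der_eq _ _ (f x + - 0)); last by rewrite subr0.
apply: has_derD; last by apply: has_derN; exact: has_der_cst.
by rewrite -e; exact: has_derP.
Qed.

Lemma der0_const f a b : (forall x, a <= x <= b -> has_der f x 0) ->
  forall x y, a <= x <= b -> a <= y <= b -> f x = f y.
Proof.
move=> h x y; wlog xy : x y / x <= y.
  by move=> H hx hy; case: (leP x y) => xy; [|symmetry]; apply: H => //; exact: ltW.
move=> /andP[ax xb] /andP[ay yb]; apply/eqP; rewrite eq_le; apply/andP; split.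
  apply: (der_ge0_le f (fun=> 0)) => // z /andP[? ?]; apply: h; slra.
rewrite -lerN2; apply: (der_ge0_le (fun x => - f x) (fun=> 0)) => // z /andP[? ?].
by rewrite -oppr0; apply: has_derN; apply: h; slra.
Qed.

(** The intervals ]1/(n+2), n+2[ exhaust the half-line and all contain 1. Primitives vanishing at 1
    agree on overlaps and are glued, the index for x being read off x + 1/x. Nothing is said about
    0. *)
Lemma has_primitive f : (forall x, 0 < x -> {for x, continuous f}) ->
  exists F, forall x, 0 < x -> has_der F x (f x).
Proof.
move=> cf.
have pr (n : nat) : exists F, F 1 = 0 /\
    forall x, (n.+2%:R)^-1 < x < n.+2%:R -> has_der F x (f x).
  apply: primitive_itv.
    by rewrite invf_lt1 ?ltr0n// ltr1n.
  move=> x /andP[h _]; apply: cf; apply: lt_le_trans h; by rewrite invr_gt0 ltr0n.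
have [F HF] := choice pr.
have agree n m x : (n <= m)%N -> (n.+2%:R)^-1 < x < n.+2%:R -> F n x = F m x.
  move=> nm /andP[x1 x2].
  have nm2 : n.+2%:R <= m.+2%:R :> R by rewrite ler_nat.
  have nmV : (m.+2%:R)^-1 <= (n.+2%:R)^-1 :> R by rewrite lef_pV2 ?posrE ?ltr0n.
  have n1 : (n.+2%:R)^-1 < 1 :> R by rewrite invf_lt1 ?ltr0n// ltr1n.
  have n2 : 1 < n.+2%:R :> R by rewrite ltr1n.
  have [Fn1 Fn] := HF n; have [Fm1 Fm] := HF m.
  have /(der0_const (fun y => F n y + - F m y)) E y :
    Num.min x 1 <= y <= Num.max x 1 -> has_der (fun y => F n y + - F m y) y 0.
    rewrite ge_min le_max => /andP[/orP hy1 /orP hy2].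
    have hy : (n.+2%:R)^-1 < y < n.+2%:R.
      apply/andP; split; first by case: hy1 => h; [exact: lt_le_trans x1 h|exact: lt_le_trans n1 h].
      by case: hy2 => h; [exact: le_lt_trans h x2|exact: le_lt_trans h n2].
    apply: (has_der_eq _ _ (f y + - f y)); last by rewrite subrr.
    apply: has_derD; first exact: Fn.
    apply: has_derN; apply: Fm; case/andP: hy => y1 y2.
    by rewrite (le_lt_trans nmV y1) (lt_le_trans y2 nm2).
  have := E x 1; rewrite !ge_min !le_max !lexx !orbT /=.
  move=> /(_ isT isT); rewrite Fn1 Fm1; slra.
pose idx x : nat := Num.truncn (x + x^-1).
have idxP x : 0 < x -> ((idx x).+2%:R)^-1 < x < (idx x).+2%:R.
  move=> x0; have xi0 : 0 < x^-1 by rewrite invr_gt0.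
  have : x + x^-1 < (idx x).+1%:R by apply: truncnS_gt.
  move=> h; have e : (idx x).+2%:R = (idx x).+1%:R + 1 :> R by rewrite natr1.
  have n0 : 0 < (idx x).+2%:R :> R by rewrite ltr0n.
  have h1 : x < (idx x).+2%:R by rewrite e; slra.
  have h2 : x^-1 < (idx x).+2%:R by rewrite e; slra.
  rewrite h1 andbT -[ltRHS]invrK ltf_pV2 ?posrE//.
exists (fun x => F (idx x) x) => x x0.
pose m := maxn (idx (2 * x)) (idx (x / 2)).
have hm y : x / 2 < y < 2 * x -> (m.+2%:R)^-1 < y < m.+2%:R.
  move=> /andP[y1 y2].
  have /andP[h1 h2] := idxP (2 * x) (ltac:(slra)).
  have /andP[h3 h4] := idxP (x / 2) (ltac:(slra)).
  have i1 : (idx (2 * x)).+2%:R <= m.+2%:R :> R by rewrite ler_nat !ltnS leq_maxl.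
  have i2 : (m.+2%:R)^-1 <= ((idx (x / 2)).+2%:R)^-1 :> R.
    by rewrite lef_pV2 ?posrE ?ltr0n// ler_nat !ltnS leq_maxr.
  by apply/andP; split; [apply: le_lt_trans i2 _; apply: lt_trans h3 _|apply: lt_le_trans i1; apply: lt_trans h2]; slra.
apply: (has_der_near (F m)); first by have [_ H] := HF m; apply: H; apply: hm; slra.
apply/nbhs_ballP; exists (x / 2) => /=; first slra.
move=> y; rewrite /ball /= ltr_distl => /andP[y1 y2].
have y0 : 0 < y by slra.
have hy : (m.+2%:R)^-1 < y < m.+2%:R by apply: hm; slra.
case: (leqP (idx y) m) => h.
  by rewrite (agree (idx y) m)//; exact: idxP.
by rewrite (agree m (idx y))//; exact: ltnW.
Qed.

Lemma nondecreasing_has_lim0 f (f' : R -> R) c T : 0 < T ->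
  (forall x, 0 < x <= T -> has_der f x (f' x)) ->
  (forall x, 0 < x <= T -> 0 <= f' x) ->
  (forall x, 0 < x < T -> c <= f x) ->
  exists l, lim0 f l.
Proof.
move=> T0 hf p lb.
exists (inf (f @` [set` Interval (BRight 0) (BLeft T)])).
apply: nondecreasing_at_right_cvgr.
- by rewrite bnd_simp.
- move=> x y /=; rewrite !in_itv /= => /andP[x0 xT] /andP[y0 yT] xy.
  by apply: (der_ge0_le f f') => // z /andP[? ?]; [apply: hf|apply: p]; slra.
- by exists c => y [x hx <-]; apply: lb; move: hx; rewrite /= in_itv.
Qed.

(** Stands for the absolutely convergent integral of f from 0. Adding M makes a primitive
    nondecreasing, and comparison with M on ]0, 1] bounds it from below; so it has a limit at 0,
    which is then subtracted. *)
Lemma primitive0 f M (m : R -> R) :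
  (forall x, 0 < x -> {for x, continuous f}) ->
  (forall x, 0 < x -> has_der M x (m x)) -> lim0 M 0 ->
  (forall x, 0 < x -> `|f x| <= m x) ->
  exists F, [/\ forall x, 0 < x -> has_der F x (f x), lim0 F 0 &
    forall x, 0 < x -> `|F x| <= M x].
Proof.
move=> cf hM M0 fm; have [F hF] := has_primitive f cf.
have m0 x : 0 < x -> 0 <= m x by move=> x0; apply: le_trans (normr_ge0 _) (fm _ x0).
have fm' x : 0 < x -> - m x <= f x <= m x by move=> x0; rewrite -ler_norml fm.
have Mge0 x : 0 < x -> 0 <= M x.
  move=> x0; apply: (nondecreasing_lim0 M m 0 x) => //; last by rewrite x0 lexx.
  - by move=> y /andP[? _]; exact: hM.
  - by move=> y /andP[? _]; exact: m0.
have [|||| l hl] := @nondecreasing_has_lim0 (fun x => F x + M x) (fun x => f x + m x) (F 1 - M 1) 1.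
- exact: ltr01.
- by move=> x /andP[x0 _]; apply: has_derD; [exact: hF|exact: hM].
- by move=> x /andP[x0 _]; have := fm' _ x0; slra.
- move=> x /andP[x0 x1].
  have := @der_le_le _ F M f m x 1 (ltW x1).
  have h1 y : x <= y <= 1 -> has_der F y (f y) by move=> ?; apply: hF; slra.
  have h2 y : x <= y <= 1 -> has_der M y (m y) by move=> ?; apply: hM; slra.
  have h3 y : x < y < 1 -> f y <= m y by move=> ?; have := fm' y (ltac:(slra)); slra.
  by move=> /(_ h1 h2 h3); have := Mge0 x x0; slra.
have lF : lim0 F l.
  apply: (lim0_ext (fun x => (F x + M x) + - M x) _ _ 1) => //; first by move=> *; slra.
  by apply: lim0_eq (lim0D _ _ _ _ hl (lim0N _ _ M0)) _; slra.
exists (fun x => F x + - l); split.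
- move=> x x0; apply: has_der_eq (has_derD _ _ _ _ _ (hF x x0) (has_der_cst _ _)) _; slra.
- by apply: lim0_eq (lim0D _ _ _ _ lF (lim0_cst _)) _; slra.
- move=> x x0; have := @der_norm_lim0 _ F M f m l 0 x lF M0.
  move=> /(_ _ _ _ x); rewrite subr0; apply; rewrite ?x0 ?lexx//.
  + by move=> y /andP[? _]; exact: hF.
  + by move=> y /andP[? _]; exact: hM.
  + by move=> y /andP[? _]; exact: fm.
Qed.
End Primitives.

(** * The flow of the logarithmic variable *)

Section Flow.
Context {R : realType}.
Implicit Types (k H t p : R -> R).

Lemma sqr_lt1_itv (x : R) : x ^+ 2 < 1 -> -1 <= x /\ x <= 1.
Proof. by move=> ?; split; nra. Qed.

(* For a solution u of the equation and k = sqrt K, the logarithmic variable is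
   t = ln u + (n / 2) ln r + (ln K) / 4, and p = t' / k. *)
Definition flow (a b : R) k H t p := forall r, a <= r <= b ->
  has_der t r (k r * p r) /\ has_der p r (k r * (H r - 2 * t r - p r ^+ 2)).

Definition slope k H t p (h : R) r := expR (2 * t r) * (p r ^+ 2 + 2 * t r - h - 1).

Lemma flow_sub a b a' b' k H t p : a <= a' -> b' <= b -> flow a b k H t p -> flow a' b' k H t p.
Proof. by move=> h1 h2 h r rab; apply: h; slra. Qed.

(* expR (2 t) (p^2 + 2 t - h - 1) is the energy with H frozen at h. *)
Lemma slope_der a b k H t p h : flow a b k H t p -> forall r, a <= r <= b ->
  has_der (slope k H t p h) r (2 * k r * p r * expR (2 * t r) * (H r - h)).
Proof. by move=> fl r /fl[h1 h2]; rewrite /slope; der; rewrite /=; ring. Qed.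

Definition energy H t p r := expR (2 * t r) * (p r ^+ 2 + 2 * t r - H r - 1).

Lemma energy_der a b k H (H' : R -> R) t p : flow a b k H t p -> 
  (forall r, a <= r <= b -> has_der H r (H' r)) -> forall r, a <= r <= b ->
  has_der (energy H t p) r (- H' r * expR (2 * t r)).
Proof.
move=> fl hH r rab; have [h1 h2] := fl r rab; have h3 := hH r rab; rewrite /energy; der.
by rewrite /=; ring.
Qed.

Lemma flow_negative a b k H t p h : flow a b k H t p ->
  (forall r, a <= r <= b -> 1 <= k r) -> (forall r, a <= r <= b -> H r <= h) ->
  p a < 0 -> h + 1 < p a ^+ 2 + 2 * t a ->
  forall r, a <= r <= b -> p r < 0 /\ slope k H t p h a <= slope k H t p h r.
Proof.
move=> fl k1 Hh pa Sa.
have mono r : a <= r <= b -> (forall s, a <= s < r -> p s < 0) ->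
    slope k H t p h a <= slope k H t p h r.
  move=> /andP[ar rb] ps.
  apply: (der_ge0_le _ (fun r => 2 * k r * p r * expR (2 * t r) * (H r - h))) => //.
    by move=> s /andP[? ?]; apply: (slope_der a b) => //; slra.
  move=> s /andP[as_ sr]; have sab : a <= s <= b by slra.
  have := k1 s sab; have := Hh s sab; have := ps s ltac:(slra); have := expR_gt0 (2 * t s).
  move=> e0 p0 h0 k0.
  have -> : 2 * k s * p s * expR (2 * t s) * (H s - h) =
    2 * (k s * expR (2 * t s)) * (- p s * (h - H s)) by ring.
  by rewrite !mulr_ge0//; slra.
have pos0 : 0 < slope k H t p h a by rewrite /slope mulr_gt0 ?expR_gt0//; slra.
have neg r : a <= r <= b -> 0 < - p r.
  apply: (continuity_induction_cc (fun r => - p r) a b); first slra.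
  - move=> s sab; apply: (@has_der_cont _ _ _ _ (has_derN _ _ _ (fl s sab).2)).
  - move=> u /andP[au ub] hs.
    have hs' s : a <= s < u -> p s < 0 by move=> /hs; slra.
    suff : p u <= p a by slra.
    rewrite -lerN2; apply: (der_ge0_le (fun r => - p r)
       (fun r => - (k r * (H r - 2 * t r - p r ^+ 2)))) => //; first exact: ltW.
      by move=> s /andP[? ?]; apply: has_derN; apply: (fl s _).2; slra.
    move=> s /andP[as_ su]; have sab : a <= s <= b by slra.
    have := mono s sab (fun z hz => hs' z ltac:(slra)).
    move=> /(lt_le_trans pos0); rewrite /slope pmulr_rgt0 ?expR_gt0// => q.
    have := k1 s sab; have := Hh s sab => h1 h2.
    by rewrite -mulrN mulr_ge0//; slra.
move=> r rab; split; first by have := neg r rab; slra.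
by apply: mono => // s /andP[? ?]; have /andP[? ?] := rab; have := neg s ltac:(slra); slra.
Qed.

Lemma flow_cross a k H t p h : flow a (a + 3) k H t p ->
  (forall r, a <= r <= a + 3 -> 1 <= k r) -> (forall r, a <= r <= a + 3 -> H r <= h) ->
  p a < 0 -> h + 2 < p a ^+ 2 + 2 * t a -> False.
Proof.
move=> fl k1 Hh pa Sa.
have Sa1 : h + 1 < p a ^+ 2 + 2 * t a by slra.
have neg r (rab : a <= r <= a + 3) := (flow_negative _ _ _ _ _ _ _ fl k1 Hh pa Sa1 r rab).1.
have slp r (rab : a <= r <= a + 3) := (flow_negative _ _ _ _ _ _ _ fl k1 Hh pa Sa1 r rab).2.
have slpa : expR (2 * t a) < slope k H t p h a.
  by rewrite /slope ltr_pMr ?expR_gt0//; slra.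
have Spos r : a <= r <= a + 3 -> 0 < p r ^+ 2 + 2 * t r - h - 1.
  move=> rab; have := slp r rab; move=> /(lt_le_trans slpa) q.
  have : 0 < slope k H t p h r by apply: lt_trans q; exact: expR_gt0.
  by rewrite /slope pmulr_rgt0 ?expR_gt0.
have tmono r s : a <= r -> r <= s -> s <= a + 3 -> t s <= t r.
  move=> ar rs sb; rewrite -lerN2.
  apply: (der_ge0_le (fun r => - t r) (fun r => - (k r * p r))) => //.
    by move=> z /andP[? ?]; apply: has_derN; apply: (fl z _).1; slra.
  move=> z /andP[? ?]; have zab : a <= z <= a + 3 by slra.
  by have := neg z zab; have := k1 z zab => ? ?; rewrite -mulrN mulr_ge0//; slra.
have p1 : p (a + 1) <= -1.
  suff : a + 1 - a <= - p (a + 1) - - p a by slra.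
  have := @der_le_le _ (fun x => x) (fun r => - p r) (fun _ => 1)
    (fun r => - (k r * (H r - 2 * t r - p r ^+ 2))) a (a + 1) (ltac:(slra)).
  have d1 x : a <= x <= a + 1 -> has_der (fun x : R => x) x 1 by move=> _; exact: has_der_id.
  have d2 x : a <= x <= a + 1 -> has_der (fun r => - p r) x (- (k x * (H x - 2 * t x - p x ^+ 2))).
    by move=> ?; apply: has_derN; apply: (fl x _).2; slra.
  move=> /(_ d1 d2) q.
  apply: q => x xa; have xab : a <= x <= a + 3 by slra.
    have := Spos x xab; have := k1 x xab; have := Hh x xab => ? ? ?.
  by rewrite -mulrN; nra.
(* Second unit: if 2 t stayed above h + 1, then - p' >= p^2, so (1/p)' >= 1, and 1/p would climb
   from at least -1 to a nonnegative value. *)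
have t2 : 2 * t (a + 2) <= h + 1.
  rewrite leNgt; apply/negP => th.
  have pn r : a + 1 <= r <= a + 2 -> p r != 0.
    by move=> ?; rewrite lt_eqF//; apply: neg; slra.
  have := @der_le_le _ (fun x => x) (fun r => (p r)^-1) (fun _ => 1)
    (fun r => - (k r * (H r - 2 * t r - p r ^+ 2)) / p r ^+ 2) (a + 1) (a + 2) (ltac:(slra)).
  have d1 x : a + 1 <= x <= a + 2 -> has_der (fun x : R => x) x 1 by move=> _; exact: has_der_id.
  have d2 x : a + 1 <= x <= a + 2 ->
      has_der (fun r => (p r)^-1) x (- (k x * (H x - 2 * t x - p x ^+ 2)) / p x ^+ 2).
    by move=> xa; apply: has_derV; [exact: pn|apply: (fl x _).2; slra].
  move=> /(_ d1 d2) q; have : a + 2 - (a + 1) <= (p (a + 2))^-1 - (p (a + 1))^-1.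
    apply: q => x /andP[x1 x2]; have xab : a <= x <= a + 3 by slra.
    have px : 0 < p x ^+ 2 by rewrite lt_neqAle sqr_ge0 andbT eq_sym sqrf_eq0; apply: pn; slra.
    have := tmono x (a + 2) ltac:(slra) ltac:(slra) ltac:(slra) => tx.
    have := k1 x xab; have := Hh x xab => Hx kx.
    rewrite ler_pdivlMr// mul1r -mulrN; nra.
  have i1 : -1 <= (p (a + 1))^-1.
    have q1 : p (a + 1) * (p (a + 1))^-1 = 1 by rewrite divff// lt_eqF//; slra.
    by rewrite leNgt; apply/negP => ?; nra.
  have i2 : (p (a + 2))^-1 < 0 by rewrite invr_lt0; apply: neg; slra.
  by slra.
have slow r : a + 2 <= r <= a + 3 -> expR (t r) * p r <= - expR (t a).
  move=> /andP[r1 r2]; have rab : a <= r <= a + 3 by slra.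
  have tr := tmono (a + 2) r ltac:(slra) r1 r2.
  have := lt_le_trans slpa (slp r rab); rewrite /slope.
  have e2 s : expR (2 * t s) = expR (t s) ^+ 2 by rewrite expRM_natl.
  rewrite !e2 => q; have pr := neg r rab; have er := expR_gt0 (t r); have ea := expR_gt0 (t a).
  have : expR (t a) ^+ 2 < (expR (t r) * p r) ^+ 2.
    apply: lt_le_trans q _; rewrite exprMn; apply: ler_wpM2l; first exact: sqr_ge0.
    slra.
  have : expR (t r) * p r < 0 by rewrite pmulr_rlt0.
  move: (expR (t r) * p r) (expR (t a)) ea => X Y *; rewrite leNgt; apply/negP => ?; nra.
have := @der_le_le _ (fun r => expR (t r)) (fun r => - expR (t a) * r)
   (fun r => expR (t r) * (k r * p r)) (fun _ => - expR (t a)) (a + 2) (a + 3) (ltac:(slra)).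
have d1 x : a + 2 <= x <= a + 3 -> has_der (fun r => expR (t r)) x (expR (t x) * (k x * p x)).
  by move=> ?; apply: has_der_exp; apply: (fl x _).1; slra.
have d2 x : a + 2 <= x <= a + 3 -> has_der (fun r => - expR (t a) * r) x (- expR (t a)).
  by move=> _; der; ring.
move=> /(_ d1 d2) q.
have : expR (t (a + 3)) - expR (t (a + 2)) <= - expR (t a) * (a + 3) - - expR (t a) * (a + 2).
  apply: q => x /andP[x1 x2]; have xab : a <= x <= a + 3 by slra.
  have := slow x ltac:(slra); have := k1 x xab; have := neg x xab; have := expR_gt0 (t x).
  move=> ex px kx; rewrite [k x * p x]mulrC mulrA; apply: le_trans.
  have : expR (t x) * p x <= 0 by rewrite mulr_ge0_le0; slra.
  nra.
have : expR (t (a + 2)) <= expR (t a) by rewrite ler_expR; apply: tmono; slra.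
have := expR_gt0 (t (a + 3)); slra.
Qed.

(** A priori bound in the absence of crossing. At the level S the quantity p^2 + 2 t can only be
    reached with p >= 0, where its derivative 2 k p (H + 1 - p^2 - 2 t) is nonpositive. The bound on
    t from below comes from Gronwall's inequality. *)
Lemma flow_bounded a b k H t p h S : flow a b k H t p ->
  (forall r, a <= r <= b -> 1 <= k r <= 2) -> (forall r, a <= r <= b -> H r <= h) ->
  (forall r, a <= r <= b -> 0 <= p r \/ p r ^+ 2 + 2 * t r <= h + 2) ->
  p a ^+ 2 + 2 * t a <= S -> h + 2 <= S ->
  forall r, a <= r <= b ->
    2 * t r <= S /\ S + 1 - 2 * t r <= (S + 1 - 2 * t a) * expR (4 * (r - a)).
Proof.
move=> fl k12 Hh alt Sa hS.
have Sle r : a <= r <= b -> 0 <= S - (p r ^+ 2 + 2 * t r).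
  apply: (barrier_cc (fun r => S - (p r ^+ 2 + 2 * t r))
    (fun r => - (2 * k r * p r * (H r + 1 - (p r ^+ 2 + 2 * t r)))) a b).
  - slra.
  - by move=> x /fl[h1 h2]; der; rewrite /=; ring.
  - move=> x xab /andP[_ xneg]; have := Hh x xab; have /andP[k1 _] := k12 x xab => Hx.
    have [px|] := alt x xab; last by slra.
    by rewrite -mulrN mulr_ge0 ?mulr_ge0//; slra.
move=> r /andP[ar rb]; split.
  by have := Sle r ltac:(slra); have := sqr_ge0 (p r); slra.
(* The quantity z = S + 1 - 2 t is at least 1 + p^2, hence at least |p|, so z' = - 2 k p <= 4 z. *)
pose f s := - ((S + 1 - 2 * t s) * expR (- 4 * (s - a))).
have q : f a <= f r.
  apply: (der_ge0_le f (fun s => (2 * k s * p s + 4 * (S + 1 - 2 * t s)) * expR (- 4 * (s - a))) a r ar).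
  - by move=> x xab; have [h1 h2] := fl x ltac:(slra); rewrite /f; der; ring.
  - move=> x xab; have xab' : a <= x <= b by slra.
    rewrite mulr_ge0 ?expR_ge0//; have := Sle x xab'; have /andP[k1 k2] := k12 x xab'.
    move=> sx; have z1 : 1 <= S + 1 - 2 * t x by have := sqr_ge0 (p x); slra.
    have : - (S + 1 - 2 * t x) <= p x by nra.
    have : p x <= (S + 1 - 2 * t x) by nra.
    nra.
move: q; rewrite /f subrr mulr0 expR0 mulr1 lerN2 mulNr expRN => q.
by rewrite -ler_pdivrMr ?expR_gt0.
Qed.

(** The point y is the infimum of the points where f < 0; a positive derivative there would keep f
    positive just to the right. *)
Lemma first_negative (f f' : R -> R) a b : 0 <= f a ->
  (forall r, a <= r <= b -> has_der f r (f' r)) ->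
  (exists2 s, a <= s <= b & f s < 0) ->
  exists2 y, a <= y <= b & [/\ forall z, a <= z <= y -> 0 <= f z, f y = 0 & f' y <= 0].
Proof.
move=> fa hf [s /andP[as_ sb] fs].
pose A := [set z | a <= z <= s /\ f z < 0].
have As : A s by rewrite /A /= as_ lexx.
have lbA : lbound A a by move=> z [/andP[]].
have hiA : has_inf A by split; [exists s|exists a].
pose y := inf A.
have ay : a <= y by apply: lb_le_inf => //; exists s.
have ys : y <= s by apply: ge_inf => //; exists a.
have yab : a <= y <= b by rewrite ay (le_trans ys).
have below z : a <= z < y -> 0 <= f z.
  move=> /andP[az zy]; rewrite leNgt; apply/negP => fz.
  suff : y <= z by rewrite leNgt zy.
  by apply: ge_inf; [exists a|split=> //; rewrite az (le_trans (ltW zy))].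
have cf z : a <= z <= b -> {for z, continuous f} by move=> /hf /has_der_cont.
have fy0 : 0 <= f y.
  rewrite leNgt; apply/negP => fy.
  have cN : {for y, continuous (fun z => - f z)} by apply: continuousN; exact: cf.
  have [|d d0 hd] := continuous_gt0 _ _ cN; first slra.
  move: ay; rewrite le_eqVlt => /orP[/eqP ya|ay'].
    by move: fy; rewrite -ya ltNge fa.
  have [u [/andP[u0 ud] /andP[_ uy]]] := small_between _ _ d0 (ltac:(slra) : 0 < y - a).
  have := below (y - u) ltac:(slra); have := hd (y - u); rewrite ltr0_norm; last by slra.
  by move=> /(_ ltac:(slra)); slra.
have fyA e : 0 < e -> exists2 z, y <= z < y + e & f z < 0.
  move=> e0; have [z [zs fz] ze] := inf_adherent e0 hiA.
  exists z => //; rewrite ze andbT; apply: ge_inf; first by exists a.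
  by split.
have fy : f y = 0.
  apply/eqP; rewrite eq_le fy0 andbT leNgt; apply/negP => fyp.
  have [d d0 hd] := continuous_gt0 _ _ (cf y yab) fyp.
  have [z /andP[yz zd] fz] := fyA d d0.
  by have := hd z; rewrite ger0_norm ?subr_ge0// => /(_ ltac:(slra)); slra.
exists y => //; split => //.
  move=> z /andP[az]; rewrite le_eqVlt => /orP[/eqP->//|zy]; by apply: below; rewrite az.
rewrite leNgt; apply/negP => f'y.
have [df df'] := hf y yab.
have : (fun h => h^-1 *: (f (h *: 1 + y) - f y)) @ 0^' --> f' y.
  by rewrite -df'; exact: df.
move=> /cvgrPdist_lt /(_ _ f'y) /nbhs_ballP[d /= d0 hd].
have [z /andP[yz zd] fz] := fyA d d0.
have zy : z - y != 0.
  by rewrite subr_eq0; apply/eqP => zy; move: fz; rewrite zy fy ltxx.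
have zy0 : 0 < z - y by rewrite lt_neqAle eq_sym zy subr_ge0.
have := hd (z - y); rewrite /ball /= sub0r normrN gtr0_norm// => /(_ ltac:(slra) zy).
rewrite /GRing.scale /= mulr1 subrK fy subr0 ltr_distlC => /andP[q _].
have : 0 < (z - y)^-1 * f z by slra.
by rewrite pmulr_rgt0 ?invr_gt0//; slra.
Qed.

(** Bootstrap on the squared displacement of (p, t) staying below 1. While it does, |p'| <= 2 (h + T
    + P^2) <= B and |t'| <= 2 P <= B, so each component moves by at most L B <= 1/2 and the squared
    displacement is at most 1/2. *)
Lemma flow_short x L k H t p (h T P B : R) : flow x (x + L) k H t p ->
  (forall r, x <= r <= x + L -> 1 <= k r <= 2) ->
  (forall r, x <= r <= x + L -> `|H r| <= h) ->
  `|p x| + 1 <= P -> `|2 * t x| + 2 <= T -> B = 2 * (h + T + P ^+ 2) + 2 * P ->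
  0 < L -> L * B <= 1 / 2 ->
  forall r, x <= r <= x + L -> -1 <= t r - t x <= 1.
Proof.
move=> fl k12 Hh px tx eB L0 LB.
have px0 := normr_ge0 (p x); have tx0 := normr_ge0 (2 * t x).
have h0 : 0 <= h by apply: le_trans (normr_ge0 _) (Hh x _); slra.
have P2 := sqr_ge0 P.
have T0 : 0 <= T by clear -tx tx0; lra.
have P0 : 0 <= P by clear -px px0; lra.
suff key r : x <= r <= x + L -> 0 < 1 - (p r - p x) ^+ 2 - (t r - t x) ^+ 2.
  move=> r /key q; have := sqr_ge0 (p r - p x) => q1.
  by apply/andP; apply: sqr_lt1_itv; have := sqr_ge0 (t r - t x); clear -q q1; lra.
apply: (continuity_induction_cc (fun r => 1 - (p r - p x) ^+ 2 - (t r - t x) ^+ 2)).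
- by rewrite !subrr expr0n /= !subr0.
- move=> z /fl[h1 h2]; apply: has_der_cont.
  der; reflexivity.
move=> y /andP[xy yL] hs.
have bd z : x <= z < y -> `|p z| <= P /\ `|2 * t z| <= T.
  move=> zx; have := hs z zx => q.
  have q1 : (p z - p x) ^+ 2 < 1 by have := sqr_ge0 (t z - t x); slra.
  have q2 : (t z - t x) ^+ 2 < 1 by have := sqr_ge0 (p z - p x); slra.
  have [a1 a2] := sqr_lt1_itv _ q1.
  have [a3 a4] := sqr_lt1_itv _ q2.
  have := ler_norm (p x); have := ler_normr (- p x) (p x); 
  have := ler_norm (2 * t x); have := ler_norm (- (2 * t x)); have := ler_norm (- p x).
  rewrite !normrN => b1 b2 b3 _ b4; rewrite !ler_norml.
  by clear -px tx a1 a2 a3 a4 b1 b2 b3 b4; split; apply/andP; split; lra.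
have dp z : x <= z < y -> `|k z * (H z - 2 * t z - p z ^+ 2)| <= B /\ `|k z * p z| <= B.
  move=> zx; have [b1 b2] := bd z zx.
  have zL : x <= z <= x + L by case/andP: zx => -> /ltW /le_trans ->.
  have /andP[k1 k2] := k12 z zL; have Hz := Hh z zL.
  have k0 : 0 <= k z by slra.
  have p2 : `|p z ^+ 2| <= P ^+ 2 by rewrite normrX lerXn2r ?nnegrE.
  rewrite !normrM (ger0_norm k0).
  have := ler_normB (H z - 2 * t z) (p z ^+ 2); have := ler_normB (H z) (2 * t z).
  move=> n1 n2; have := normr_ge0 (H z - 2 * t z - p z ^+ 2); have := normr_ge0 (p z) => n3 n4.
  split.
    apply: (@le_trans _ _ (2 * (h + T + P ^+ 2))); last by rewrite eB lerDl mulr_ge0.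
    by apply: ler_pM => //; clear -n1 n2 p2 b2 Hz; lra.
  apply: (@le_trans _ _ (2 * P)); first by apply: ler_pM.
  by rewrite eB lerDr mulr_ge0 ?addr_ge0.
have B0 : 0 <= B by rewrite eB !addr_ge0 ?mulr_ge0 ?addr_ge0.
have close (f f' : R -> R) : (forall z, x <= z <= y -> has_der f z (f' z)) ->
    (forall z, x <= z < y -> `|f' z| <= B) -> (f y - f x) ^+ 2 <= 1 / 4.
  move=> df bf.
  have [c cxy e1] := mean_value f f' x y xy df.
  have := bf c ltac:(slra); rewrite ler_norml e1 => /andP[c1 c2].
  have yx : 0 <= y - x <= L by slra.
  have : -(1/2) <= f' c * (y - x) <= 1/2 by clear -c1 c2 yx LB B0; apply/andP; split; nra.
  by clear; move=> /andP[? ?]; nra.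
have sub z : x <= z <= y -> x <= z <= x + L by slra.
have := close p _ (fun z zx => (fl z (sub z zx)).2) (fun z zx => (dp z zx).1).
have := close t _ (fun z zx => (fl z (sub z zx)).1) (fun z zx => (dp z zx).2).
by clear; slra.
Qed.

(** A negative energy survives a short stretch where H' may be negative: the gain there is
    outweighed by the loss on the second half of the window, provided the weight exp (2 t) is not
    much smaller later than earlier. The bound on e must not depend on the solution, so this
    comparison has to be uniform in the data at x, about which only p >= 0 and E < 0 are known. *)
Lemma flow_middle (h : R) : 0 < h -> exists2 L0, 0 < L0 <= 1 &
  forall L c0 C1, 0 < L <= L0 -> 0 < c0 -> 0 < C1 -> exists2 e, 0 < e & 
  forall e' k H (H' : R -> R) t p x, 0 < e' <= e -> flow x (x + L) k H t p ->
    (forall r, x <= r <= x + L -> 1 <= k r <= 2) ->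
    (forall r, x <= r <= x + L -> `|H r| <= h) ->
    (forall r, x <= r <= x + L -> has_der H r (H' r)) ->
    (forall r, x <= r <= x + 2 * e' -> - C1 <= H' r) ->
    (forall r, x + 2 * e' <= r <= x + L -> 0 <= H' r) ->
    (forall r, x + L / 2 <= r <= x + L -> c0 <= H' r) ->
    0 <= p x -> energy H t p x < 0 -> energy H t p (x + L) < 0.
Proof.
(* [La] will bound h + 2 - 2 t(x) and p(x) when p changes sign in the window; [P] and [B] are the
   matching constants of [flow_short]. *)
move=> h0; pose La := (2 * h + 2) * expR 4; pose P := La + 1.
pose B : R := 2 * (h + (La + 2 * h + 4) + P ^+ 2) + 2 * P.
have e4 : 1 <= expR 4 :> R by rewrite -[leLHS]expR0 ler_expR.
have La1 : 1 <= La by rewrite /La; nra.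
have B0 : 2 <= B by rewrite /B; have := sqr_ge0 P; rewrite /P; slra.
exists (2 * B)^-1.
  by rewrite invr_gt0 mulr_gt0 ?invf_le1//; slra.
move=> L c0 C1 /andP[L0 LB] c00 C10.
have LB' : L * B <= 1 / 2.
  move: LB; rewrite -[(2 * B)^-1]mul1r ler_pdivlMr; last by slra.
  by move=> ?; slra.
have L1 : L <= 1 by nra.
(* In terms of a reference weight W, the gain is at most 2 e C1 exp(4) W <= c0 L W / 4, and the loss
   is at least c0 L W / 2. The bound L / 4 keeps the bad stretch in the first half. *)
exists (Num.min (L / 4) (c0 * L / (8 * C1 * expR 4))).
  by rewrite lt_min !divr_gt0// ?mulr_gt0// ?expR_gt0.
move=> e k H H' t p x /andP[e0]; rewrite le_min => /andP[eL ec] fl k12 Hh hH H1 H2 H3 px Ex.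
have Hh' r : x <= r <= x + L -> - h <= H r <= h by move=> /Hh; rewrite ler_norml.
have ec' : 8 * C1 * expR 4 * e <= c0 * L.
  move: ec; rewrite ler_pdivlMr ?mulr_gt0 ?expR_gt0//; first by move=> ?; slra.
have Fx : p x ^+ 2 + 2 * t x - H x - 1 < 0.
  by move: Ex; rewrite /energy pmulr_rlt0 ?expR_gt0.
have /andP[hx1 hx2] := Hh' x (ltac:(slra)).
have Sle y : x <= y <= x + L -> (forall z, x <= z <= y -> 0 <= p z) ->
    forall z, x <= z <= y -> 0 <= h + 1 - (p z ^+ 2 + 2 * t z).
  move=> /andP[xy yL] pz.
  apply: (barrier_cc (fun r => h + 1 - (p r ^+ 2 + 2 * t r))
    (fun r => - (2 * k r * p r * (H r + 1 - (p r ^+ 2 + 2 * t r)))) x y).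
  - slra.
  - by move=> z zx; have [h1 h2] := fl z ltac:(slra); der; rewrite /=; ring.
  - move=> z zx /andP[_ zneg]; have zL : x <= z <= x + L by slra.
    have := Hh' z zL; have := k12 z zL; have := pz z zx => pz0 /andP[k1 _] /andP[_ Hz].
    have k0 : 0 <= k z by apply: le_trans k1.
    by rewrite -mulrN mulr_ge0 ?mulr_ge0//; clear -Hz zneg; lra.
(* All that is used of the weight: up to the factor exp 4, W bounds it from above on the bad stretch
   and from below afterwards. *)
suff [W W0 [W1 W2]] : exists2 W, 0 < W &
    (forall r, x <= r <= x + 2 * e -> expR (2 * t r) <= expR 4 * W) /\
    (forall r, x + 2 * e <= r <= x + L -> W <= expR (2 * t r)).
  have EL : flow x (x + L) k H t p by [].
  have dE := energy_der _ _ _ _ _ _ _ fl hH.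
  have E1 : energy H t p (x + 2 * e) - energy H t p x <= C1 * expR 4 * W * (x + 2 * e) - C1 * expR 4 * W * x.
    apply: (der_le_le _ _ (fun r => - H' r * expR (2 * t r)) (fun _ => C1 * expR 4 * W)).
    - slra.
    - by move=> r ?; apply: dE; slra.
    - by move=> r _; der; ring.
    - move=> r /andP[r1 r2]; have := H1 r ltac:(slra); have := W1 r ltac:(slra).
      have := expR_gt0 (2 * t r) => q1 q2 q3.
      apply: (@le_trans _ _ (C1 * expR (2 * t r))); first by rewrite ler_pM2r//; slra.
      by rewrite -mulrA ler_pM2l.
  have E2 : energy H t p (x + L / 2) <= energy H t p (x + 2 * e).
    rewrite -lerN2; apply: (der_ge0_le (fun r => - energy H t p r) (fun r => - (- H' r * expR (2 * t r)))).
    - slra.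
    - by move=> r ?; apply: has_derN; apply: dE; slra.
    - move=> r /andP[r1 r2]; have := H2 r ltac:(slra) => q.
      by rewrite mulNr opprK mulr_ge0 ?expR_ge0.
  have E3 : energy H t p (x + L) - energy H t p (x + L / 2) <= - c0 * W * (x + L) - - c0 * W * (x + L / 2).
    apply: (der_le_le _ _ (fun r => - H' r * expR (2 * t r)) (fun _ => - c0 * W)).
    - slra.
    - by move=> r ?; apply: dE; slra.
    - by move=> r _; der; ring.
    - move=> r /andP[r1 r2]; have := H3 r ltac:(slra); have := W2 r ltac:(slra).
      move=> q1 q2; rewrite !mulNr lerN2; apply: ler_pM => //; slra.
  have m1 := ler_wpM2r (ltW W0) ec'.
  have m2 : 0 < c0 * L * W by rewrite !mulr_gt0.
  by clear -E1 E2 E3 m1 m2 Ex; lra.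
(* If p stays nonnegative, t is nondecreasing and the weight at x + 2 e serves as W, however large
   or small the data are. *)
case: (pselect (exists2 s, x <= s <= x + L & p s < 0)) => [ex|nex]; last first.
  have pz z : x <= z <= x + L -> 0 <= p z.
    by move=> zx; rewrite leNgt; apply/negP => pz; apply: nex; exists z.
  have tm r s : x <= r -> r <= s -> s <= x + L -> t r <= t s.
    move=> xr rs sL; apply: (der_ge0_le t (fun r => k r * p r)) => //.
      by move=> z ?; apply: (fl z _).1; slra.
    move=> z ?; have := k12 z ltac:(slra); have := pz z ltac:(slra) => ? ?.
    by rewrite mulr_ge0//; slra.
  exists (expR (2 * t (x + 2 * e))); first exact: expR_gt0.
  split=> r /andP[r1 r2]; last by rewrite ler_expR ler_pM2l// tm//; slra.
  apply: (@le_trans _ _ (expR (2 * t (x + 2 * e)))); last by rewrite ler_peMl// expR_ge0.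
  by rewrite ler_expR ler_pM2l// tm//; slra.
have Zx : h + 2 - 2 * t x <= La.
  have [y /andP[xy yL] [pz py p'y]] := first_negative p _ x (x + L) px (fun r hr => (fl r hr).2) ex.
  have yxL : x <= y <= x + L by rewrite xy.
  have Sz := Sle y yxL pz.
  have ky := k12 y yxL; have Hy := Hh' y yxL.
  (* At the first zero y of p before it turns negative, p' <= 0 reads H <= 2 t. Going back from y to
     x by Gronwall's inequality bounds t(x) from below, and then p(x) through E < 0. *)
  have ty : - h <= 2 * t y.
    move: p'y; have ky0 : 0 < k y by clear -ky; lra.
    by rewrite py expr0n /= subr0 pmulr_rle0// => p'y; clear -p'y Hy; lra.
  pose f r := (h + 2 - 2 * t r) * expR (4 * (r - x)).
  have : f x <= f y.
    apply: (der_ge0_le f (fun r => (4 * (h + 2 - 2 * t r) - 2 * (k r * p r)) * expR (4 * (r - x)))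
      x y xy).
    - move=> z /andP[xz zy]; have zL : z <= x + L := le_trans zy yL.
      by have [h1 h2] := fl z ltac:(by rewrite xz); rewrite /f; der; ring.
    - move=> z /andP[xz zy]; rewrite mulr_ge0 ?expR_ge0//.
      have zL : z <= x + L := le_trans (ltW zy) yL.
      have xzy : x <= z <= y by rewrite !ltW.
      have := Sz z xzy; have := pz z xzy; have := k12 z ltac:(by rewrite ltW).
      by clear; move=> ? ? ?; nra.
  rewrite /f.
  rewrite subrr mulr0 expR0 mulr1 => q; apply: le_trans q _; rewrite /La.
  have yx1 : 4 * (y - x) <= 4 by clear -xy yL L1; lra.
  have Sy := Sz y ltac:(by rewrite xy lexx); have py2 := sqr_ge0 (p y).
  by apply: ler_pM; rewrite ?expR_ge0 ?ler_expR//; [clear -Sy py2|clear -ty h0]; lra.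
have p2x : p x <= La by clear -Zx Fx hx1 hx2 h0 La1 px; nra.
exists (expR (2 * t x - 2)); first exact: expR_gt0.
have key1 r : x <= r <= x + L -> -1 <= t r - t x <= 1.
  apply: (flow_short _ _ _ _ _ _ h (La + 2 * h + 4) P B fl k12 Hh) => //.
  - by rewrite ger0_norm// /P lerD2r.
  - have q : `|2 * t x| <= La + 2 * h + 2.
      have := sqr_ge0 (p x); clear -Zx Fx hx1 hx2 h0 La1 => ?.
      by rewrite ler_norml; apply/andP; split; slra.
    by clear -q; slra.
split=> r rx; have /andP[q1 q2] := key1 r (ltac:(clear -rx eL L0 e0; slra)); clear -q1 q2.
  by rewrite -expRD ler_expR; slra.
by rewrite ler_expR; slra.
Qed.

(** The flow is reversible: reflecting r and changing the sign of p preserves it, and the energy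
    only sees p^2. This turns the case p < 0 into p >= 0 on a window to the left. *)
Lemma flow_reflect a b x k H t p : flow a b k H t p ->
  flow (2 * x - b) (2 * x - a) (fun r => k (2 * x - r)) (fun r => H (2 * x - r))
    (fun r => t (2 * x - r)) (fun r => - p (2 * x - r)).
Proof.
move=> fl r rab; have [h1 h2] := fl (2 * x - r) ltac:(slra).
have hr : has_der (fun r => 2 * x - r) r (- 1).
  by der; ring.
split; first by apply: has_der_eq (has_der_comp _ _ _ _ _ hr h1) _; ring.
by apply: has_der_eq (has_derN _ _ _ (has_der_comp _ _ _ _ _ hr h2)) _; ring.
Qed.

(** * Asymptotics of decaying solutions *)

Section Decay.
Variables (H H' t p : R -> R) (R0 c : R).
Hypothesis R00 : 0 < R0.
Hypothesis fl : forall b, flow R0 b (fun=> 1) H t p.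
Hypothesis hH : forall r, R0 <= r -> has_der H r (H' r).
Hypothesis H'0 : forall r, R0 <= r -> 0 <= H' r.
Hypothesis B2 : forall r, R0 <= r -> 2 <= H r - 2 * t r.
Hypothesis pc : forall r, R0 <= r -> p r <= 1 / 2.

Let ht r : R0 <= r -> has_der t r (p r).
Proof.
move=> Rr; have [h1 _] := fl r r (ltac:(lra)); apply: has_der_eq h1 _; ring.
Qed.
Let hp r : R0 <= r -> has_der p r (H r - 2 * t r - p r ^+ 2).
Proof.
move=> Rr; have [_ h1] := fl r r (ltac:(lra)); apply: has_der_eq h1 _; ring.
Qed.

(** For p in ]-1, 1/2] one has p' >= 2 - p^2 >= 1, so a value above -1 would push p beyond 1/2
    within length 2. *)
Lemma decay_slope r : R0 <= r -> p r <= - 1.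
Proof.
move=> Rr; rewrite leNgt; apply/negP => pr.
have pos s : r <= s <= r + 2 -> 0 < p s + 1.
  apply: (continuity_induction_cc (fun s => p s + 1)); first lra.
  - move=> x xr; apply: has_der_cont; apply: has_derD; last exact: has_der_cst.
    by apply: hp; lra.
  - move=> u /andP[ru ur] hs; suff : p r <= p u by lra.
    apply: (der_ge0_le p (fun s => H s - 2 * t s - p s ^+ 2)); first lra.
      by move=> z ?; apply: hp; lra.
    move=> z ?; have := hs z ltac:(lra); have := B2 z ltac:(lra); have := pc z ltac:(lra).
    by move=> ? ? ?; nra.
have := @der_le_le _ (fun s => s) p (fun _ => 1) (fun s => H s - 2 * t s - p s ^+ 2) r (r + 2)
  (ltac:(lra)) (fun s _ => has_der_id s) (fun s hs => hp s (ltac:(lra))).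
move=> q; have : r + 2 - r <= p (r + 2) - p r.
  apply: q => s ?; have := pos s ltac:(lra); have := B2 s ltac:(lra); have := pc s ltac:(lra).
  by move=> ? ? ?; nra.
by have := pc (r + 2) ltac:(lra); lra.
Qed.

Lemma decay_log r : R0 <= r -> t r <= t R0 - (r - R0).
Proof.
move=> Rr; have := @der_le_le _ t (fun s => - s) p (fun _ => - 1) R0 r Rr
  (fun s hs => ht s (ltac:(lra))) (fun s _ => has_derN _ _ _ (has_der_id s)).
move=> q; have : t r - t R0 <= - r - - R0.
  by apply: q => s ?; apply: decay_slope; lra.
lra.
Qed.

Let dE r : R0 <= r -> has_der (energy H t p) r (- H' r * expR (2 * t r)).
Proof.
move=> Rr; apply: (energy_der R0 r (fun=> 1)); [exact: fl| |lra].
by move=> s ?; apply: hH; lra.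
Qed.

Lemma energy_mono r s : R0 <= r -> r <= s -> energy H t p s <= energy H t p r.
Proof.
move=> Rr rs; rewrite -lerN2.
pose E z := - energy H t p z; suff : E r <= E s by [].
apply: (der_ge0_le E (fun r => - (- H' r * expR (2 * t r))) _ _ rs).
- by move=> z ?; apply: has_derN; apply: dE; lra.
- by move=> z ?; rewrite mulNr opprK mulr_ge0 ?expR_ge0// H'0//; lra.
Qed.

(** A negative energy stays below some - e. Divided by exp (2 t), which tends to 0, it forces p' >=
    e exp (- 2 t) - 1, which becomes at least 1; p then grows beyond the bound -1. *)
Lemma decay_energy_ge0 r : R0 <= r -> 0 <= energy H t p r.
Proof.
move=> Rr; rewrite leNgt; apply/negP => Er; pose e := - energy H t p r.
have e0 : 0 < e by rewrite /e; lra.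
(* Beyond x, [decay_log] gives - 2 t >= 2 / e, and exp y >= 1 + y yields e exp (- 2 t) >= 2. *)
pose x := Num.max r (R0 + e^-1 + `|t R0| + 1).
have rx : r <= x by rewrite le_max lexx.
have xe : R0 + e^-1 + `|t R0| + 1 <= x by rewrite le_max lexx orbT.
have big s : x <= s -> 1 <= H s - 2 * t s - p s ^+ 2.
  move=> xs; have Es := energy_mono r s Rr ltac:(lra).
  have ts := decay_log s ltac:(lra); have := ler_norm (t R0) => tn.
  have : 2 <= e * expR (- (2 * t s)).
    have := expR_ge1Dx (- (2 * t s)) => q.
    have : e * (2 * e^-1) <= e * expR (- (2 * t s)) by rewrite ler_pM2l//; lra.
    by rewrite mulrCA divff ?gt_eqF// mulr1.
  move: Es; rewrite -/e /energy => Es.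
  have : p s ^+ 2 + 2 * t s - H s - 1 <= - (e * expR (- (2 * t s))).
    have ee : expR (2 * t s) * expR (- (2 * t s)) = 1 by rewrite -expRD subrr expR0.
    have ep := expR_gt0 (2 * t s).
    rewrite -(ler_pM2l ep) mulrN mulrCA ee mulr1; apply: le_trans Es _.
    by rewrite /e opprK.
  lra.
have px := decay_slope x ltac:(lra).
have := @der_le_le _ (fun s => s) p (fun _ => 1) (fun s => H s - 2 * t s - p s ^+ 2) x (x + 1 - p x)
  (ltac:(lra)) (fun s _ => has_der_id s) (fun s hs => hp s (ltac:(lra))).
move=> q; have : x + 1 - p x - x <= p (x + 1 - p x) - p x.
  by apply: q => s ?; apply: big; lra.
by have := decay_slope (x + 1 - p x) ltac:(lra); lra.
Qed.

(** Since 2 t - H - 1 <= 0, an energy that stays above e gives (exp t p)^2 >= e with p < 0; then exp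
    t decreases at the rate sqrt e and would reach 0. *)
Lemma decay_energy_small r e : R0 <= r -> 0 < e -> exists2 s, r <= s & energy H t p s < e.
Proof.
move=> Rr e0.
case: (pselect (exists2 s, r <= s & energy H t p s < e)) => // nex; exfalso.
have big s : r <= s -> e <= energy H t p s.
  by move=> rs; rewrite leNgt; apply/negP => q; apply: nex; exists s.
pose se := Num.sqrt e; have se0 : 0 < se by rewrite sqrtr_gt0.
have se2 : se ^+ 2 = e by rewrite sqr_sqrtr// ltW.
have slow s : r <= s -> expR (t s) * p s <= - se.
  move=> rs; have := big s rs; rewrite /energy.
  have -> : expR (2 * t s) = expR (t s) ^+ 2 by rewrite expRM_natl.
  move=> q; have := decay_slope s ltac:(lra); have := B2 s ltac:(lra) => b ps.
  have et := expR_gt0 (t s).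
  have : se ^+ 2 <= (expR (t s) * p s) ^+ 2.
    rewrite se2; apply: le_trans q _; rewrite exprMn; apply: ler_wpM2l; first exact: sqr_ge0.
    lra.
  have : expR (t s) * p s < 0 by rewrite pmulr_rlt0//; lra.
  move: (expR (t s) * p s) => X *; rewrite leNgt; apply/negP => ?; nra.
pose x := r + expR (t r) / se.
have rx : r <= x by rewrite /x lerDl divr_ge0 ?expR_ge0// ltW.
have := @der_le_le _ (fun s => expR (t s)) (fun s => - se * s) (fun s => expR (t s) * p s)
  (fun _ => - se) r x rx.
have d1 s : r <= s <= x -> has_der (fun s => expR (t s)) s (expR (t s) * p s).
  by move=> ?; apply: has_der_exp; apply: ht; lra.
have d2 s : r <= s <= x -> has_der (fun s => - se * s) s (- se).
  by move=> _; der; ring.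
move=> /(_ d1 d2) q; have : expR (t x) - expR (t r) <= - se * x - - se * r.
  by apply: q => s ?; apply: slow; lra.
have -> : - se * x - - se * r = - expR (t r).
  by rewrite /x; field; rewrite gt_eqF.
by have := expR_gt0 (t x); lra.
Qed.
End Decay.

End Flow.

(** * Initial value problems *)

Section Geometric.
Context {R : realType}.

Lemma half_pow_small (C e : R) : 0 < e -> exists k, C / 2 ^+ k < e.
Proof.
move=> e0; pose k := (Num.truncn (C / e)).+1; exists k.
have h : C / e < k%:R by rewrite /k; exact: truncnS_gt.
have h2 : k%:R <= 2 ^+ k :> R by rewrite -natrX ler_nat ltnW// ltn_expl.
have p : 0 < 2 ^+ k :> R by rewrite exprn_gt0.
by rewrite ltr_pdivrMr// mulrC -ltr_pdivrMr// (lt_le_trans h h2).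
Qed.

Lemma half_powS (C : R) k : C / 2 ^+ k.+1 = C / 2 ^+ k / 2.
Proof. by rewrite exprS invfM mulrCA mulrC. Qed.

Lemma geometric_limit (x : nat -> R) (C : R) :
  (forall k, `|x k.+1 - x k| <= C / 2 ^+ k) ->
  exists l, forall k, `|l - x k| <= 2 * C / 2 ^+ k.
Proof.
move=> h; pose lo k := x k - 2 * C / 2 ^+ k; pose hi k := x k + 2 * C / 2 ^+ k.
have C0 : 0 <= C.
  by have := le_trans (normr_ge0 _) (h 0%N); rewrite expr0 divr1.
have c0 k : 0 <= C / 2 ^+ k by rewrite divr_ge0// exprn_ge0.
have step k : lo k <= lo k.+1 /\ hi k.+1 <= hi k.
  have := h k; rewrite ler_norml /lo /hi -!mulrA half_powS => /andP[h1 h2].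
  by split; slra.
have lo_mono j k : (j <= k)%N -> lo j <= lo k.
  elim: k => [|k ih]; first by rewrite leqn0 => /eqP ->.
  rewrite leq_eqVlt => /orP[/eqP->//|]; rewrite ltnS => /ih h1.
  by apply: le_trans h1 _; have [] := step k.
have hi_mono j k : (j <= k)%N -> hi k <= hi j.
  elim: k => [|k ih]; first by rewrite leqn0 => /eqP ->.
  rewrite leq_eqVlt => /orP[/eqP->//|]; rewrite ltnS => /ih h1.
  by apply: le_trans h1; have [] := step k.
have lohi j k : lo j <= hi k.
  have a1 := lo_mono _ _ (leq_maxl j k); have a2 := hi_mono _ _ (leq_maxr j k).
  apply: le_trans a1 (le_trans _ a2); rewrite /lo /hi -!mulrA.
  by have := c0 (maxn j k); slra.
have hs : has_sup (range lo).
  by split; [exists (lo 0%N), 0%N|exists (hi 0%N) => _ [j _ <-]].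
exists (sup (range lo)) => k; rewrite ler_norml; apply/andP; split.
  have : lo k <= sup (range lo) by apply: ub_le_sup; [case: hs|exists k].
  by rewrite /lo; slra.
have : sup (range lo) <= hi k by apply: ge_sup; [exists (lo 0%N), 0%N|move=> _ [j _ <-]].
by rewrite /hi; slra.
Qed.

Lemma eq_of_half_pow (x y C : R) : (forall k, `|x - y| <= C / 2 ^+ k) -> x = y.
Proof.
move=> h; apply/eqP; rewrite -subr_eq0 -normr_eq0 eq_le normr_ge0 andbT.
rewrite leNgt; apply/negP => p; have [k hk] := half_pow_small C _ p.
by have := h k; rewrite leNgt hk.
Qed.

Lemma le_of_half_pow (x y C : R) : (forall k, x <= y + C / 2 ^+ k) -> x <= y.
Proof.
move=> h; rewrite leNgt; apply/negP => p.
have [k hk] := half_pow_small C (x - y) (ltac:(slra)).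
by have := h k; slra.
Qed.
End Geometric.

Section SingularIVP.
Context {R : realType} (n : nat) (m M : R -> R).
Hypothesis hM : forall r, 0 < r -> has_der M r (m r).
Hypothesis m0 : forall r, 0 < r -> 0 <= m r.
Hypothesis M0 : lim0 M 0.

Lemma exprn_pred (r : R) k : r != 0 -> k%:R * r ^+ k.-1 = k%:R / r * r ^+ k.
Proof.
by case: k => [|k] r0; rewrite ?mul0r//= exprS -mulrA mulKf.
Qed.

Lemma M_ge0 r : 0 < r -> 0 <= M r.
Proof.
move=> r0; apply: (nondecreasing_lim0 M m 0 r) => //; last by rewrite r0 lexx.
- by move=> y /andP[? _]; exact: hM.
- by move=> y /andP[? _]; exact: m0.
Qed.

Lemma M_mono r s : 0 < r -> r <= s -> M r <= M s.
Proof.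
move=> r0 rs; apply: (der_ge0_le M m) => // x /andP[? ?].
- by apply: hM; lra.
- by apply: m0; lra.
Qed.

Lemma flux_der (w1 : R -> R) (h : R) r : 0 < r -> has_der w1 r (h - n%:R / r * w1 r) ->
  has_der (fun r => r ^+ n * w1 r) r (r ^+ n * h).
Proof.
move=> r0 hw; have rn0 : r != 0 by rewrite gt_eqF.
der; rewrite exprn_pred// mulr1; ring.
Qed.

(** Two integrations from 0 in an exponentially weighted norm. In the first, r^n and exp (lam r) are
    nondecreasing and can be taken out of the integral of m; the second integrates exp (lam r) and
    gains 1 / lam, so that lam = 2 M T + 1 gives a contraction by 1/2. *)
Lemma linear_bound (w w1 h : R -> R) (g D lam T : R) : 0 < lam -> 0 <= D ->
  (forall r, 0 < r <= T -> has_der w r (w1 r)) ->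
  (forall r, 0 < r <= T -> has_der w1 r (h r - n%:R / r * w1 r)) ->
  lim0 w g -> lim0 (fun r => r ^+ n * w1 r) 0 ->
  (forall r, 0 < r <= T -> `|h r| <= m r * (D * expR (lam * r))) ->
  (forall r, 0 < r <= T -> `|w1 r| <= M r * (D * expR (lam * r))) /\
  (forall r, 0 < r <= T -> `|w r - g| <= M T * D / lam * expR (lam * r)).
Proof.
move=> lam0 D0 hw hw1 wg w10 hh.
have b1 r : 0 < r <= T -> `|w1 r| <= M r * (D * expR (lam * r)).
  move=> /andP[r0 rT].
  have rn0 : 0 < r ^+ n by rewrite exprn_gt0.
  have := @der_norm_lim0 _ (fun r => r ^+ n * w1 r)
    (fun r => r ^+ n * (M r * (D * expR (lam * r)))) (fun r => r ^+ n * h r)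
    (fun r => r ^+ n * (m r * (D * expR (lam * r))) +
              (n%:R / r * r ^+ n + r ^+ n * lam) * (M r * (D * expR (lam * r)))) 0 0 T w10.
  have L : lim0 (fun r => r ^+ n * (M r * (D * expR (lam * r)))) 0.
    apply: lim0_eq; first apply: lim0M (lim0X _ _ _ lim0_id) (lim0M _ _ _ _ M0 _).
      apply: lim0M; first exact: lim0_cst.
      apply: (lim0_comp (fun r => lam * r) expR (lam * 0)).
        by apply: lim0M lim0_id; exact: lim0_cst.
      exact: continuous_expR.
    by rewrite mul0r mulr0.
  move=> /(_ L) H.
  have {H} : `|r ^+ n * w1 r - 0| <= r ^+ n * (M r * (D * expR (lam * r))) - 0.
    apply: H; last by rewrite r0.
    - by move=> s /andP[s0 sT]; apply: flux_der => //; apply: hw1; rewrite s0.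
    - move=> s /andP[s0 sT].
      have sn0 : s != 0 by rewrite gt_eqF.
      have hMs := hM s s0.
      by der; rewrite exprn_pred// ; ring.
    - move=> s /andP[s0 sT]; rewrite normrM ger0_norm ?exprn_ge0 ?(ltW s0)//.
      have sn : 0 <= s ^+ n by rewrite exprn_ge0// ltW.
      apply: (@le_trans _ _ (s ^+ n * (m s * (D * expR (lam * s))))).
        by apply: ler_wpM2l => //; apply: hh; rewrite s0 ltW.
      rewrite lerDl; apply: mulr_ge0.
        apply: addr_ge0; apply: mulr_ge0 => //; last exact: ltW.
        by rewrite divr_ge0// ltW.
      by rewrite !mulr_ge0 ?M_ge0 ?expR_ge0.
  by rewrite !subr0 normrM (gtr0_norm rn0) ler_pM2l.
split=> // r rT; have /andP[r0 rT'] := rT.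
have lamn0 : lam != 0 by rewrite gt_eqF.
have MT : 0 <= M T by apply: M_ge0; lra.
have := @der_norm_lim0 _ w (fun r => M T * D / lam * expR (lam * r)) w1
  (fun r => M T * D * expR (lam * r)) g (M T * D / lam) T wg.
have L : lim0 (fun r => M T * D / lam * expR (lam * r)) (M T * D / lam).
  apply: lim0_eq; first apply: lim0M (lim0_cst _) _.
    apply: (lim0_comp (fun r => lam * r) expR (lam * 0)).
      by apply: lim0M lim0_id; exact: lim0_cst.
    exact: continuous_expR.
  by rewrite mulr0 expR0 mulr1.
move=> /(_ L hw) H; apply: le_trans (H _ _ r rT) _.
- by move=> s /andP[s0 sT]; der; field.
- move=> s /andP[s0 sT]; apply: le_trans (b1 s _) _; first by rewrite s0 ltW.
  rewrite -mulrA ler_wpM2r ?mulr_ge0 ?expR_ge0//; exact: M_mono (ltW sT).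
- by rewrite gerBl; rewrite divr_ge0 ?mulr_ge0// ltW.
Qed.

(** Two applications of [primitive0]: to r^n f for the flux, then to the flux divided by r^n. *)
Lemma linear_solve (f : R -> R) (al : R) :
  (forall r, 0 < r -> {for r, continuous f}) ->
  (forall r, 0 < r -> `|f r| <= m r) ->
  exists p : (R -> R) * (R -> R),
    [/\ forall r, 0 < r -> has_der p.1 r (p.2 r),
        forall r, 0 < r -> has_der p.2 r (f r - n%:R / r * p.2 r),
        lim0 p.1 al, forall r, 0 < r -> `|p.2 r| <= M r &
        forall r, 0 < r -> `|p.1 r - al| <= r * M r].
Proof.
move=> cf fm.
have [||||J [hJ J0 JM]] := @primitive0 R (fun r => r ^+ n * f r) (fun r => r ^+ n * M r)
   (fun r => r ^+ n * m r + n%:R / r * r ^+ n * M r).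
- move=> r r0; apply: continuousM; last exact: cf.
  exact: (has_der_cont _ _ _ (has_derX _ n _ _ (has_der_id r))).
- move=> r r0; have hMr := hM _ r0; have rn0 : r != 0 by rewrite gt_eqF.
  by der; rewrite exprn_pred//; ring.
- apply: lim0_eq; first exact: lim0M (lim0X _ _ _ lim0_id) M0.
  by rewrite mulr0.
- move=> r r0; have rn : 0 <= r ^+ n by rewrite exprn_ge0// ltW.
  rewrite normrM ger0_norm//.
  apply: (@le_trans _ _ (r ^+ n * m r)); first by rewrite ler_wpM2l// fm.
  by rewrite lerDl !mulr_ge0 ?invr_ge0 ?M_ge0// ltW.
pose v1 r := J r / r ^+ n.
have hv1 r : 0 < r -> has_der v1 r (f r - n%:R / r * v1 r).
  move=> r0; have rn0 : r != 0 by rewrite gt_eqF.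
  have rnn0 : r ^+ n != 0 by rewrite expf_neq0.
  have hJr := hJ r r0; rewrite /v1; der => //.
  rewrite exprn_pred//; field; by rewrite ?rn0 ?rnn0.
have v1M r : 0 < r -> `|v1 r| <= M r.
  move=> r0; have rn : 0 < r ^+ n by rewrite exprn_gt0.
  rewrite /v1 normrM normfV (gtr0_norm rn) ler_pdivrMr// mulrC; exact: JM.
have [||||v [hv v0 vM]] := @primitive0 R v1 (fun r => r * M r) (fun r => M r + r * m r).
- by move=> r r0; exact: has_der_cont (hv1 r r0).
- by move=> r r0; have hMr := hM _ r0; der; ring.
- by apply: lim0_eq; [exact: lim0M lim0_id M0|rewrite mulr0].
- by move=> r r0; apply: le_trans (v1M r r0) _; rewrite lerDl mulr_ge0 ?m0// ltW.
exists (fun r => v r + al, v1); split => //=.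
- move=> r r0; have h := hv r r0; der; ring.
- by apply: lim0_eq (lim0D _ _ _ _ v0 (lim0_cst al)) _; rewrite add0r.
- by move=> r r0; rewrite addrK; exact: vM.
Qed.

Variable Phi : R -> R -> R.
Hypothesis Phi_le : forall r x, 0 < r -> `|Phi r x| <= m r.
Hypothesis Phi_lip : forall r x y, 0 < r -> `|Phi r x - Phi r y| <= m r * `|x - y|.
Hypothesis Phi_cont : forall u : R -> R, (forall r, 0 < r -> {for r, continuous u}) ->
  forall r, 0 < r -> {for r, continuous (fun s => Phi s (u s))}.

Definition ivp_sol (T al : R) (u u1 : R -> R) :=
  [/\ forall r, 0 < r <= T -> has_der u r (u1 r),
      forall r, 0 < r <= T -> has_der u1 r (Phi r (u r) - n%:R / r * u1 r),
      lim0 u al & lim0 (fun r => r ^+ n * u1 r) 0].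

Lemma flux_lim0 (v1 : R -> R) :
  (forall r, 0 < r -> `|v1 r| <= M r) -> lim0 (fun r => r ^+ n * v1 r) 0.
Proof.
move=> h; apply: (lim0_squeeze _ (fun r => r ^+ n * M r) _ 1) => //.
  by apply: lim0_eq; [exact: lim0M (lim0X _ _ _ lim0_id) M0|rewrite mulr0].
move=> r /andP[r0 _]; rewrite subr0 normrM ger0_norm ?exprn_ge0 ?(ltW r0)//.
by rewrite ler_wpM2l ?exprn_ge0 ?(ltW r0)// h.
Qed.

(** The constant does not involve D0: with al = be this gives uniqueness, as soon as some bound on
    the difference is available. *)
Lemma ivp_stability T al be u u1 v v1 D0 : 0 < T ->
  ivp_sol T al u u1 -> ivp_sol T be v v1 ->
  (forall r, 0 < r <= T -> `|u r - v r| <= D0) ->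
  forall r, 0 < r <= T ->
    `|u r - v r| <= 2 * `|al - be| * expR ((2 * M T + 1) * T) /\
    `|u1 r - v1 r| <= M T * (2 * `|al - be| * expR ((2 * M T + 1) * T)).
Proof.
move=> T0 [hu hu1 ua fu] [hv hv1 vb fv] hD0.
have MT := M_ge0 T T0; set lam := 2 * M T + 1.
have lam0 : 0 < lam by rewrite /lam; lra.
set a := `|al - be|.
have D00 : 0 <= D0 by apply: le_trans (normr_ge0 _) (hD0 T _); rewrite T0 lexx.
have a0 : 0 <= a by exact: normr_ge0.
have e1 r : 0 < r -> 1 <= expR (lam * r).
  by move=> r0; rewrite -expR0 ler_expR mulr_ge0// ltW.
have key D : 0 <= D -> (forall r, 0 < r <= T -> `|u r - v r| <= D * expR (lam * r)) ->
  forall r, 0 < r <= T -> `|u1 r - v1 r| <= M r * (D * expR (lam * r)) /\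
   `|u r - v r| <= (a + D / 2) * expR (lam * r).
  move=> D0' hD r rT.
  have [|||||B1 B2] := @linear_bound (fun r => u r + - v r) (fun r => u1 r + - v1 r)
    (fun r => Phi r (u r) + - Phi r (v r)) (al - be) D lam T lam0 D0'.
  - by move=> s sT; apply: has_derD; [exact: hu|apply: has_derN; exact: hv].
  - move=> s sT; have h1 := hu1 s sT; have h2 := hv1 s sT; der; ring.
  - exact: lim0D ua (lim0N _ _ vb).
  - have := lim0D _ _ _ _ fu (lim0N _ _ fv); rewrite subrr; apply: lim0_ext T0 _.
    by move=> s _ /=; ring.
  - move=> s /andP[s0 sT]; apply: le_trans (Phi_lip _ _ _ s0) _.
    by rewrite ler_wpM2l ?m0// hD// s0.
  split; first exact: B1.
  have := B2 r rT; have /andP[r0 rT'] := rT.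
  have h1 : M T * D / lam <= D / 2.
    rewrite ler_pdivrMr// mulrAC ler_pdivlMr// /lam; nra.
  move=> h2; have h3 : `|u r - v r| <= a + D / 2 * expR (lam * r).
    have -> : u r - v r = (al - be) + (u r + - v r - (al - be)) by ring.
    apply: le_trans (ler_normD _ _) _; rewrite lerD2l; apply: le_trans h2 _.
    by rewrite ler_wpM2r// expR_ge0.
  have h4 : a <= a * expR (lam * r) by rewrite ler_peMr// e1.
  by rewrite mulrDl; lra.
(* Each pass replaces a bound D by a + D / 2, whose fixed point is 2 a; the contribution of D0 is
   halved each time and disappears in the limit. *)
have it k : forall r, 0 < r <= T -> `|u r - v r| <= (2 * a + D0 / 2 ^+ k) * expR (lam * r).
  elim: k => [|k ih] r rT.
    have /andP[r0 rT'] := rT.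
    rewrite expr0 divr1; apply: le_trans (hD0 r rT) _.
    have := e1 r r0; nra.
  have p : 0 <= D0 / 2 ^+ k by rewrite divr_ge0// exprn_ge0.
  have [_] := key (2 * a + D0 / 2 ^+ k) ltac:(lra) ih r rT.
  rewrite half_powS; suff -> : a + (2 * a + D0 / 2 ^+ k) / 2 = 2 * a + D0 / 2 ^+ k / 2 by [].
  by field; rewrite expf_neq0// (pnatr_eq0 R 2).
have fin r : 0 < r <= T -> `|u r - v r| <= 2 * a * expR (lam * r).
  move=> rT; apply: (@le_of_half_pow _ _ _ (D0 * expR (lam * r))) => k.
  by have := it k r rT; rewrite mulrDl [D0 / _ * _]mulrAC.
have eT r : 0 < r <= T -> expR (lam * r) <= expR (lam * T).
  by move=> /andP[? ?]; rewrite ler_expR ler_pM2l.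
move=> r rT; have h := eT r rT; have /andP[r0 rT'] := rT; split.
  by apply: le_trans (fin r rT) _; rewrite ler_wpM2l// mulr_ge0.
have [h1 _] := key (2 * a) ltac:(lra) fin r rT.
apply: le_trans h1 _; apply: ler_pM => //; rewrite ?M_ge0 ?mulr_ge0 ?expR_ge0 ?M_mono//.
by rewrite ler_wpM2l// mulr_ge0.
Qed.

(** Picard iteration on the whole half-line. The weight that makes a step halve distances depends on
    T, so the iterates converge geometrically with a constant C(r) growing with r, uniformly on each
    ]0, T]. *)
Lemma ivp_exists al : exists p : (R -> R) * (R -> R),
  (forall T, ivp_sol T al p.1 p.2) /\
  (forall r, 0 < r -> `|p.2 r| <= M r) /\ (forall r, 0 < r -> `|p.1 r - al| <= r * M r).
Proof.
have /choice[step hstep] (u : R -> R) : exists p : (R -> R) * (R -> R),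
  (forall r, 0 < r -> {for r, continuous u}) ->
    [/\ forall r, 0 < r -> has_der p.1 r (p.2 r),
        forall r, 0 < r -> has_der p.2 r (Phi r (u r) - n%:R / r * p.2 r),
        lim0 p.1 al, forall r, 0 < r -> `|p.2 r| <= M r &
        forall r, 0 < r -> `|p.1 r - al| <= r * M r].
  case: (pselect (forall r, 0 < r -> {for r, continuous u})) => [cu|ncu]; last first.
    by exists (u, u).
  have [||p hp] := @linear_solve (fun r => Phi r (u r)) al.
  - exact: Phi_cont.
  - by move=> r; exact: Phi_le.
  by exists p.
pose U := fix U k := if k is k'.+1 then (step (U k')).1 else (fun _ : R => al).
have cU k : forall r, 0 < r -> {for r, continuous (U k)}.
  elim: k => [|k ih] r r0 /=; first exact: cst_continuous.
  have [h _ _ _ _] := hstep _ ih; exact: has_der_cont (h r r0).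
pose C r := r * M r * expR ((2 * M r + 1) * r).
have diff (u v : R -> R) T D : 0 < T -> 0 <= D ->
  (forall r, 0 < r -> {for r, continuous u}) ->
  (forall r, 0 < r -> {for r, continuous v}) ->
  (forall r, 0 < r <= T -> `|u r - v r| <= D * expR ((2 * M T + 1) * r)) ->
  forall r, 0 < r <= T ->
    `|(step u).1 r - (step v).1 r| <= D / 2 * expR ((2 * M T + 1) * r).
  move=> T0 D0 cu cv huv r rT; set lam := 2 * M T + 1.
  have MT := M_ge0 T T0.
  have lam0 : 0 < lam by rewrite /lam; slra.
  have [a1 a2 a3 a4 a5] := hstep u cu; have [b1 b2 b3 b4 b5] := hstep v cv.
  have [|||||_ B2] := @linear_bound (fun r => (step u).1 r + - (step v).1 r)
    (fun r => (step u).2 r + - (step v).2 r)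
    (fun r => Phi r (u r) + - Phi r (v r)) (al - al) D lam T lam0 D0.
  - by move=> s /andP[s0 _]; apply: has_derD; [exact: a1|apply: has_derN; exact: b1].
  - move=> s /andP[s0 _]; have h1 := a2 s s0; have h2 := b2 s s0; der; ring.
  - exact: lim0D a3 (lim0N _ _ b3).
  - have := lim0D _ _ _ _ (flux_lim0 _ a4) (lim0N _ _ (flux_lim0 _ b4)).
    by rewrite subrr; apply: lim0_ext T0 _; move=> s _ /=; ring.
  - move=> s /andP[s0 sT]; apply: le_trans (Phi_lip _ _ _ s0) _.
    by rewrite ler_wpM2l ?m0// huv// s0.
  have := B2 r rT; rewrite subrr subr0 => h; apply: le_trans h _.
  rewrite ler_wpM2r ?expR_ge0// ler_pdivrMr// mulrAC ler_pdivlMr// /lam; nra.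
have inc T k : 0 < T -> forall r, 0 < r <= T ->
    `|U k.+1 r - U k r| <= T * M T / 2 ^+ k * expR ((2 * M T + 1) * r).
  move=> T0; have MT := M_ge0 T T0; elim: k => [|k ih] r rT.
    have [_ _ _ _ h] := hstep _ (cU 0%N); have /andP[r0 rT'] := rT.
    rewrite expr0 divr1; apply: le_trans (h r r0) _.
    apply: (@le_trans _ _ (T * M T)).
      by apply: ler_pM; [exact: ltW|exact: M_ge0|by []|exact: M_mono].
    have h1 : 1 <= expR ((2 * M T + 1) * r).
      by rewrite -[leLHS]expR0 ler_expR mulr_ge0// ?ltW//; slra.
    by rewrite ler_peMr// mulr_ge0// ltW.
  rewrite half_powS; apply: (diff (U k.+1) (U k) T) => //; [|exact: cU|exact: cU].
  by rewrite divr_ge0 ?mulr_ge0 ?exprn_ge0 ?(ltW T0).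
have /choice[V hV] : forall x : R, exists l, 0 < x -> forall k, `|l - U k x| <= 2 * C x / 2 ^+ k.
  move=> x; case: (ltP 0 x) => x0; last by exists 0.
  have [|l hl] := @geometric_limit R (fun k => U k x) (C x); last by exists l.
  move=> k; have := inc x k x0 x; rewrite x0 lexx => /(_ isT).
  by rewrite /C [X in _ <= X -> _]mulrAC.
have Cmono r s : 0 < r -> r <= s -> C r <= C s.
  move=> r0 rs; have s0 := lt_le_trans r0 rs.
  have hm := M_mono r s r0 rs; have Mr := M_ge0 r r0; have Ms := M_ge0 s s0.
  have h1 : r * M r <= s * M s by apply: ler_pM => //; exact: ltW.
  have h2 : (2 * M r + 1) * r <= (2 * M s + 1) * s by apply: ler_pM => //; slra.
  by rewrite /C; apply: ler_pM; rewrite ?expR_ge0 ?ler_expR// mulr_ge0// ltW.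
have C0 r : 0 < r -> 0 <= C r.
  by move=> r0; rewrite /C !mulr_ge0 ?expR_ge0 ?M_ge0// ltW.
have hV' T r k : 0 < r <= T -> `|V r - U k r| <= 2 * C T / 2 ^+ k.
  move=> /andP[r0 rT]; apply: le_trans (hV r r0 k) _.
  by rewrite ler_wpM2r ?invr_ge0 ?exprn_ge0// ler_wpM2l// Cmono.
have cV r : 0 < r -> {for r, continuous V}.
  move=> r0; apply/continuousP_dist => e e0.
  have [k hk] := half_pow_small (2 * C (2 * r)) (e / 3) (ltac:(lra)).
  have /continuousP_dist cUk := cU k r r0.
  have [d d0 hd] := cUk (e / 3) (ltac:(slra)).
  exists (Num.min d r); first by rewrite lt_min d0.
  move=> y; rewrite lt_min => /andP[yd yr].
  have h1 := hd y yd; have h2 := hV' (2 * r) r k (ltac:(slra)).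
  have h3 : `|V y - U k y| <= 2 * C (2 * r) / 2 ^+ k.
    by apply: hV'; move: yr; rewrite ltr_distl => /andP[? ?]; apply/andP; split; slra.
  have -> : V y - V r = (V y - U k y) + (U k y - U k r) - (V r - U k r) by ring.
  apply: le_lt_trans (ler_normB _ _) _.
  by have := ler_normD (V y - U k y) (U k y - U k r); slra.
have [a1 a2 a3 a4 a5] := hstep V cV.
(* Both sides are within a multiple of 2^-k of the iterate k + 1, so [step V] solves the nonlinear
   problem itself. *)
have eV r : 0 < r -> (step V).1 r = V r.
  move=> r0; set lam := 2 * M r + 1.
  apply: (@eq_of_half_pow _ _ _ (C r * expR (lam * r) + C r)) => k.
  have := diff V (U k) r (2 * C r / 2 ^+ k) r0.
  have p : 0 <= 2 * C r / 2 ^+ k by rewrite divr_ge0 ?exprn_ge0// mulr_ge0// C0.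
  move=> /(_ p cV (cU k)).
  move=> H; have {}H : `|(step V).1 r - U k.+1 r| <= 2 * C r / 2 ^+ k / 2 * expR (lam * r).
    apply: H; last by rewrite r0 lexx.
    move=> s sr; apply: le_trans (hV' r s k sr) _; have /andP[s0 _] := sr.
    rewrite ler_peMr// -[leLHS]expR0 ler_expR mulr_ge0 ?(ltW s0)//.
    by rewrite /lam; have := M_ge0 r r0; slra.
  have H2 := hV r r0 k.+1; rewrite half_powS in H2.
  have -> : (step V).1 r - V r = ((step V).1 r - U k.+1 r) - (V r - U k.+1 r) by ring.
  apply: le_trans (ler_normB _ _) _.
  apply: le_trans (lerD H H2) _.
  rewrite le_eqVlt; apply/orP; left; apply/eqP; field.
  by rewrite expf_neq0// (pnatr_eq0 R 2).
exists (step V); split; last by split.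
move=> T; split.
- by move=> r /andP[r0 _]; exact: a1.
- by move=> r /andP[r0 _]; rewrite eV//; exact: a2.
- exact: a3.
- exact: flux_lim0.
Qed.
End SingularIVP.

(** * Positive solutions *)

(* The equation u'' + (n / r) u' - Q u + 2 K u ln u = 0, with kap = K' / (2 K). The
   potential H is increasing from prb on, and M is a primitive of the bound m of |Q|. *)
Record problem (R : realType) := Problem {
  pn : nat;
  pQ : R -> R; pK : R -> R; pkap : R -> R; pkap' : R -> R;
  pH : R -> R; pH' : R -> R;
  pm : R -> R; pM : R -> R;
  prho : R; pfar : R; pbot : R; prb : R;
  pn_gt0 : (0 < pn)%N;
  pQ_cont : forall r : R, 0 < r -> {for r, continuous pQ};
  pM_der : forall r : R, 0 < r -> has_der pM r (pm r);
  pM_lim0 : lim0 pM 0;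
  pQ_le : forall r : R, 0 < r -> `|pQ r| <= pm r;
  pK_der : forall r : R, 0 < r -> has_der pK r (2 * pK r * pkap r);
  pkap_der : forall r : R, 0 < r -> has_der pkap r (pkap' r);
  pK_itv : forall r : R, 0 < r -> 1 <= pK r <= 2;
  prho_gt0 : 0 < prho;
  pK_near0 : forall r : R, 0 < r < prho -> pK r = pK prho /\ pkap r = 0 /\ pkap' r = 0;
  pH_eq : forall r : R, 0 < r -> pH r =
    (pQ r + pn%:R / 2 * (pn%:R / 2 - 1) / r ^+ 2 + pkap' r / 2 - pkap r ^+ 2 / 4) / pK r
    + pn%:R * ln r + ln (pK r) / 2;
  pH_der : forall r : R, 0 < r -> has_der pH r (pH' r);
  pfar_gt0 : 0 < pfar;
  pK_far : forall r : R, pfar <= r -> pK r = 1 /\ pkap r = 0 /\ pkap' r = 0;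
  pQ_far : forall r : R, pfar <= r -> pbot <= pQ r;
  prb_gt0 : 0 < prb;
  pH'_gt0 : forall r : R, prb <= r -> 0 < pH' r;
  pH'_cont : forall r : R, prb <= r -> {for r, continuous pH'}
}.

Section Clamp.
Context {R : realType}.

Implicit Types (a b x y : R).

Lemma lipschitz_max (a x y : R) : `|Num.max a x - Num.max a y| <= `|x - y|.
Proof.
rewrite !maxEle; case: (leP a x) => h1; case: (leP a y) => h2; rewrite ?subrr ?normr0//.
- by rewrite ler_norml; have := ler_norm (x - y); have := ler_norm (- (x - y));
    rewrite normrN => ? ?; apply/andP; split; slra.
- by rewrite ler_norml; have := ler_norm (x - y); have := ler_norm (- (x - y));
    rewrite normrN => ? ?; apply/andP; split; slra.
Qed.

Lemma lipschitz_min (a x y : R) : `|Num.min a x - Num.min a y| <= `|x - y|.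
Proof.
have := lipschitz_max (- a) (- x) (- y).
by rewrite -!oppr_min -!opprD !normrN.
Qed.

(** Composed with this truncation, x ln x is bounded and globally Lipschitz; the truncated problem
    has global solutions, which are genuine as long as they stay in [exp (- b), exp b]. *)
Definition clamp (b x : R) := Num.max (expR (- b)) (Num.min (expR b) x).

Lemma clamp_itv b x : 0 < b -> expR (- b) <= clamp b x <= expR b.
Proof.
move=> b0; rewrite /clamp le_max lexx /= ge_max ge_min lexx /= andbT ler_expR; slra.
Qed.

Lemma clamp_id b x : expR (- b) <= x <= expR b -> clamp b x = x.
Proof. by move=> /andP[h1 h2]; rewrite /clamp min_r// max_r. Qed.

Lemma clamp_lip b x y : `|clamp b x - clamp b y| <= `|x - y|.
Proof. exact: le_trans (lipschitz_max _ _ _) (lipschitz_min _ _ _). Qed.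

Lemma clamp_cont b (x : R) : {for x, continuous (clamp b)}.
Proof.
apply/continuousP_dist => e e0; exists e => // y yx.
exact: le_lt_trans (clamp_lip _ _ _) yx.
Qed.

Lemma xlnx_lip b x y : 0 < b -> expR (- b) <= x <= expR b -> expR (- b) <= y <= expR b ->
  `|x * ln x - y * ln y| <= (b + 1) * `|x - y|.
Proof.
move=> b0; wlog xy : x y / x <= y.
  move=> H hx hy; case: (leP x y) => xy; first exact: H.
  by rewrite distrC [`|x - y|]distrC; apply: H => //; exact: ltW.
move=> /andP[x1 x2] /andP[y1 y2].
move: xy; rewrite le_eqVlt => /orP[/eqP->|xy]; first by rewrite !subrr normr0 mulr0.
have p z : x <= z <= y -> 0 < z.
  by move=> /andP[xz _]; apply: lt_le_trans xz; apply: lt_le_trans x1; exact: expR_gt0.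
have [|c cxy e] := @mean_value R (fun z => z * ln z) (fun z => ln z + 1) x y xy.
  by move=> z zxy; have z0 := p z zxy; der => //; field; exact: lt0r_neq0.
rewrite distrC [`|x - y|]distrC e normrM ler_wpM2r//.
have c0 : 0 < c by apply: p; slra.
have : - b <= ln c by rewrite -[leLHS]expRK ler_ln ?posrE ?expR_gt0//; slra.
have : ln c <= b by rewrite -[leRHS]expRK ler_ln ?posrE ?expR_gt0//; slra.
move=> l1 l2; rewrite ler_norml; apply/andP; split; slra.
Qed.

Lemma xlnx_bound b x : 0 < b -> expR (- b) <= x <= expR b -> `|x * ln x| <= b * expR b.
Proof.
move=> b0 /andP[x1 x2]; have x0 : 0 < x by apply: lt_le_trans x1; exact: expR_gt0.
rewrite normrM mulrC (gtr0_norm x0); apply: ler_pM => //; first exact: ltW.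
have : - b <= ln x by rewrite -[leLHS]expRK ler_ln ?posrE ?expR_gt0//; slra.
have : ln x <= b by rewrite -[leRHS]expRK ler_ln ?posrE ?expR_gt0//; slra.
move=> l1 l2; rewrite ler_norml; apply/andP; split; slra.
Qed.
End Clamp.

Section Problem.
Context {R : realType} (P : problem R).
Local Notation n := (pn R P).
Local Notation Q := (pQ R P).
Local Notation K := (pK R P).
Local Notation kap := (pkap R P).
Local Notation kap' := (pkap' R P).
Local Notation H := (pH R P).
Local Notation H' := (pH' R P).
Local Notation m := (pm R P).
Local Notation M := (pM R P).

(* [Q] may be singular at 0, so the initial conditions are limits; that of [u1] only
   requires the flux [r ^+ n * u1 r] to vanish. *)
Definition psol (T al : R) (u u1 : R -> R) :=
  [/\ forall r, 0 < r <= T ->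
        [/\ has_der u r (u1 r),
            has_der u1 r (Q r * u r - K r * (2 * (u r * ln (u r))) - n%:R / r * u1 r) & 0 < u r],
      lim0 u al & lim0 (fun r => r ^+ n * u1 r) 0].

Lemma psol_sub T T' al u u1 : T' <= T -> psol T al u u1 -> psol T' al u u1.
Proof. by move=> TT [h1 h2 h3]; split => // r rT; apply: h1; slra. Qed.

Definition slog (u : R -> R) r := ln (u r) + n%:R / 2 * ln r + ln (K r) / 4.
Definition sslope (u u1 : R -> R) r := (u1 r / u r + n%:R / (2 * r) + kap r / 2) / Num.sqrt (K r).

Lemma K_gt0 r : 0 < r -> 0 < K r.
Proof. by move=> /(pK_itv R P) /andP[h _]; slra. Qed.

Lemma sqrtK_itv r : 0 < r -> 1 <= Num.sqrt (K r) <= 2.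
Proof.
move=> r0; have /andP[h1 h2] := pK_itv R P r r0.
rewrite -{1}sqrtr1 ler_wsqrtr//=.
have -> : 2 = Num.sqrt (2 ^+ 2) :> R by rewrite sqrtr_sqr ger0_norm.
by rewrite ler_wsqrtr//; slra.
Qed.

Lemma psol_flow T al u u1 a : 0 < a -> psol T al u u1 ->
  flow a T (fun r => Num.sqrt (K r)) H (slog u) (sslope u u1).
Proof.
move=> a0 [hs _ _] r raT; have r0 : 0 < r by slra.
have [h1 h2 h3] := hs r ltac:(slra).
have hK := pK_der R P r r0; have hk := pkap_der R P r r0.
have K0 := K_gt0 r r0; have sK0 : 0 < Num.sqrt (K r) by rewrite sqrtr_gt0.
have eK : K r = Num.sqrt (K r) ^+ 2 by rewrite sqr_sqrtr// ltW.
have r2 : 2 * r != 0 by rewrite gt_eqF//; slra.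
have rn := lt0r_neq0 r0; have un := lt0r_neq0 h3; have Kn := lt0r_neq0 K0.
have skn := lt0r_neq0 sK0.
split.
  rewrite /slog /sslope; der => //.
  by rewrite mulr0 mul0r; field; rewrite ?rn ?un ?Kn ?skn.
rewrite /sslope; der => //.
rewrite (pH_eq R P r r0) /slog.
set s := Num.sqrt (K r) in eK skn *.
set lu := ln (u r); set lr := ln r; set lK := ln (K r).
rewrite -/s eK; field.
by rewrite ?rn ?un ?Kn ?skn.
Qed.

(** One function that dominates both the size m exp b + 4 b exp b and the Lipschitz constant m + 4
    (b + 1) of the truncated right-hand side. *)
Definition bm b r := (4 * b + 4) * expR b * (m r + 1).
Definition bM b r := (4 * b + 4) * expR b * (M r + r).
Definition bPhi b r x := Q r * clamp b x - K r * (2 * (clamp b x * ln (clamp b x))).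

Lemma m_ge0 r : 0 < r -> 0 <= m r.
Proof. by move=> r0; apply: le_trans (normr_ge0 _) (pQ_le R P _ r0). Qed.

Lemma bM_der b r : 0 < r -> has_der (bM b) r (bm b r).
Proof. by move=> r0; have hM := pM_der R P r r0; rewrite /bM /bm; der; ring. Qed.

Lemma bM_lim0 b : lim0 (bM b) 0.
Proof.
apply: lim0_eq (lim0M _ _ _ _ (lim0_cst _) (lim0D _ _ _ _ (pM_lim0 R P) lim0_id)) _.
by rewrite addr0 mulr0.
Qed.

Lemma bm_ge0 b r : 0 < b -> 0 < r -> 0 <= bm b r.
Proof.
move=> b0 r0; have := m_ge0 r r0 => ?.
by rewrite /bm mulr_ge0 ?mulr_ge0 ?expR_ge0//; slra.
Qed.

Lemma bPhi_le b r x : 0 < b -> 0 < r -> `|bPhi b r x| <= bm b r.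
Proof.
move=> b0 r0; have ci := clamp_itv b x b0; have /andP[c1 c2] := ci.
have /andP[K1 K2] := pK_itv R P r r0; have Qm := pQ_le R P r r0.
have mr := m_ge0 r r0.
have h1 : `|Q r * clamp b x| <= m r * expR b.
  rewrite normrM; apply: ler_pM => //; rewrite ger0_norm//.
  by apply: le_trans c1; exact: expR_ge0.
have h2 : `|K r * (2 * (clamp b x * ln (clamp b x)))| <= 2 * (2 * (b * expR b)).
  rewrite !normrM [`|K r|]ger0_norm; last by slra.
  rewrite (@ger0_norm _ 2)// -normrM; apply: ler_pM; rewrite ?mulr_ge0//; first by slra.
  by rewrite ler_pM2l//; exact: xlnx_bound.
apply: le_trans (ler_normB _ _) _; apply: le_trans (lerD h1 h2) _; rewrite /bm.
have e0 := expR_gt0 b; have : 0 <= expR b * m r by rewrite mulr_ge0// ltW.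
have : 0 <= b * (expR b * m r) by rewrite !mulr_ge0// ltW.
slra.
Qed.

Lemma bPhi_lip b r x y : 0 < b -> 0 < r -> `|bPhi b r x - bPhi b r y| <= bm b r * `|x - y|.
Proof.
move=> b0 r0; have cx := clamp_itv b x b0; have cy := clamp_itv b y b0.
have /andP[K1 K2] := pK_itv R P r r0; have Qm := pQ_le R P r r0; have mr := m_ge0 r r0.
have L := clamp_lip b x y; have d0 := normr_ge0 (x - y).
have -> : bPhi b r x - bPhi b r y = Q r * (clamp b x - clamp b y) -
  K r * (2 * (clamp b x * ln (clamp b x) - clamp b y * ln (clamp b y))).
  by rewrite /bPhi; ring.
have h1 : `|Q r * (clamp b x - clamp b y)| <= m r * `|x - y|.
  by rewrite normrM; apply: ler_pM.
have h2 : `|K r * (2 * (clamp b x * ln (clamp b x) - clamp b y * ln (clamp b y)))| <=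
   2 * (2 * ((b + 1) * `|x - y|)).
  rewrite !normrM [`|K r|]ger0_norm; last by slra.
  rewrite (@ger0_norm _ 2)//; apply: ler_pM; rewrite ?mulr_ge0//; first by slra.
  rewrite ler_pM2l//; apply: le_trans (xlnx_lip _ _ _ b0 cx cy) _.
  by rewrite ler_pM2l//; slra.
apply: le_trans (ler_normB _ _) _; apply: le_trans (lerD h1 h2) _; rewrite /bm.
have e1 : 1 <= expR b by rewrite -[leLHS]expR0 ler_expR ltW.
have -> : m r * `|x - y| + 2 * (2 * ((b + 1) * `|x - y|)) = (m r + (4 * b + 4)) * `|x - y| by ring.
rewrite ler_wpM2r//.
have : (4 * b + 4) * (m r + 1) <= (4 * b + 4) * expR b * (m r + 1).
  rewrite ler_pM2r; last by slra.
  by rewrite ler_peMr//; slra.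
have : 0 <= b * m r by rewrite mulr_ge0// ltW.
slra.
Qed.

Lemma bPhi_cont b (u : R -> R) : 0 < b -> (forall r, 0 < r -> {for r, continuous u}) ->
  forall r, 0 < r -> {for r, continuous (fun s => bPhi b s (u s))}.
Proof.
move=> b0 cu r r0.
have cc : {for r, continuous (fun s => clamp b (u s))}.
  by apply: continuous_comp; [exact: cu|exact: clamp_cont].
have cp : 0 < clamp b (u r).
  by have /andP[h _] := clamp_itv b (u r) b0; apply: lt_le_trans h; exact: expR_gt0.
have cl : {for r, continuous (fun s => ln (clamp b (u s)))}.
  by apply: (@continuous_comp _ _ _ (fun s => clamp b (u s)) (@ln R)) => //; exact: continuous_ln.
apply: continuousB; first by apply: continuousM => //; exact: pQ_cont.
apply: continuousM; first exact: has_der_cont (pK_der R P r r0).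
by apply: continuousM; [exact: cst_continuous|exact: continuousM].
Qed.

Definition bsol b T al := ivp_sol n (bPhi b) T al.

Lemma bsol_exists b al : 0 < b -> exists p : (R -> R) * (R -> R),
  (forall T, bsol b T al p.1 p.2) /\
  (forall r, 0 < r -> `|p.2 r| <= bM b r) /\ (forall r, 0 < r -> `|p.1 r - al| <= r * bM b r).
Proof.
move=> b0; apply: (ivp_exists n (bm b) (bM b)).
- by move=> r; exact: bM_der.
- by move=> r; exact: bm_ge0.
- exact: bM_lim0.
- by move=> r x; exact: bPhi_le.
- by move=> r x y; exact: bPhi_lip.
- by move=> u; exact: bPhi_cont.
Qed.

Lemma bsol_stability b T al be u u1 v v1 D : 0 < b -> 0 < T ->
  bsol b T al u u1 -> bsol b T be v v1 ->
  (forall r, 0 < r <= T -> `|u r - v r| <= D) ->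
  forall r, 0 < r <= T ->
    `|u r - v r| <= 2 * `|al - be| * expR ((2 * bM b T + 1) * T) /\
    `|u1 r - v1 r| <= bM b T * (2 * `|al - be| * expR ((2 * bM b T + 1) * T)).
Proof.
move=> b0; apply: (ivp_stability n (bm b) (bM b)).
- by move=> r; exact: bM_der.
- by move=> r; exact: bm_ge0.
- exact: bM_lim0.
- by move=> r x y; exact: bPhi_lip.
Qed.

Lemma psol_bsol b T al u u1 : psol T al u u1 ->
  (forall r, 0 < r <= T -> expR (- b) <= u r <= expR b) -> bsol b T al u u1.
Proof.
move=> [hs ua fl] hb; split => //; first by move=> r /hs[].
by move=> r rT; have [_ h2 _] := hs r rT; rewrite /bPhi clamp_id ?hb.
Qed.

Lemma bsol_psol b T al u u1 : bsol b T al u u1 ->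
  (forall r, 0 < r <= T -> expR (- b) <= u r <= expR b) -> psol T al u u1.
Proof.
move=> [hs1 hs2 ua fl] hb; split => // r rT; split; first exact: hs1.
  by have := hs2 r rT; rewrite /bPhi clamp_id ?hb.
by have /andP[h _] := hb r rT; apply: lt_le_trans h; exact: expR_gt0.
Qed.

Lemma psol_bounds T al u u1 : 0 < al -> psol T al u u1 ->
  exists2 b, 0 < b & forall r, 0 < r <= T -> expR (- b) <= u r <= expR b.
Proof.
move=> al0 [hs ua _].
have lu : lim0 (fun r => ln (u r)) (ln al).
  by apply: lim0_comp => //; exact: continuous_ln.
move/lim0P: lu => /(_ 1 ltr01)[d d0 hd].
have [|C C0 hC] := @continuous_bounded R (fun r => ln (u r)) (d / 2) T.
  move=> r rT; have [h1 _ h3] := hs r ltac:(slra).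
  by apply: has_der_cont; apply: has_der_ln h3 h1.
exists (`|ln al| + 1 + C); first by have := normr_ge0 (ln al); slra.
move=> r rT; have [_ _ ur] := hs r rT.
have : `|ln (u r)| <= `|ln al| + 1 + C.
  case: (ltP r d) => rd.
    have := hd r ltac:(slra) => h.
    have -> : ln (u r) = ln (u r) - ln al + ln al by ring.
    by apply: le_trans (ler_normD _ _) _; slra.
  have := hC r ltac:(slra); have := normr_ge0 (ln al); slra.
rewrite ler_norml => /andP[h1 h2].
by rewrite -[u r]lnK ?posrE// !ler_expR h1.
Qed.

Lemma psol_eq_bsol b T al u u1 v v1 : 0 < b -> 0 < T -> psol T al u u1 ->
  (forall r, 0 < r <= T -> expR (- b) <= u r <= expR b) -> bsol b T al v v1 ->
  (forall r, 0 < r -> `|v r - al| <= r * bM b r) ->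
  forall r, 0 < r <= T -> u r = v r /\ u1 r = v1 r.
Proof.
move=> b0 T0 us ub vs vb r rT.
have su := psol_bsol _ _ _ _ _ us ub.
have := bsol_stability b T al al u u1 v v1 (expR b + (`|al| + T * bM b T)) b0 T0 su vs.
have D : forall r, 0 < r <= T -> `|u r - v r| <= expR b + (`|al| + T * bM b T).
  move=> s /andP[s0 sT]; have /andP[u1b u2b] := ub s (ltac:(slra)).
  have hv := vb s s0.
  have := M_mono (bm b) (bM b) (fun r => bM_der b r) (fun r => bm_ge0 b r b0) s T s0 sT.
  have bMs := M_ge0 (bm b) (bM b) (fun r => bM_der b r) (fun r => bm_ge0 b r b0) (bM_lim0 b) s s0.
  move=> mono; have h1 : s * bM b s <= T * bM b T by apply: ler_pM => //; exact: ltW.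
  have -> : u s - v s = u s - (v s - al + al) by ring.
  apply: le_trans (ler_normB _ _) _.
  have := ler_normD (v s - al) al; rewrite (@ger0_norm _ (u s)); first by slra.
  by apply: le_trans u1b; exact: expR_ge0.
move=> /(_ D r rT); rewrite subrr normr0 mulr0 mul0r mulr0 => -[h1 h2].
by split; apply/eqP; rewrite -subr_eq0 -normr_le0.
Qed.

Lemma psol_unique T al u u1 v v1 : 0 < al -> psol T al u u1 -> psol T al v v1 ->
  forall r, 0 < r <= T -> u r = v r /\ u1 r = v1 r.
Proof.
move=> al0 us vs r rT.
have [b1 b10 h1] := psol_bounds _ _ _ _ al0 us.
have [b2 b20 h2] := psol_bounds _ _ _ _ al0 vs.
pose b := Num.max b1 b2.
have b0 : 0 < b by rewrite lt_max b10.
have T0 : 0 < T by slra.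
have bb1 : b1 <= b by rewrite le_max lexx.
have bb2 : b2 <= b by rewrite le_max lexx orbT.
have [p [hp [_ pb]]] := bsol_exists b al b0.
have hu s : 0 < s <= T -> expR (- b) <= u s <= expR b.
  move=> /h1 /andP[q1 q2]; apply/andP; split.
    by apply: le_trans q1; rewrite ler_expR; slra.
  by apply: le_trans q2 _; rewrite ler_expR.
have hv s : 0 < s <= T -> expR (- b) <= v s <= expR b.
  move=> /h2 /andP[q1 q2]; apply/andP; split.
    by apply: le_trans q1; rewrite ler_expR; slra.
  by apply: le_trans q2 _; rewrite ler_expR.
have [-> ->] := psol_eq_bsol b T al u u1 p.1 p.2 b0 T0 us hu (hp T) pb r rT.
by have [-> ->] := psol_eq_bsol b T al v v1 p.1 p.2 b0 T0 vs hv (hp T) pb r rT.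
Qed.

(** The truncation level exceeds by one unit the level that contains u. A truncated solution
    starting nearby stays within g of u, hence inside the truncation range, where it solves the true
    equation. *)
Lemma psol_stable T al u u1 e : 0 < al -> 0 < T -> 0 < e -> psol T al u u1 ->
  exists2 d, 0 < d & forall be, `|be - al| < d -> exists v v1,
    [/\ psol T be v v1, `|v T - u T| < e & `|v1 T - u1 T| < e].
Proof.
move=> al0 T0 e0 us.
have [b0 b00 hb0] := psol_bounds _ _ _ _ al0 us.
pose b := b0 + 1; have bp : 0 < b by rewrite /b; slra.
have ub r : 0 < r <= T -> expR (- b) <= u r <= expR b.
  move=> /hb0 /andP[q1 q2]; apply/andP; split.
    by apply: le_trans q1; rewrite ler_expR /b; slra.
  by apply: le_trans q2 _; rewrite ler_expR /b; slra.
have bMT := M_ge0 (bm b) (bM b) (fun r => bM_der b r) (fun r => bm_ge0 b r bp) (bM_lim0 b) T T0.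
pose E := expR ((2 * bM b T + 1) * T); have E0 : 0 < E by exact: expR_gt0.
pose g := Num.min e (Num.min (expR b - expR b0) (expR (- b0) - expR (- b))).
have g0 : 0 < g.
  by rewrite !lt_min e0 !subr_gt0 !ltr_expR /b; apply/andP; split; slra.
have ge_ : g <= e by rewrite ge_min lexx.
have g1 : g <= expR b - expR b0 by rewrite !ge_min lexx !orbT.
have g2 : g <= expR (- b0) - expR (- b) by rewrite !ge_min lexx !orbT.
exists (g / (2 * E * (bM b T + 1) + 1)).
  by rewrite divr_gt0// addr_gt0// !mulr_gt0//; slra.
move=> be; rewrite ltr_pdivlMr; last by rewrite addr_gt0// !mulr_gt0//; slra.
set d := `|be - al| => hd; have d0 : 0 <= d by exact: normr_ge0.
have [p [hp [_ pb]]] := bsol_exists b be bp.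
have [q [hq [_ qb]]] := bsol_exists b al bp.
have eq := psol_eq_bsol b T al u u1 q.1 q.2 bp T0 us ub (hq T) qb.
have D s : 0 < s <= T -> `|p.1 s - q.1 s| <= T * bM b T + T * bM b T + d.
  move=> /andP[s0 sT].
  have := M_mono (bm b) (bM b) (fun r => bM_der b r) (fun r => bm_ge0 b r bp) s T s0 sT.
  have bMs := M_ge0 (bm b) (bM b) (fun r => bM_der b r) (fun r => bm_ge0 b r bp) (bM_lim0 b) s s0.
  move=> mono; have h1 : s * bM b s <= T * bM b T by apply: ler_pM => //; exact: ltW.
  have -> : p.1 s - q.1 s = (p.1 s - be) - (q.1 s - al) + (be - al) by ring.
  apply: le_trans (ler_normD _ _) _; rewrite lerD2r.
  apply: le_trans (ler_normB _ _) _.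
  have := pb s s0; have := qb s s0; clear -h1 mono s0 sT => q1 p1; lra.
have st := bsol_stability b T be al p.1 p.2 q.1 q.2 _ bp T0 (hp T) (hq T) D.
have dE : 0 <= d * E by rewrite mulr_ge0// ltW.
have dEM : 0 <= d * E * bM b T by rewrite mulr_ge0.
have close r : 0 < r <= T -> `|p.1 r - u r| < g /\ `|p.2 r - u1 r| < g.
  move=> rT; have [-> ->] := eq r rT; have [a1 a2] := st r rT; split.
    by apply: le_lt_trans a1 _; rewrite -/E -/d; clear -hd d0 dE dEM; lra.
  by apply: le_lt_trans a2 _; rewrite -/E -/d; clear -hd d0 dE dEM; lra.
exists p.1, p.2; split.
- apply: bsol_psol (hp T) _ => r rT.
  have [c1 _] := close r rT; move: c1; rewrite ltr_distl => /andP[c1 c2].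
  have /andP[q1 q2] := hb0 r rT; clear -c1 c2 q1 q2 g1 g2; apply/andP; split; lra.
- by have [c1 _] := close T ltac:(slra); slra.
- by have [_ c1] := close T ltac:(slra); slra.
Qed.

Lemma psol_short al : 0 < al -> exists2 T, 0 < T & exists u u1, psol T al u u1.
Proof.
move=> al0; pose b := `|ln al| + 1; have b0 : 0 < b by rewrite /b; have := normr_ge0 (ln al); slra.
have [p [hp _]] := bsol_exists b al b0.
have [_ _ pa _] := hp 1.
have a1 : expR (- b) < al < expR b.
  rewrite -{1 2}[al]lnK ?posrE// !ltr_expR /b.
  by have := ler_norm (ln al); have := ler_norm (- ln al); rewrite normrN => ? ?; slra.
move/lim0P: pa => /(_ (Num.min (al - expR (- b)) (expR b - al))) lim.
have [|d d0 hd] := lim; first by rewrite lt_min; apply/andP; split; slra.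
exists (d / 2); first slra.
exists p.1, p.2; apply: bsol_psol (hp _) _ => r rd.
have := hd r ltac:(slra); rewrite lt_min !ltr_distl => /andP[/andP[? ?] /andP[? ?]].
by apply/andP; split; slra.
Qed.

(** The solution truncated at level b + 1 is global and, by uniqueness, agrees with the given ones
    before T. Its values are there within level b, so by continuity it stays within level b + 1 a
    little beyond T. *)
Lemma psol_extend T al b : 0 < al -> 0 < T -> 0 < b ->
  (forall S, 0 < S < T -> exists u u1, psol S al u u1 /\
     forall r, 0 < r <= S -> expR (- b) <= u r <= expR b) ->
  exists2 T', T < T' & exists u u1, psol T' al u u1.
Proof.
move=> al0 T0 b0 hS; have bp : 0 < b + 1 by slra.
have [p [hp [_ pb]]] := bsol_exists (b + 1) al bp.
have i1 : expR (- (b + 1)) < expR (- b) by rewrite ltr_expR; slra.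
have i2 : expR b < expR (b + 1) by rewrite ltr_expR; slra.
have pin r : 0 < r < T -> expR (- b) <= p.1 r <= expR b.
  move=> /andP[r0 rT]; have [u [u1 [us ub]]] := hS r ltac:(slra).
  have [|<- _] := psol_eq_bsol (b + 1) r al u u1 p.1 p.2 bp r0 us _ (hp r) pb r ltac:(slra).
    by move=> s /ub /andP[? ?]; apply/andP; split; slra.
  by apply: ub; slra.
have cp : {for T, continuous p.1}.
  by have [h _ _ _] := hp T; apply: has_der_cont (h T _); slra.
pose g := Num.min (expR (- b) - expR (- (b + 1))) (expR (b + 1) - expR b).
have g0 : 0 < g / 2 by rewrite divr_gt0// lt_min; apply/andP; split; slra.
have g1 : g <= expR (- b) - expR (- (b + 1)) by rewrite ge_min lexx.
have g2 : g <= expR (b + 1) - expR b by rewrite ge_min lexx orbT.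
move/continuousP_dist: cp => /(_ _ g0)[d d0 hd].
have pT : expR (- b) - g / 2 <= p.1 T <= expR b + g / 2.
  have [x [/andP[x0 xd] /andP[_ xT]]] := small_between _ _ d0 T0.
  have /andP[q1 q2] := pin (T - x) ltac:(slra).
  have := hd (T - x); rewrite ltr0_norm; last by slra.
  move=> /(_ ltac:(slra)); rewrite ltr_distl => /andP[h1 h2].
  by clear -q1 q2 h1 h2; apply/andP; split; lra.
exists (T + d / 2); first slra.
exists p.1, p.2; apply: bsol_psol (hp _) _ => r rT.
case: (ltP r T) => rT'.
  by have /andP[? ?] := pin r ltac:(slra); apply/andP; split; slra.
have := hd r; rewrite ger0_norm ?subr_ge0// => /(_ ltac:(slra)).
by rewrite ltr_distl => /andP[h1 h2]; clear -h1 h2 pT g1 g2; apply/andP; split; lra.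
Qed.

(** Continuation: at the supremum of the existence radii below S, the a priori bound and
    [psol_extend] give a larger radius, which must then exceed S. *)
Lemma psol_reach S al : 0 < al -> 0 < S ->
  (forall T, 0 < T <= S -> exists2 b, 0 < b & forall T' u u1, 0 < T' < T -> psol T' al u u1 ->
     forall r, 0 < r <= T' -> expR (- b) <= u r <= expR b) ->
  exists u u1, psol S al u u1.
Proof.
move=> al0 S0 hb.
pose A := [set T | 0 < T <= S /\ exists u u1, psol T al u u1].
have [T0 T00 [u0 [u01 hu0]]] := psol_short al al0.
have AT : A (Num.min T0 S).
  split; first by rewrite lt_min T00 S0 ge_min lexx orbT.
  by exists u0, u01; apply: psol_sub hu0; rewrite ge_min lexx.
have hsA : has_sup A by split; [exists (Num.min T0 S)|exists S => T [/andP[]]].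
pose T := sup A.
have TS : T <= S by apply: ge_sup; [exists (Num.min T0 S)|move=> x [/andP[]]].
have Tp : 0 < T.
  apply: (@lt_le_trans _ _ (Num.min T0 S)); first by rewrite lt_min T00.
  by apply: ub_le_sup => //; case: hsA.
have [b b0 bb] := hb T ltac:(slra).
have [|T' TT' [u [u1 us]]] := psol_extend T al b al0 Tp b0.
  move=> x /andP[x0 xT].
  have [y [/andP[y0 yS] [u [u1 us]]] xy] := sup_adherent (ltac:(slra) : 0 < T - x) hsA.
  exists u, u1; have ux : psol x al u u1 by apply: psol_sub us; rewrite -/T in xy; slra.
  by split=> // r rx; apply: (bb x u u1) => //; rewrite x0 xT.
case: (leP S T') => ST; first by exists u, u1; exact: psol_sub us.
have : T' <= T.
  by apply: ub_le_sup; [case: hsA|split; [slra|exists u, u1]].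
by slra.
Qed.
End Problem.

(** * Large initial values *)

Section Extremes.
Context {R : realType} (P : problem R).
Local Notation n := (pn R P).
Local Notation Q := (pQ R P).
Local Notation K := (pK R P).
Local Notation kap := (pkap R P).
Local Notation H := (pH R P).
Local Notation H' := (pH' R P).
Local Notation m := (pm R P).
Local Notation M := (pM R P).
Local Notation rb := (prb R P).
Local Notation psol := (psol P).

(** The vanishing flux in [psol] is enough: u coincides with a truncated solution, whose derivative
    is bounded by [bM], which tends to 0. *)
Lemma psol_lim_slope T al u u1 : 0 < al -> 0 < T -> psol T al u u1 -> lim0 u1 0.
Proof.
move=> al0 T0 us; have [b b0 ub] := psol_bounds _ _ _ _ _ al0 us.
have [p [hp [p2 pb]]] := bsol_exists P b al b0.
have e := psol_eq_bsol _ b T al u u1 p.1 p.2 b0 T0 us ub (hp T) pb.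
apply: (lim0_squeeze _ _ _ T T0 (bM_lim0 P b)) => r rT.
have [_ ->] := e r ltac:(slra); rewrite subr0; apply: p2; slra.
Qed.

Lemma M_le r s : 0 < r -> r <= s -> M r <= M s.
Proof. exact: (M_mono m M (pM_der R P) (m_ge0 P)). Qed.

Lemma M_pos r : 0 < r -> 0 <= M r.
Proof. exact: (M_ge0 m M (pM_der R P) (m_ge0 P) (pM_lim0 R P)). Qed.

Lemma ylny_ge (y : R) : 0 < y -> -1 <= y * ln y.
Proof.
move=> y0; have := expR_ge1Dx (- ln y); rewrite expRN lnK ?posrE// => h.
have : y * (1 + - ln y) <= y * y^-1 by rewrite ler_pM2l.
by rewrite divff ?gt_eqF//; slra.
Qed.

Lemma ylny_le (y : R) : 0 < y -> y * ln y <= y * (y - 1).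
Proof.
move=> y0; rewrite ler_pM2l//; have := expR_ge1Dx (ln y); rewrite lnK ?posrE//; slra.
Qed.

(** For ln y >= - l / 2 the bracket is at least l y / 2, and the factor 2 k restores l y. For
    smaller y all terms are exponentially small in l, hence below a multiple of 1 / l. *)
Lemma log_term (l y k : R) : 0 < l -> 0 < y -> 1 <= k <= 2 ->
  - (k * (2 * (l * y + y * ln y))) <= - (l * y) + 20 / l.
Proof.
move=> l0 y0 /andP[k1 k2].
have e1 : 16 * l * expR (- (l / 2)) <= 256 / l.
  have h : 1 + l / 4 <= expR (l / 4) by exact: expR_ge1Dx.
  have e : expR (l / 2) = expR (l / 4) ^+ 2 by rewrite -expRM_natl; congr expR; field.
  have h2 : l ^+ 2 / 16 <= expR (l / 2) by rewrite e; nra.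
  rewrite expRN ler_pdivlMr// mulrAC ler_pdivrMr ?expR_gt0//; nra.
have e2 : expR (- l) <= 1 / l.
  rewrite expRN div1r lef_pV2 ?posrE ?expR_gt0//.
  by have := expR_ge1Dx l; slra.
case: (lerP (- (l / 2)) (ln y)) => h.
  have : l / 2 * y <= (l + ln y) * y by rewrite ler_pM2r//; slra.
  have -> : (l + ln y) * y = l * y + y * ln y by ring.
  have il : 0 <= 20 / l by rewrite divr_ge0// ltW.
  move: (l * y + y * ln y) => Z hZ.
  have ly : 0 < l * y by rewrite mulr_gt0.
  have : l * y <= k * (2 * Z) by nra.
  slra.
have ye : y <= expR (- (l / 2)) by rewrite -[y]lnK ?posrE// ler_expR ltW.
have ly : l * y <= l * expR (- (l / 2)) by rewrite ler_pM2l.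
have z : - expR (- l) <= l * y + y * ln y.
  have y2 : 0 < y * expR l by rewrite mulr_gt0 ?expR_gt0.
  have := ylny_ge _ y2; rewrite lnM ?posrE ?expR_gt0// expRK => q.
  have e0 := expR_gt0 (- l).
  have ee : expR l * expR (- l) = 1 by rewrite -expRD subrr expR0.
  have : -1 * expR (- l) <= y * expR l * (ln y + l) * expR (- l) by rewrite ler_pM2r.
  have -> : y * expR l * (ln y + l) * expR (- l) = (expR l * expR (- l)) * (l * y + y * ln y) by ring.
  by rewrite ee mul1r mulN1r.
have il : 0 < l^-1 by rewrite invr_gt0.
have : - (k * (2 * (l * y + y * ln y))) <= 4 * expR (- l).
  have := expR_gt0 (- l); move: (l * y + y * ln y) z => Z *; nra.
move: e1 e2; rewrite -!mulrA !mul1r; move: (l^-1) il => I *; slra.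
Qed.

Lemma weight_lower (k Z : R) : 1 <= k -> k <= 2 -> -1 <= Z -> - (k * (2 * Z)) <= 4.
Proof. by move=> *; nra. Qed.

Lemma weight_upper (k Z l : R) : 1 <= k -> k <= 2 -> 1 <= l -> Z <= 2 * l + 2 ->
  k * (2 * Z) <= 8 * l + 8.
Proof. by move=> *; nra. Qed.

(** Multiplying by r^k makes the term (k / r) w1 part of a total derivative; as M' >= 0, the
    derivative of r^k M' is at least r^k m'. *)
Lemma flux_upper T (w1 h m' M' : R -> R) (k : nat) : 
  lim0 (fun r => r ^+ k * w1 r) 0 -> lim0 M' 0 ->
  (forall r, 0 < r < T -> 0 <= M' r) ->
  (forall r, 0 < r <= T -> has_der w1 r (h r - k%:R / r * w1 r)) ->
  (forall r, 0 < r <= T -> has_der M' r (m' r)) ->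
  (forall r, 0 < r < T -> h r <= m' r) ->
  forall r, 0 < r <= T -> w1 r <= M' r.
Proof.
move=> wl Ml M0 hw hM hm r rT; have /andP[r0 rT'] := rT.
have rn : 0 < r ^+ k by rewrite exprn_gt0.
have : r ^+ k * w1 r - 0 <= r ^+ k * M' r - 0.
  apply: (der_le_lim0 (fun r => r ^+ k * w1 r) (fun r => r ^+ k * M' r)
    (fun r => r ^+ k * h r) (fun r => r ^+ k * m' r + k%:R / r * r ^+ k * M' r) 0 0 T) => //.
  - by apply: lim0_eq (lim0M _ _ _ _ (lim0X _ _ _ lim0_id) Ml) _; rewrite mulr0.
  - by move=> s sT; have /andP[s0 _] := sT; apply: flux_der => //; exact: hw.
  - move=> s sT; have hMs := hM s sT; have s0 : s != 0 by rewrite gt_eqF//; slra.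
    by der; rewrite exprn_pred//; ring.
  - move=> s sT; have s0 : 0 < s by slra.
    have : s ^+ k * h s <= s ^+ k * m' s by rewrite ler_pM2l ?exprn_gt0// hm.
    have : 0 <= k%:R / s * s ^+ k * M' s.
      by rewrite !mulr_ge0 ?invr_ge0 ?exprn_ge0 ?M0// ltW.
    slra.
by rewrite !subr0 ler_pM2l.
Qed.

Lemma sqr_le_sqr (x y : R) : 0 <= x -> x <= y -> x ^+ 2 <= y ^+ 2.
Proof. by move=> x0 xy; rewrite lerXn2r// nnegrE// (le_trans x0). Qed.

(* Where 4 N z <= 4 (N + 2) x fails, z - x >= 2 z / (N + 2). *)
Lemma bump_laplacian (N x z : R) : 2 <= N -> 0 <= x -> x <= z -> 0 < z ->
  (4 * N * z - 4 * (N + 2) * x) * z <= (z - x) ^+ 2 * (N * (N + 2) ^+ 2).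
Proof.
move=> N2 x0 xz z0; have N0 : 0 <= N by lra.
have Np : 0 <= N + 2 by lra.
have xz0 : 0 <= (N + 2) * x * z by rewrite !mulr_ge0// ltW.
case: (lerP (N * z) ((N + 2) * x)) => h.
  apply: (@le_trans _ _ 0); last by rewrite mulr_ge0 ?sqr_ge0// mulr_ge0 ?sqr_ge0.
  by apply: mulr_le0_ge0; [lra|exact: ltW].
have h2 : 2 * z <= (N + 2) * (z - x) by lra.
have h3 : (2 * z) ^+ 2 <= ((N + 2) * (z - x)) ^+ 2.
  by rewrite lerXn2r ?nnegrE ?mulr_ge0 ?subr_ge0// ltW.
rewrite [leRHS]exprMn in h3.
have h4 : N * (2 * z) ^+ 2 <= N * ((N + 2) ^+ 2 * (z - x) ^+ 2) by rewrite ler_wpM2l.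
have -> : (z - x) ^+ 2 * (N * (N + 2) ^+ 2) = N * ((N + 2) ^+ 2 * (z - x) ^+ 2) by ring.
apply: le_trans h4; clear -xz0; lra.
Qed.

Section Large.
Variables (rho l c : R) (u u1 : R -> R).
Let N : R := n%:R + 1.
Let lam : R := N * (N + 2) ^+ 2.
(** Data refuted by an eigenvalue argument. The rescaled y = exp (- l) u starts from 1, and its
    Laplacian is roughly below - l y. The bump chi = (rho^2 - r^2)^2 satisfies - Lap chi <= (lam /
    rho^2) chi, and l is twice this constant. The number c is the fraction of the radius on which y
    >= 1/2 is guaranteed; the conditions on rho absorb the potential. *)
Record large : Prop := Large {
  rho_itv : 0 < rho <= 1;
  lE : l = 2 * lam / rho ^+ 2;
  cE : c = (8 * lam)^-1;
  large_psol : psol 1 (expR l) u u1;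
  rho_small1 : rho * (16 * (M 1 + 2)) <= 1;
  rho_small2 : rho * (2 * M 1 + 22) < lam * c ^+ n.+1 / (8 * N)
}.
Hypothesis L : large.

Let y r := expR (- l) * u r.
Let y1 r := expR (- l) * u1 r.

Lemma large_N2 : 2 <= N.
Proof. by have : 1 <= n%:R :> R; [rewrite ler1n pn_gt0|rewrite /N; lra]. Qed.
Lemma large_lam1 : 32 <= lam.
Proof.
have aux (x : R) : 2 <= x -> 32 <= x * (x + 2) ^+ 2.
  move=> x2; have h : 16 <= (x + 2) ^+ 2 by nra.
  by nra.
exact: aux large_N2.
Qed.
Lemma large_l1 : 1 <= l.
Proof.
have [r0 r1] := andP (rho_itv L).
rewrite (lE L) ler_pdivlMr ?exprn_gt0//.
have r2 : rho ^+ 2 <= 1 by nra.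
have := large_lam1; lra.
Qed.
Lemma large_M10 : 0 <= M 1. Proof. exact: M_pos. Qed.

Lemma large_ypos r : 0 < r <= 1 -> 0 < y r.
Proof. by move=> r1; have [h _ _] := large_psol L; have [_ _ q] := h r r1; rewrite mulr_gt0 ?expR_gt0. Qed.

Lemma large_hy r : 0 < r <= 1 -> has_der y r (y1 r).
Proof.
move=> r1; have [h _ _] := large_psol L; have [q _ _] := h r r1.
by rewrite /y /y1; der; ring.
Qed.

Lemma large_hy1 r : 0 < r <= 1 ->
  has_der y1 r ((Q r * y r - K r * (2 * (l * y r + y r * ln (y r)))) - n%:R / r * y1 r).
Proof.
move=> r1; have [h _ _] := large_psol L; have [_ q p] := h r r1.
rewrite /y1; der; rewrite /y lnM ?posrE ?expR_gt0// expRK; ring.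
Qed.

Lemma large_ylim : lim0 y 1.
Proof.
have [_ h _] := large_psol L; apply: lim0_eq (lim0M _ _ _ _ (lim0_cst _) h) _.
by rewrite -expRD addNr expR0.
Qed.

Lemma large_yflux : lim0 (fun r => r ^+ n * y1 r) 0.
Proof.
have [_ _ h] := large_psol L.
apply: (lim0_ext (fun r => expR (- l) * (r ^+ n * u1 r)) _ _ 1) => //.
  by move=> r _; rewrite /y1; ring.
by apply: lim0_eq (lim0M _ _ _ _ (lim0_cst _) h) _; rewrite mulr0.
Qed.

(** While y < 2, the potential contributes at most 2 m and the logarithmic term at most 4, because x
    ln x >= -1. Two integrations give y - 1 <= (2 M 1 + 4) rho < 1. *)
Lemma large_y_upper r : 0 < r <= rho -> 0 < 2 - y r.
Proof.
have rho01 := rho_itv L; have l1' := large_l1; have M10' := large_M10; have lam1' := large_lam1.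
have N2' := large_N2; have sm1 := rho_small1 L; have sm2 := rho_small2 L.
have ypos := large_ypos; have hy := large_hy; have hy1 := large_hy1; have ylim := large_ylim; have yflux := large_yflux.
apply: (continuity_induction (fun r => 2 - y r) 0 rho).
- move=> x xr; apply: has_der_cont; apply: has_derD; first exact: has_der_cst.
  by apply: has_derN; apply: hy; slra.
- have /lim0P h := ylim; have [d d0 hd] := h 1 ltr01; exists d => // x; rewrite add0r => /hd.
  by rewrite ltr_distl => /andP[? ?] _; slra.
move=> t /andP[t0 tr] hs.
have up r1 : 0 < r1 <= t -> y1 r1 <= 2 * M r1 + 4 * r1.
  apply: (flux_upper t y1 (fun r => Q r * y r - K r * (2 * (l * y r + y r * ln (y r))))
    (fun r => 2 * m r + 4) (fun r => 2 * M r + 4 * r) n yflux).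
  - apply: lim0_eq (lim0D _ _ _ _ (lim0M _ _ _ _ (lim0_cst _) (pM_lim0 R P))
     (lim0M _ _ _ _ (lim0_cst _) lim0_id)) _; ring.
  - by move=> s ?; have := M_pos s ltac:(slra); slra.
  - by move=> s ?; apply: hy1; slra.
  - by move=> s ?; have h := pM_der R P s ltac:(slra); der; ring.
  - move=> s st; have ys := ypos s ltac:(slra); have y2 := hs s ltac:(slra).
    have /andP[K1 K2] := pK_itv R P s ltac:(slra); have := pQ_le R P s ltac:(slra).
    rewrite ler_norml => /andP[_ Q1].
    have z : -1 <= l * y s + y s * ln (y s).
      have := ylny_ge _ ys; have : 0 <= l * y s by rewrite mulr_ge0//; slra.
      slra.
    have := m_ge0 P s ltac:(slra) => m0.
    have q1 : Q s * y s <= 2 * m s.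
      apply: (@le_trans _ _ (m s * y s)); first by rewrite ler_pM2r.
      by rewrite mulrC ler_wpM2r//; slra.
    have q2 : - (K s * (2 * (l * y s + y s * ln (y s)))) <= 4.
      exact: weight_lower.
    clear -L q1 q2; lra.
have : y t - 1 <= (2 * M 1 + 4) * t - (2 * M 1 + 4) * 0.
  apply: (der_le_lim0 y (fun r => (2 * M 1 + 4) * r) y1 (fun=> 2 * M 1 + 4) 1 _ t ylim).
  - by apply: lim0M lim0_id; exact: lim0_cst.
  - by move=> s ?; apply: hy; slra.
  - by move=> s _; der; ring.
  - move=> s ?; have := up s ltac:(slra); have := M_le s 1 ltac:(slra) ltac:(slra); slra.
  - by rewrite t0 lexx.
have : (2 * M 1 + 4) * t <= (2 * M 1 + 4) * rho by rewrite ler_wpM2l//; slra.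
slra.
Qed.

Lemma large_c01 : 0 < c /\ c <= 1 / 8.
Proof.
have rho01 := rho_itv L; have l1' := large_l1; have M10' := large_M10; have lam1' := large_lam1.
have N2' := large_N2; have sm1 := rho_small1 L; have sm2 := rho_small2 L.
have ypos := large_ypos; have hy := large_hy; have hy1 := large_hy1; have ylim := large_ylim; have yflux := large_yflux.
have p : 0 < 8 * lam by slra.
by rewrite (cE L) invr_gt0 p; split => //; rewrite -[1/8]invf_div divr1 lef_pV2 ?posrE//; slra.
Qed.

(** Here y may fall at the rate (8 l + 8) r, with l large. The choice c = 1 / (8 lam) makes l (c
    rho)^2 = 1 / (32 lam), so the total fall is below 1/2. *)
Lemma large_y_lower r : 0 < r <= c * rho -> 1 / 2 <= y r.
Proof.
have rho01 := rho_itv L; have l1' := large_l1; have M10' := large_M10; have lam1' := large_lam1.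
have N2' := large_N2; have sm1 := rho_small1 L; have sm2 := rho_small2 L.
have ypos := large_ypos; have hy := large_hy; have hy1 := large_hy1; have ylim := large_ylim; have yflux := large_yflux.
have y_upper := large_y_upper.
have [c0 c1] := large_c01.
have [cr crE] : exists cr, cr = c * rho by exists (c * rho).
have crho : cr <= rho by rewrite crE; clear -L c0 c1 rho01; nra.
rewrite -crE.
have lo r1 : 0 < r1 <= rho -> - y1 r1 <= 2 * M r1 + (8 * l + 8) * r1.
  apply: (flux_upper rho (fun r => - y1 r)
    (fun r => - (Q r * y r - K r * (2 * (l * y r + y r * ln (y r)))))
    (fun r => 2 * m r + (8 * l + 8)) (fun r => 2 * M r + (8 * l + 8) * r) n).
  - apply: lim0_eq (lim0_ext _ _ _ 1 _ _ (lim0N _ _ yflux)) _ => //; last by rewrite oppr0.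
    by move=> s _; rewrite mulrN.
  - apply: lim0_eq (lim0D _ _ _ _ (lim0M _ _ _ _ (lim0_cst _) (pM_lim0 R P))
     (lim0M _ _ _ _ (lim0_cst _) lim0_id)) _; ring.
  - move=> s ?; have := M_pos s ltac:(slra); have : 0 <= (8 * l + 8) * s by rewrite mulr_ge0//; slra.
    slra.
  - by move=> s ?; have h := hy1 s ltac:(slra); der; ring.
  - by move=> s ?; have h := pM_der R P s ltac:(slra); der; ring.
  - move=> s st; have ys := ypos s ltac:(slra); have y2 := y_upper s ltac:(slra).
    have /andP[K1 K2] := pK_itv R P s ltac:(slra); have := pQ_le R P s ltac:(slra).
    rewrite ler_norml => /andP[Q1 _].
    have z : l * y s + y s * ln (y s) <= 2 * l + 2.
      have := ylny_le _ ys; have : l * y s <= l * 2 by rewrite ler_pM2l; slra.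
      have q0 : y s * (y s - 1) <= 2 by clear -L ys y2; nra.
      clear -L q0; lra.
    have z1 : -1 <= l * y s + y s * ln (y s).
      have := ylny_ge _ ys; have : 0 <= l * y s by rewrite mulr_ge0//; slra.
      slra.
    have := m_ge0 P s ltac:(slra) => m0.
    have q1 : - (Q s * y s) <= 2 * m s.
      apply: (@le_trans _ _ (m s * y s)); first by rewrite -mulNr ler_pM2r//; slra.
      by rewrite mulrC ler_wpM2r//; slra.
    have q2 : K s * (2 * (l * y s + y s * ln (y s))) <= 8 * l + 8.
      exact: weight_upper.
    clear -L q1 q2; lra.
move=> rc; have : - y r - (- 1) <= (2 * M 1 * r + (4 * l + 4) * r ^+ 2) - 0.
  apply: (der_le_lim0 (fun r => - y r) (fun r => 2 * M 1 * r + (4 * l + 4) * r ^+ 2)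
    (fun r => - y1 r) (fun r => 2 * M 1 + (8 * l + 8) * r) (-1) 0 cr _ _ _ _ _ r rc).
  - exact: lim0N.
  - apply: lim0_eq (lim0D _ _ _ _ (lim0M _ _ _ _ (lim0_cst _) lim0_id)
     (lim0M _ _ _ _ (lim0_cst _) (lim0X _ _ 2 lim0_id))) _; by rewrite expr0n /=; ring.
  - by move=> s ?; apply: has_derN; apply: hy; slra.
  - by move=> s _; der; rewrite /=; ring.
  - move=> s ?; have := lo s ltac:(slra); have := M_le s 1 ltac:(slra) ltac:(slra); slra.
have lr : l * cr ^+ 2 <= 1 / 32.
  have -> : l * cr ^+ 2 = (32 * lam)^-1.
    by rewrite crE (lE L) (cE L); field; rewrite !gt_eqF//; slra.
  by rewrite -[1/32]invf_div divr1 lef_pV2 ?posrE//; slra.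
have r2 : r ^+ 2 <= cr ^+ 2 by apply: sqr_le_sqr; slra.
have lr' : l * r ^+ 2 <= 1 / 32 by apply: le_trans lr; rewrite ler_pM2l//; slra.
have rs : 2 * M 1 * r <= 2 * M 1 * rho by rewrite ler_wpM2l//; slra.
have rr : r ^+ 2 <= rho / 8.
  have h1 : c ^+ 2 <= 1 / 8 by clear -L c0 c1; nra.
  have h2 : rho ^+ 2 <= rho by clear -L rho01; nra.
  apply: le_trans r2 _; rewrite crE exprMn [leRHS]mulrC -[8^-1]div1r.
  by apply: ler_pM; rewrite ?sqr_ge0.
by move=> h; clear -L lr' rs rr sm1 rho01 h; lra.
Qed.

(** Green's identity for y and chi: f = r^n (chi y' - chi' y) vanishes at rho together with chi and
    chi', and tends to 0 at 0, whereas its derivative r^n (chi Lap y - y Lap chi) has a negative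
    integral. *)
Lemma large_absurd : False.
Proof.
have rho01 := rho_itv L; have l1' := large_l1; have M10' := large_M10; have lam1' := large_lam1.
have N2' := large_N2; have sm1 := rho_small1 L; have sm2 := rho_small2 L.
have ypos := large_ypos; have hy := large_hy; have hy1 := large_hy1; have ylim := large_ylim; have yflux := large_yflux.
have y_upper := large_y_upper; have y_lower := large_y_lower.
have [c0 c1] := large_c01.
have rho_gt0 : 0 < rho by slra.
have [cr crE] : exists cr, cr = c * rho by exists (c * rho).
have crho : cr <= rho by rewrite crE; clear -L c0 c1 rho01; nra.
have crp : 0 < cr by rewrite crE mulr_gt0.
rewrite -crE in y_lower.
have rho2 : 0 < rho ^+ 2 by rewrite exprn_gt0.
have L20 : 0 < lam / rho ^+ 2 by apply: divr_gt0 => //; slra.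
pose chi r := (rho ^+ 2 - r ^+ 2) ^+ 2.
pose f r := r ^+ n * (chi r * y1 r + 4 * r * (rho ^+ 2 - r ^+ 2) * y r).
pose e0 := 20 / l.
have e0_le : 0 <= e0 <= 20.
  by rewrite /e0 divr_ge0 ?ler_pdivrMr//; slra.
pose f' r := r ^+ n * (chi r * (Q r * y r - K r * (2 * (l * y r + y r * ln (y r))))
   + (4 * N * rho ^+ 2 - 4 * (N + 2) * r ^+ 2) * y r).
have hf r : 0 < r <= 1 -> has_der f r (f' r).
  move=> r1; have h1 := hy r r1; have h2 := hy1 r r1; have rn : r != 0 by rewrite gt_eqF//; slra.
  rewrite /f /chi; der; rewrite /= exprn_pred// /f' /chi /N; field.
  exact: rn.
have chi_le r : 0 < r <= rho -> 0 <= chi r <= rho ^+ 4.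
  move=> rr; rewrite sqr_ge0 /chi.
  have -> : rho ^+ 4 = (rho ^+ 2) ^+ 2 by rewrite -exprM.
  have r2 : r ^+ 2 <= rho ^+ 2 by apply: sqr_le_sqr; slra.
  have r3 := sqr_ge0 r.
  by apply: sqr_le_sqr; [rewrite subr_ge0|rewrite gerBl].
have f'_le r : 0 < r <= rho ->
    f' r <= r ^+ n * (chi r * (2 * m r + e0 - lam / rho ^+ 2 * y r)).
  move=> rr; rewrite /f' ler_pM2l ?exprn_gt0//; last by slra.
  have ys := ypos r ltac:(slra); have y2 := y_upper r rr; have /andP[ch0 ch1] := chi_le r rr.
  have := pQ_le R P r ltac:(slra); rewrite ler_norml => /andP[_ Q1].
  have m0 := m_ge0 P r ltac:(slra).
  have q1 : Q r * y r <= 2 * m r.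
    apply: (@le_trans _ _ (m r * y r)); first by rewrite ler_pM2r.
    by rewrite mulrC ler_wpM2r//; slra.
  have q2 := log_term l (y r) (K r) ltac:(slra) ys (pK_itv R P r ltac:(slra)).
  have q3 : 4 * N * rho ^+ 2 - 4 * (N + 2) * r ^+ 2 <= chi r * (lam / rho ^+ 2).
    have rh2 : 0 < rho ^+ 2 by rewrite exprn_gt0.
    rewrite mulrA ler_pdivlMr// /chi /lam.
    by apply: bump_laplacian => //; [exact: sqr_ge0|apply: sqr_le_sqr; slra].
  have q4 : (4 * N * rho ^+ 2 - 4 * (N + 2) * r ^+ 2) * y r <= chi r * (lam / rho ^+ 2) * y r.
    by rewrite ler_pM2r.
  have q5 : chi r * (Q r * y r - K r * (2 * (l * y r + y r * ln (y r)))) <=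
     chi r * (2 * m r + e0 - l * y r).
    by rewrite ler_wpM2l// /e0; clear -L q1 q2; lra.
  have -> : chi r * (2 * m r + e0 - lam / rho ^+ 2 * y r) =
     chi r * (2 * m r + e0 - l * y r) + chi r * (lam / rho ^+ 2) * y r by rewrite (lE L); ring.
  exact: lerD.
pose B r := rho ^+ 4 * (r ^+ n * (2 * M r + e0 * r)).
pose B' r := rho ^+ 4 * (r ^+ n * (2 * m r + e0) + n%:R / r * r ^+ n * (2 * M r + e0 * r)).
have hB r : 0 < r -> has_der B r (B' r).
  move=> r0; have h := pM_der R P r r0; have rn := lt0r_neq0 r0.
  rewrite /B; der; rewrite exprn_pred// /B'; ring.
have B'_ge r : 0 < r -> rho ^+ 4 * (r ^+ n * (2 * m r + e0)) <= B' r.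
  move=> r0; rewrite /B' ler_pM2l ?exprn_gt0// lerDl.
  have Mr := M_pos r r0.
  have a1 : 0 <= e0 * r by rewrite mulr_ge0//; slra.
  have a2 : 0 <= r ^+ n by rewrite exprn_ge0// ltW.
  have a3 : 0 <= n%:R / r by rewrite divr_ge0// ltW.
  by apply: mulr_ge0; [exact: mulr_ge0|apply: addr_ge0 => //; exact: mulr_ge0].
(* On ]0, cr] the bounds y >= 1/2 and chi >= rho^4 / 4 give a definite negative contribution - (lam
   rho^2 / 8) r^n; B collects the potential and the error of [log_term]. *)
have step1 : f cr - 0 <= (B cr - lam * rho ^+ 2 / (8 * N) * cr ^+ n.+1) - 0.
  apply: (der_le_lim0 f (fun r => B r - lam * rho ^+ 2 / (8 * N) * r ^+ n.+1) f'
    (fun r => B' r - lam * rho ^+ 2 / 8 * r ^+ n) 0 0 cr).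
  - apply: (lim0_ext (fun r => chi r * (r ^+ n * y1 r) + 4 * r * (rho ^+ 2 - r ^+ 2) * r ^+ n * y r) _ _ 1) => //.
      by move=> r _; rewrite /f; ring.
    have lr2 := lim0X _ _ 2 (@lim0_id R).
    have ld := lim0D _ _ _ _ (lim0_cst (rho ^+ 2)) (lim0N _ _ lr2).
    have lc := lim0X _ _ 2 ld.
    have l4 := lim0M _ _ _ _ (lim0_cst 4) (@lim0_id R).
    have lrn := lim0X _ _ n (@lim0_id R).
    have la := lim0M _ _ _ _ lc yflux.
    have lb := lim0M _ _ _ _ (lim0M _ _ _ _ (lim0M _ _ _ _ l4 ld) lrn) ylim.
    by apply: lim0_eq (lim0D _ _ _ _ la lb) _; ring.
  - have lrn := lim0X _ _ n (@lim0_id R).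
    have l2 := lim0M _ _ _ _ (lim0_cst 2) (pM_lim0 R P).
    have l3 := lim0M _ _ _ _ (lim0_cst e0) (@lim0_id R).
    have la := lim0M _ _ _ _ (lim0_cst (rho ^+ 4)) (lim0M _ _ _ _ lrn (lim0D _ _ _ _ l2 l3)).
    have lb := lim0M _ _ _ _ (lim0_cst (lam * rho ^+ 2 / (8 * N))) (lim0X _ _ n.+1 (@lim0_id R)).
    apply: lim0_eq (lim0D _ _ _ _ la (lim0N _ _ lb)) _; rewrite [0 ^+ n.+1]expr0n /=; ring.
  - by move=> r ?; apply: hf; slra.
  - move=> r ?; have h := hB r ltac:(slra); have eN : n.+1%:R = N by rewrite /N natr1.
    by der; rewrite eN /=; field; rewrite gt_eqF//; slra.
  - move=> r rr; apply: le_trans (f'_le r _) _; first by slra.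
    have yr := y_lower r ltac:(slra); have m0 := m_ge0 P r ltac:(slra).
    have rn : 0 < r ^+ n by rewrite exprn_gt0//; slra.
    have /andP[ch0 ch1] := chi_le r ltac:(slra).
    have ch2 : rho ^+ 4 / 4 <= chi r.
      have : r ^+ 2 <= cr ^+ 2 by apply: sqr_le_sqr; slra.
      have c2 : c ^+ 2 <= 1 / 2 by clear -L c0 c1; nra.
      have : cr ^+ 2 <= 1 / 2 * rho ^+ 2 by rewrite crE exprMn ler_pM2r ?exprn_gt0.
      have rh2 : 0 < rho ^+ 2 by rewrite exprn_gt0.
      have -> : rho ^+ 4 = (rho ^+ 2) ^+ 2 by rewrite -exprM.
      rewrite /chi; move: (rho ^+ 2) (r ^+ 2) rh2 (cr ^+ 2) (sqr_ge0 r) => z x z0 w x0 h1 h2; clear -L z0 h1 h2 x0; nra.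
    have rh0 : rho ^+ 2 != 0 by rewrite expf_neq0// gt_eqF.
    have k1 : rho ^+ 4 / 4 * (lam / rho ^+ 2) * (1 / 2) <= chi r * (lam / rho ^+ 2) * y r.
      have rh4 : 0 <= rho ^+ 4 / 4 by rewrite divr_ge0// exprn_ge0// ltW.
      apply: ler_pM; [by apply: mulr_ge0 => //; exact: ltW|slra| |exact: yr].
      by rewrite ler_pM2r.
    have k2 : rho ^+ 4 / 4 * (lam / rho ^+ 2) * (1 / 2) = lam * rho ^+ 2 / 8.
      by field; rewrite gt_eqF.
    rewrite k2 in k1.
    have me0 : 0 <= 2 * m r + e0 by clear -L m0 e0_le; lra.
    have k3 : chi r * (2 * m r + e0) <= rho ^+ 4 * (2 * m r + e0) by rewrite ler_wpM2r.
    have k4 : r ^+ n * (chi r * (2 * m r + e0 - lam / rho ^+ 2 * y r)) <=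
       r ^+ n * (rho ^+ 4 * (2 * m r + e0) - lam * rho ^+ 2 / 8).
      by rewrite ler_pM2l//; clear -L k1 k3; lra.
    have B'r := B'_ge r ltac:(slra); clear -L k4 B'r; lra.
  - by rewrite crp lexx.
(* Beyond cr the contribution of y, known only to have the right sign, is dropped. *)
have step2 : f rho - f cr <= B rho - B cr.
  apply: (der_le_le f B f' B' _ _ crho).
  - by move=> r ?; apply: hf; slra.
  - by move=> r ?; apply: hB; slra.
  - move=> r rr; apply: le_trans (f'_le r _) _; first by slra.
    have ys := ypos r ltac:(slra); have m0 := m_ge0 P r ltac:(slra).
    have rn : 0 < r ^+ n by rewrite exprn_gt0//; slra.
    have /andP[ch0 ch1] := chi_le r ltac:(slra).
    have me0 : 0 <= 2 * m r + e0 by clear -L m0 e0_le; lra.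
    have k3 : chi r * (2 * m r + e0) <= rho ^+ 4 * (2 * m r + e0) by rewrite ler_wpM2r.
    have k1 : 0 <= chi r * (lam / rho ^+ 2 * y r).
      by apply: mulr_ge0 => //; apply: mulr_ge0; exact: ltW.
    have k4 : r ^+ n * (chi r * (2 * m r + e0 - lam / rho ^+ 2 * y r)) <=
       r ^+ n * (rho ^+ 4 * (2 * m r + e0)) by rewrite ler_pM2l//; clear -L k1 k3; lra.
    by apply: le_trans k4 _; rewrite mulrCA; apply: B'_ge; slra.
have frho : f rho = 0 by rewrite /f /chi subrr expr0n /=; ring.
have : 0 <= B rho - lam * rho ^+ 2 / (8 * N) * cr ^+ n.+1 by rewrite frho in step2; clear -L step1 step2; lra.
(* Both terms scale like rho^(n+3), but the error keeps one more factor rho, so a small rho decides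
   the sign. *)
have -> : B rho - lam * rho ^+ 2 / (8 * N) * cr ^+ n.+1 =
   rho ^+ n.+3 * (rho * (2 * M rho + e0 * rho) - lam * c ^+ n.+1 / (8 * N)).
  by rewrite /B crE exprMn !exprS; ring.
rewrite pmulr_rge0 ?exprn_gt0// => q.
have Mr := M_le rho 1 rho_gt0 ltac:(slra).
have : rho * (2 * M rho + e0 * rho) <= rho * (2 * M 1 + 22).
  rewrite ler_pM2l//; have : e0 * rho <= 20 * 1.
    by case/andP: e0_le => e00 e01; case/andP: rho01 => _ rho1; apply: ler_pM => //; exact: ltW.
  clear -L Mr; lra.
clear -L q sm2; lra.
Qed.
End Large.

Lemma psol_large : exists2 al, 0 < al & forall u u1, ~ psol 1 al u u1.
Proof.
pose N : R := n%:R + 1; pose lam := N * (N + 2) ^+ 2; pose c := (8 * lam)^-1.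
have M1 : 0 <= M 1 by exact: M_pos.
have N1 : 1 <= N by rewrite /N lerDr.
have lam0 : 0 < lam by rewrite /lam mulr_gt0 ?exprn_gt0//; slra.
have k0 : 0 < lam * c ^+ n.+1 / (8 * N).
  by rewrite divr_gt0 ?mulr_gt0 ?exprn_gt0 ?invr_gt0 ?mulr_gt0//; slra.
(* The 23, against 22 in [rho_small2], yields the strict inequality. *)
pose A := (16 * (M 1 + 2))^-1; pose B := lam * c ^+ n.+1 / (8 * N) / (2 * M 1 + 23).
have A0 : 0 < A by rewrite invr_gt0; slra.
have B0 : 0 < B by rewrite divr_gt0//; slra.
pose rho := Num.min A B.
have rA : rho <= A by rewrite ge_min lexx.
have rB : rho <= B by rewrite ge_min lexx orbT.
have r0 : 0 < rho by rewrite lt_min A0.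
have s1 : rho * (16 * (M 1 + 2)) <= 1 by rewrite -ler_pdivlMr ?div1r//; slra.
have s2 : rho * (2 * M 1 + 23) <= lam * c ^+ n.+1 / (8 * N) by rewrite -ler_pdivlMr//; slra.
exists (expR (2 * lam / rho ^+ 2)); first exact: expR_gt0.
move=> u u1 us; apply: (large_absurd rho (2 * lam / rho ^+ 2) c u u1); split => //.
- by rewrite r0 /=; nra.
- by rewrite -/N -/lam; nra.
Qed.
End Extremes.

(** * Small initial values *)

Section SmallData.
Context {R : realType} (P : problem R).
Local Notation n := (pn R P).
Local Notation Q := (pQ R P).
Local Notation K := (pK R P).
Local Notation kap := (pkap R P).
Local Notation H := (pH R P).
Local Notation H' := (pH' R P).
Local Notation m := (pm R P).
Local Notation M := (pM R P).
Local Notation rb := (prb R P).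
Local Notation psol := (psol P).

Lemma small_gain (k L g La : R) : 1 <= k <= 2 -> L = 8 * La ^+ 2 -> - La ^+ 2 <= g <= La ^+ 2 ->
  6 * La ^+ 2 <= k * (L - 2 * g) <= 20 * La ^+ 2.
Proof.
move=> /andP[k1 k2] -> /andP[g1 g2]; have L0 := sqr_ge0 La.
move: (La ^+ 2) L0 g1 g2 => z *; apply/andP; split; nra.
Qed.

Lemma sqr_gap (z w : R) : - z < w -> w < z -> 0 < z ^+ 2 - w ^+ 2.
Proof. by move=> *; nra. Qed.

Lemma small_scale (La a s : R) : 1 <= La -> a <= La -> 6 * s + 1 <= La -> 0 < s ->
  (5 * La + a) * s < La ^+ 2.
Proof.
move=> L1 aL sL s0; have : (5 * La + a) * s <= 6 * La * s by rewrite ler_pM2r//; slra.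
have : La * (6 * s + 1) <= La * La by rewrite ler_wpM2l//; slra.
by rewrite expr2; slra.
Qed.

(* With u(0) = expR (- L / 2), L = 8 La^2, the logarithmic derivative
   q = u'/u obeys a Riccati equation whose forcing term is of order La^2. *)
Section Riccati.
Variables (La T S : R) (u u1 : R -> R).
Let L : R := 8 * La ^+ 2.
Let l : R := - L / 2.
Record small_flow : Prop := SmallFlow {
  small_itv : 0 < T <= S;
  small_La : M S + 1 <= La;
  small_LaS : (5 * La + M S) * S < La ^+ 2;
  small_psol : psol T (expR l) u u1
}.
Hypothesis D : small_flow.

Let q r := u1 r / u r.
Let g r := ln (u r) - l.

Lemma small_hg r : 0 < r <= T -> has_der g r (q r).
Proof.
move=> rT; have [h _ _] := small_psol D; have [h1 h2 h3] := h r rT.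
by rewrite /g /q; der => //; field; exact: lt0r_neq0.
Qed.

Lemma small_hq r : 0 < r <= T ->
  has_der q r (- q r ^+ 2 - n%:R / r * q r + Q r + K r * (L - 2 * g r)).
Proof.
move=> rT; have [h _ _] := small_psol D; have [h1 h2 h3] := h r rT; have r0 : 0 < r by lra.
have rn := lt0r_neq0 r0; have un := lt0r_neq0 h3.
rewrite /g /q /l; der => //; field.
by rewrite ?rn ?un.
Qed.

Lemma small_qlim : lim0 q 0.
Proof.
have T00 : 0 < T by case/andP: (small_itv D).
have el : 0 < expR l by exact: expR_gt0.
have h1 := psol_lim_slope P T _ u u1 el T00 (small_psol D); have [_ h2 _] := small_psol D.
apply: lim0_eq; first apply: lim0M h1 _.
  apply: (lim0_comp u (fun x => x^-1) _ h2).
  by apply: (has_der_cont (fun x : R => x^-1)); apply: has_derV (has_der_id _); rewrite gt_eqF.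
by rewrite mul0r.
Qed.

Lemma small_glim : lim0 g 0.
Proof.
have [_ h2 _] := small_psol D; have el : 0 < expR l by exact: expR_gt0.
have : lim0 (fun r => ln (u r)) (ln (expR l)) by apply: lim0_comp => //; exact: continuous_ln.
rewrite expRK => h; apply: lim0_eq (lim0D _ _ _ _ h (lim0_cst (- l))) _.
by rewrite subrr.
Qed.

(** While |g| <= La^2 the forcing K (L - 2 g) lies between 6 La^2 and 20 La^2. It pushes q up from -
    M, and above 5 La the term - q^2 <= - 25 La^2 wins. In turn |g| stays below (5 La + M S) S <
    La^2, which closes the bootstrap. *)
Lemma riccati_bounds r : 0 < r <= T ->
  [/\ - La ^+ 2 <= g r <= La ^+ 2, - M r <= q r & q r <= 5 * La + M r].
Proof.
have T0' := small_itv D; have La1' := small_La D; have LaS' := small_LaS D.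
have hg := small_hg; have hq := small_hq; have qlim := small_qlim; have glim := small_glim.
have S0 : 0 < S by slra.
have MS : 0 <= M S by exact: M_pos.
have La0 : 1 <= La by slra.
have glow s t : 0 < s < t -> t <= T -> (forall x, 0 < x < t -> - La ^+ 2 <= g x <= La ^+ 2) ->
    - M s <= q s /\ q s <= 5 * La + M s.
  move=> st tT hg1.
  have gain x : 0 < x <= s -> 6 * La ^+ 2 <= K x * (L - 2 * g x) <= 20 * La ^+ 2.
    by move=> xs; apply: small_gain => //; [apply: pK_itv|apply: hg1]; slra.
  split.
    suff : 0 <= q s + M s by slra.
    apply: (barrier (fun r => q r + M r)
      (fun r => (- q r ^+ 2 - n%:R / r * q r + Q r + K r * (L - 2 * g r)) + m r) 0 s).
    - have h : lim0 (fun r => q r + M r) 0.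
        by apply: lim0_eq (lim0D _ _ _ _ qlim (pM_lim0 R P)) _; rewrite addr0.
      move=> e e0; have /lim0P := h; move=> /(_ e e0)[d d0 hd].
      by exists d => // x; rewrite add0r => /hd; rewrite subr0 ltr_norml => /andP[? _].
    - move=> x xs; have h1 := hq x ltac:(slra); have h2 := pM_der R P x ltac:(slra).
      by apply: has_derD.
    - move=> x xs xneg; have /andP[g1 _] := gain x xs.
      have := M_le P x S ltac:(slra) ltac:(slra); have Mx := M_pos P x ltac:(slra).
      have := pQ_le R P x ltac:(slra); rewrite ler_norml => /andP[Q1 _] MxS.
      have q1 : 0 <= - q x <= La by slra.
      have q2 : q x ^+ 2 <= La ^+ 2 by clear -D q1; nra.
      have q3 : 0 <= n%:R / x * - q x.
        by apply: mulr_ge0; [apply: divr_ge0 => //; slra|slra].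
      have := sqr_ge0 La; clear -D g1 Q1 q2 q3; lra.
    - slra.
  suff : 0 <= 5 * La + M s - q s by slra.
  apply: (barrier (fun r => 5 * La + M r - q r)
    (fun r => m r - (- q r ^+ 2 - n%:R / r * q r + Q r + K r * (L - 2 * g r))) 0 s).
  - have h : lim0 (fun r => 5 * La + M r - q r) (5 * La).
      by apply: lim0_eq (lim0D _ _ _ _ (lim0D _ _ _ _ (lim0_cst _) (pM_lim0 R P)) (lim0N _ _ qlim)) _; ring.
    move=> e e0; have /lim0P := h; move=> /(_ (5 * La) ltac:(slra))[d d0 hd].
    exists d => // x; rewrite add0r => /hd; rewrite ltr_distl => /andP[? _] _; slra.
  - move=> x xs; have h1 := hq x ltac:(slra); have h2 := pM_der R P x ltac:(slra).
    by der; ring.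
  - move=> x xs xneg; have /andP[_ g1] := gain x xs.
    have Mx := M_pos P x ltac:(slra).
    have := pQ_le R P x ltac:(slra); rewrite ler_norml => /andP[_ Q1].
    have q1 : 5 * La <= q x by slra.
    have q2 : 25 * La ^+ 2 <= q x ^+ 2 by clear -D q1 La0; nra.
    have q3 : 0 <= n%:R / x * q x.
      by apply: mulr_ge0; [apply: divr_ge0 => //; slra|slra].
    have := sqr_ge0 La; clear -D g1 Q1 q2 q3; lra.
  - slra.
have gpos v : 0 < v <= T -> 0 < (La ^+ 2) ^+ 2 - g v ^+ 2.
  apply: (continuity_induction (fun r => (La ^+ 2) ^+ 2 - g r ^+ 2) 0 T).
  - move=> x xT; apply: has_der_cont; have h := hg x xT; der; reflexivity.
  - have /lim0P := glim; move=> /(_ 1 ltr01)[d d0 hd]; exists d => // x; rewrite add0r => /hd.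
    rewrite subr0 ltr_norml => /andP[? ?] _; have : 1 <= La ^+ 2 by nra.
    by move: (La ^+ 2) => z ?; nra.
  move=> t tT hs.
  have hg1 x : 0 < x < t -> - La ^+ 2 <= g x <= La ^+ 2.
    move=> xt; have := hs x xt; have := sqr_ge0 La; move: (La ^+ 2) (g x) => z w *.
    by apply/andP; split; nra.
  have : `|g t - 0| <= (5 * La + M S) * t - 0.
    apply: (der_norm_lim0 g (fun r => (5 * La + M S) * r) q (fun=> 5 * La + M S) 0 0 t glim).
    - by apply: lim0_eq (lim0M _ _ _ _ (lim0_cst _) lim0_id) _; rewrite mulr0.
    - by move=> x ?; apply: hg; slra.
    - by move=> x _; der; ring.
    - move=> x xt; have [q1 q2] := glow x t xt ltac:(slra) hg1.
      have := M_le P x S ltac:(slra) ltac:(slra) => ?.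
      by rewrite ler_norml; apply/andP; split; slra.
    - slra.
  rewrite !subr0 => gt.
  have : (5 * La + M S) * t <= (5 * La + M S) * S by rewrite ler_wpM2l//; slra.
  move=> gS; have : `|g t| < La ^+ 2 by slra.
  rewrite ltr_norml => /andP[g1 g2]; exact: sqr_gap.
move=> rT.
have hg1 x : 0 < x <= T -> - La ^+ 2 <= g x <= La ^+ 2.
  move=> xt; have := gpos x xt; have := sqr_ge0 La; move: (La ^+ 2) (g x) => z w *.
  by apply/andP; split; nra.
have inner s : 0 < s < T -> - M s <= q s /\ q s <= 5 * La + M s.
  by move=> sT; apply: (glow s T) => // x ?; apply: hg1; slra.
split; first exact: hg1.
- case: (ltP r T) => rT'; first by case: (inner r ltac:(by case/andP: rT => ->)).
  have {rT' rT} -> : r = T by apply/eqP; rewrite eq_le rT' andbT; case/andP: rT.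
  have c : {for T, continuous (fun r => - (q r + M r))}.
    apply: has_der_cont; have h1 := hq T ltac:(slra); have h2 := pM_der R P T ltac:(slra).
    by der; reflexivity.
  rewrite leNgt; apply/negP => neg.
  have [|d d0 hd] := continuous_gt0 _ _ c; first slra.
  have [x [/andP[x0 xd] /andP[_ xT]]] := small_between _ _ d0 (ltac:(slra) : 0 < T).
  have := hd (T - x); rewrite ltr0_norm; last by slra.
  by move=> /(_ ltac:(slra)); have [i1 _] := inner (T - x) ltac:(slra); clear -D i1; lra.
- case: (ltP r T) => rT'; first by case: (inner r ltac:(by case/andP: rT => ->)).
  have {rT' rT} -> : r = T by apply/eqP; rewrite eq_le rT' andbT; case/andP: rT.
  have c : {for T, continuous (fun r => q r - (5 * La + M r))}.
    apply: has_der_cont; have h1 := hq T ltac:(slra); have h2 := pM_der R P T ltac:(slra).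
    by der; reflexivity.
  rewrite leNgt; apply/negP => neg.
  have [|d d0 hd] := continuous_gt0 _ _ c; first slra.
  have [x [/andP[x0 xd] /andP[_ xT]]] := small_between _ _ d0 (ltac:(slra) : 0 < T).
  have := hd (T - x); rewrite ltr0_norm; last by slra.
  by move=> /(_ ltac:(slra)); have [_ i1] := inner (T - x) ltac:(slra); clear -D i1; lra.
Qed.

(** As long as |q| <= La, the forcing 6 La^2 exceeds q^2 + (n / r) q + La, each term being at most
    La^2; so q + M rises at least at the rate La, and u'/u is of order La after half a unit. *)
Lemma riccati_ramp c1 : 0 < c1 -> c1 + 1 <= T -> n%:R / c1 + 1 <= La ->
  forall r, c1 <= r <= c1 + 1 -> La * (r - c1) <= q r + M r.
Proof.
move=> c10 cT Lac r rc.
have T0' := small_itv D; have La1' := small_La D; have hq := small_hq.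
have S0 : 0 < S by slra.
have MS : 0 <= M S by exact: M_pos.
have La0 : 1 <= La by slra.
suff : 0 <= q r + M r - La * (r - c1) by slra.
apply: (barrier_cc (fun r => q r + M r - La * (r - c1))
  (fun r => (- q r ^+ 2 - n%:R / r * q r + Q r + K r * (L - 2 * g r)) + m r - La) c1 (c1 + 1)) => //.
- by have [_ ? _] := riccati_bounds c1 ltac:(slra); slra.
- move=> x xc; have h1 := hq x ltac:(slra); have h2 := pM_der R P x ltac:(slra).
  by der; ring.
- move=> x xc xneg; have [gx q1 _] := riccati_bounds x ltac:(slra).
  have /andP[gn _] := small_gain (K x) L (g x) La (pK_itv R P x ltac:(slra)) erefl gx.
  have := M_le P x S ltac:(slra) ltac:(slra); have Mx := M_pos P x ltac:(slra) => MxS.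
  have := pQ_le R P x ltac:(slra); rewrite ler_norml => /andP[Q1 _].
  have lx : La * (x - c1) <= La by rewrite ler_piMr//; slra.
  have q2 : - La <= q x <= La by clear -D q1 MxS La1' xneg lx Mx; lra.
  have q3 : q x ^+ 2 <= La ^+ 2 by clear -D q2; nra.
  have nc : n%:R / x <= n%:R / c1 by rewrite ler_wpM2l// lef_pV2 ?posrE//; slra.
  have nx : 0 <= n%:R / x by apply: divr_ge0 => //; slra.
  have q4 : n%:R / x * q x <= La * La.
    have q5' : n%:R / x <= La by apply: le_trans nc _; clear -D Lac; lra.
    have La0' : 0 <= La by apply: le_trans La0.
    by apply: (@le_trans _ _ (n%:R / x * La)); rewrite ?ler_wpM2l ?ler_wpM2r//; case/andP: q2.
  have q5 : La <= La * La by rewrite ler_peMr// (le_trans _ La0).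
  have := expr2 La; clear -D gn Q1 q3 q4 q5 La0; lra.
Qed.
End Riccati.

(** The function (F + c0 / lam) exp (lam (r - c)) is nonincreasing: F can stay nonnegative only if
    it starts exponentially large in lam. *)
Lemma forced_decay (F F' : R -> R) c s lam c0 : 0 < lam -> 0 < c0 -> 0 <= s ->
  (forall r, c <= r <= c + s -> has_der F r (F' r)) ->
  (forall r, c <= r <= c + s -> F' r <= - c0 - lam * F r) -> 0 <= F (c + s) ->
  c0 / lam * expR (lam * s) <= F c + c0 / lam.
Proof.
move=> lam0 c00 s0 hF hF' Fs.
pose f r := - ((F r + c0 / lam) * expR (lam * (r - c))).
have cs : c <= c + s by slra.
have fm : f c <= f (c + s).
  apply: (der_ge0_le f (fun r => - ((F' r + lam * F r + c0) * expR (lam * (r - c)))) _ _ cs).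
  - move=> r rS; have h := hF r rS; rewrite /f; der; field.
    by rewrite gt_eqF.
  - move=> r rS; rewrite -mulNr mulr_ge0 ?expR_ge0//.
    by have := hF' r ltac:(slra); slra.
have e1 : c + s - c = s by ring.
move: fm; rewrite /f lerN2 e1 subrr mulr0 expR0 mulr1; apply: le_trans.
by rewrite ler_wpM2r ?expR_ge0//; slra.
Qed.

(** The exponential is bounded below by (La / 32)^4, which leaves La^3 against the quadratic bound
    on [Fc]; the constant is 64^3 = 32^4 / 4. W is a variable so that the arithmetic does not expand
    it. *)
Lemma forced_decay_absurd (La c0 Fc W : R) : 1 <= La -> 0 < c0 -> 0 < W -> W = 64 ^+ 3 ->
  W * (54 + 4 * c0) < La * c0 -> Fc <= 50 * La ^+ 2 ->
  c0 / (La / 4) * expR (La / 4 * (1 / 2)) <= Fc + c0 / (La / 4) -> False.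
Proof.
move=> La0 c00 W0 WE L6 Fc2 h.
have La2 : 1 <= La ^+ 2 by nra.
have e1 : (La / 32) ^+ 4 <= expR (La / 4 * (1 / 2)).
  have -> : La / 4 * (1 / 2) = 4 * (La / 32) by field.
  rewrite expRM_natl lerXn2r ?nnegrE ?expR_ge0//; first by clear -La0; lra.
  by have := expR_ge1Dx (La / 32); slra.
have lc : c0 / (La / 4) = 4 * c0 / La by field; rewrite gt_eqF//; slra.
have lcL : c0 / (La / 4) <= 4 * c0 by rewrite lc ler_pdivrMr; [rewrite ler_peMr; slra|slra].
have l0 : 0 <= c0 / (La / 4) by apply: divr_ge0; slra.
have : c0 / (La / 4) * (La / 32) ^+ 4 <= Fc + c0 / (La / 4).
  by apply: le_trans h; rewrite ler_wpM2l.
have -> : c0 / (La / 4) * (La / 32) ^+ 4 = c0 * La ^+ 3 / W.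
  by rewrite lc WE; field; rewrite gt_eqF//; slra.
have hW : W * (54 + 4 * c0) * La ^+ 2 < La * c0 * La ^+ 2 by rewrite ltr_pM2r//; slra.
have iW : 0 < W^-1 by rewrite invr_gt0.
have := hW; rewrite -(ltr_pM2r iW).
have -> : W * (54 + 4 * c0) * La ^+ 2 / W = (54 + 4 * c0) * La ^+ 2.
  by field; rewrite gt_eqF.
have -> : La * c0 * La ^+ 2 / W = c0 * La ^+ 3 / W by rewrite !exprS; ring.
have : c0 <= c0 * La ^+ 2 by rewrite ler_peMr//; slra.
slra.
Qed.

Lemma slope_sqr (La sk p q nr kp a nb km : R) : 1 <= sk -> sk * p = q + nr + kp / 2 ->
  q <= 5 * La + a -> nr <= nb -> kp <= km -> forall MS, a <= MS -> 8 * MS <= La ->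
  nb + 1 <= La -> 4 * km <= La -> La / 8 <= sk * p -> 1 <= La -> p ^+ 2 <= 49 * La ^+ 2.
Proof.
move=> sk1 e h1 h2 h3 MS h4 h5 h6 h7 h8 La0.
have p0 : 0 <= p.
  have sk0 := lt_le_trans ltr01 sk1; have : 0 <= sk * p by slra.
  by rewrite pmulr_rge0.
have : p <= sk * p by rewrite ler_peMl.
move=> pl; have p7 : p <= 7 * La by slra.
have -> : 49 * La ^+ 2 = (7 * La) ^+ 2 by ring.
by apply: sqr_le_sqr.
Qed.

(** With F = E exp (- 2 t) one has F' = - H' - 2 (k p) F. On [rb + 1/2, rb + 1] the ramp gives k p
    >= La / 8, and H' >= c0, while F is at most 50 La^2 at the left end: the damping at rate La / 4
    drives F below 0 before rb + 1. *)
Lemma psol_small : exists al, [/\ 0 < al & exists T u u1,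
  [/\ psol T al u u1, rb <= T & energy H (slog P u) (sslope P u u1) T < 0]].
Proof.
have rb0 := prb_gt0 R P.
pose S := rb + 1; have S0 : 0 < S by rewrite /S; slra.
have MS : 0 <= M S by exact: M_pos.
have [c0 c00 hc0] : exists2 c0, 0 < c0 & forall r, rb <= r <= S -> c0 <= H' r.
  apply: continuous_lower_bound => r ?; first by apply: pH'_cont; slra.
  by apply: pH'_gt0; slra.
have [km km0 hkm] : exists2 C, 0 < C & forall r, rb <= r <= S -> `|kap r| <= C.
  apply: continuous_bounded => r ?; apply: has_der_cont (pkap_der R P r _); slra.
pose c2 := rb + 1 / 2.
pose C0 := `|n%:R * ln c2| + `|ln (K c2)| + `|H c2|.
have C00 : 0 <= C0 by rewrite /C0 !addr_ge0.
have n0 : 0 <= n%:R / rb by apply: divr_ge0 => //; slra.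
have [W [W0 WE]] : exists W : R, 0 < W /\ W = 64 ^+ 3 by exists (64 ^+ 3); rewrite exprn_gt0.
(* A sum of nonnegative terms, one for each lower bound required of [La]; the last one lets the
   exponential win. The value is forgotten once these bounds are extracted. *)
pose La : R := M S + 1 + (6 * S + 1) + (n%:R / rb + 1) + 4 * km + C0 + 8 * M S + W * (54 + 4 * c0) / c0.
have big : 0 <= W * (54 + 4 * c0) / c0 by apply: divr_ge0; rewrite ?mulr_ge0//; slra.
have La_ge : [/\ M S + 1 <= La, 6 * S + 1 <= La, n%:R / rb + 1 <= La, 4 * km <= La & C0 <= La].
  by clear -big MS S0 n0 km0 C00; rewrite /La; split; lra.
have [L1 L2 L3 L4 L5] := La_ge.
have L7 : 8 * M S <= La by clear -big MS S0 n0 km0 C00; rewrite /La; lra.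
have L6 : W * (54 + 4 * c0) < La * c0.
  have -> : La * c0 = (La - W * (54 + 4 * c0) / c0) * c0 + W * (54 + 4 * c0).
    by rewrite mulrBl divfK ?subrK// gt_eqF.
  rewrite ltrDr mulr_gt0// /La; clear -MS S0 n0 km0 C00; lra.
have LaS : (5 * La + M S) * S < La ^+ 2.
  by apply: small_scale => //; clear -L1 MS; lra.
move: (La) L1 L2 L3 L4 L5 L6 L7 LaS {La_ge} => {}La L1 L2 L3 L4 L5 L6 L7 LaS.
pose L := 8 * La ^+ 2; pose l := - L / 2.
have La0 : 1 <= La by slra.
have La2 : 1 <= La ^+ 2 by nra.
exists (expR l); split; first exact: expR_gt0.
have [u [u1 us]] : exists u u1, psol S (expR l) u u1.
  apply: psol_reach => //; first exact: expR_gt0.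
  move=> T TS; exists (5 * La ^+ 2); first by clear -La2; lra.
  move=> T' u u1 T'T us r rT'.
  have [gb _ _] := riccati_bounds La T' S u u1 (SmallFlow La T' S u u1 ltac:(slra) L1 LaS us) r rT'.
  have [hs _ _] := us; have [_ _ ur] := hs r rT'.
  rewrite -[u r]lnK ?posrE// !ler_expR; move: gb; rewrite -/L -/l /l /L; clear; lra.
have [[T [T1 ET]]|nE] := pselect (exists T, c2 <= T <= S /\ energy H (slog P u) (sslope P u u1) T < 0).
  exists T, u, u1; split => //; last by move: T1; rewrite /c2; slra.
  by apply: psol_sub us; slra.
exists S, u, u1; split => //; first by rewrite /S; slra.
have Epos r : c2 <= r <= S -> 0 <= energy H (slog P u) (sslope P u u1) r.
  by move=> rS; rewrite leNgt; apply/negP => Er; apply: nE; exists r.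
set t := slog P u in Epos *; set p := sslope P u u1 in Epos *.
pose F r := p r ^+ 2 + 2 * t r - H r - 1.
have Fpos r : c2 <= r <= S -> 0 <= F r.
  by move=> /Epos; rewrite /energy pmulr_rge0 ?expR_gt0.
have c2rb : rb <= c2 by rewrite /c2; slra.
have fl := psol_flow P S _ u u1 rb rb0 us.
have hF r : c2 <= r <= S -> has_der F r (- H' r - 2 * (Num.sqrt (K r) * p r) * F r).
  move=> rS; have [h1 h2] := fl r ltac:(slra); have h3 := pH_der R P r ltac:(slra).
  by rewrite /F; der; rewrite /= -/t -/p; ring.
have slope_eq r : rb <= r <= S -> Num.sqrt (K r) * p r = u1 r / u r + n%:R / (2 * r) + kap r / 2.
  move=> rS; rewrite /p /sslope mulrC divfK// gt_eqF// sqrtr_gt0.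
  by apply: K_gt0; slra.
have TS : 0 < S <= S by slra.
have sf := SmallFlow La S S u u1 TS L1 LaS us.
have ramp := riccati_ramp La S S u u1 sf rb rb0 (lexx _) L3.
have bounds := riccati_bounds La S S u u1 sf.
have kpbig r : c2 <= r <= S -> La / 8 <= Num.sqrt (K r) * p r.
  move=> rS; rewrite slope_eq; last by slra.
  have := ramp r ltac:(move: rS; rewrite /c2 /S; slra).
  have := M_le P r S ltac:(slra) ltac:(slra).
  have := hkm r ltac:(slra); rewrite ler_norml => /andP[kl _].
  have nr : 0 <= n%:R / (2 * r) by apply: divr_ge0 => //; slra.
  have : La / 2 <= La * (r - rb) by rewrite ler_wpM2l ?(le_trans _ La0)//; move: rS; rewrite /c2; clear; lra.
  clear -kl nr L4 L7 MS La0; lra.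
have c2S : c2 + 1 / 2 = S by rewrite /c2 /S; slra.
have lam0 : 0 < La / 4 by clear -La0; lra.
have c2S0 : c2 <= S by rewrite /c2 /S; slra.
have rb2c : rb <= 2 * c2 by rewrite /c2; slra.
have half0 : 0 <= 1 / 2 :> R by exact: divr_ge0.
have fd : 0 <= F S -> c0 / (La / 4) * expR (La / 4 * (1 / 2)) <= F c2 + c0 / (La / 4).
  rewrite -c2S => FS; apply: (forced_decay F _ c2 (1 / 2) (La / 4) c0 lam0 c00 half0 _ _ FS).
  - by move=> r rS; apply: hF; rewrite c2S in rS.
  - rewrite c2S => r rS.
    have := hc0 r ltac:(slra); have := Fpos r rS; have := kpbig r rS => k1 F0 h1.
    have k2 : La / 4 <= 2 * (Num.sqrt (K r) * p r) by clear -k1; lra.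
    have := ler_wpM2r F0 k2; clear -h1; lra.
have ES : energy H t p S < 0; last by [].
rewrite /energy pmulr_rlt0 ?expR_gt0// -/(F S) ltNge; apply/negP => FS.
have Fc2 : F c2 <= 50 * La ^+ 2.
  have c20 : 0 < c2 by slra.
  have c2S'' : c2 <= c2 <= S by rewrite lexx c2S0.
  have c2S' : rb <= c2 <= S by rewrite c2rb c2S0.
  have [gb _ q2] : [/\ - La ^+ 2 <= ln (u c2) - - L / 2 <= La ^+ 2, - M c2 <= u1 c2 / u c2 &
    u1 c2 / u c2 <= 5 * La + M c2] by apply: bounds; rewrite c20 c2S0.
  have sk1 : 1 <= Num.sqrt (K c2) by case/andP: (sqrtK_itv P c2 c20).
  have p2 : p c2 ^+ 2 <= 49 * La ^+ 2.
    have e := slope_eq c2 c2S'; have kp := kpbig c2 c2S''.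
    have := hkm c2 c2S'; rewrite ler_norml => /andP[_ kl].
    have nr : n%:R / (2 * c2) <= n%:R / rb.
      by rewrite ler_wpM2l// lef_pV2 ?posrE ?mulr_gt0// rb2c.
    have MM := M_le P c2 S c20 c2S0.
    exact: (slope_sqr _ _ _ _ _ _ _ _ _ sk1 e q2 nr kl _ MM L7 L3 L4 kp La0).
  have t2 : 2 * t c2 <= C0 - `|H c2|.
    rewrite /t /slog /C0.
    have := ler_norm (n%:R * ln c2); have := ler_norm (ln (K c2)); have := normr_ge0 (ln (K c2)).
    move: gb La2; rewrite /L; clear; lra.
  have := ler_norm (- H c2); rewrite normrN => Hn.
  have LL : La <= La ^+ 2 by rewrite expr2 ler_peMr// (le_trans _ La0).
  by move: p2 t2 Hn LL L5; rewrite /F; clear; lra.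
exact: (forced_decay_absurd La c0 (F c2) W La0 c00 W0 WE L6 Fc2 (fd FS)).
Qed.
End SmallData.

(** * Shooting *)

Section OpenSets.
Context {R : realType}.

Definition open_cond (A : R -> Prop) := forall x : R, 0 < x -> A x ->
  exists2 d, 0 < d & forall y, `|y - x| < d -> A y.

Lemma open_conds_miss_lt (A B : R -> Prop) (a b : R) : open_cond A -> open_cond B ->
  (forall x, A x -> B x -> False) -> 0 < a -> a < b -> A a -> B b ->
  exists2 x, 0 < x & ~ A x /\ ~ B x.
Proof.
move=> oA oB dAB a0 ab Aa Bb.
pose E := [set x | a <= x <= b /\ forall y, a <= y <= x -> A y].
have Ea : E a.
  by split; [rewrite lexx ltW|move=> y /andP[? ?]; suff -> : y = a by []; slra].
have hs : has_sup E by split; [exists a|exists b => x [/andP[]]].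
pose s := sup E.
have as_ : a <= s by apply: ub_le_sup => //; case: hs.
have sb : s <= b by apply: ge_sup; [exists a|move=> x [/andP[]]].
have below y : a <= y < s -> A y.
  move=> /andP[ay ys]; have [x [_ Ex] yx] := sup_adherent (ltac:(slra) : 0 < s - y) hs.
  by apply: Ex; rewrite ay /=; rewrite -/s in yx; slra.
have s0 : 0 < s by slra.
exists s => //; split => [As|Bs].
  have [d d0 hd] := oA s s0 As.
  case: (ltP s b) => sb'; last first.
    by have e : s = b by [slra]; rewrite e in As; exact: (dAB b).
  have [x [/andP[x0 xd] /andP[_ xb]]] := small_between _ _ d0 (ltac:(slra) : 0 < b - s).
  have : s + x <= s.
    apply: ub_le_sup; first by case: hs.
    split; first by slra.
    move=> y /andP[ay ysx]; case: (ltP y s) => ys; first by apply: below; rewrite ay.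
    by apply: hd; rewrite ger0_norm ?subr_ge0//; slra.
  by slra.
have [d d0 hd] := oB s s0 Bs.
move: as_; rewrite le_eqVlt => /orP[/eqP e|as_]; first by rewrite e in Aa; exact: (dAB s).
have [x [/andP[x0 xd] /andP[_ xs]]] := small_between _ _ d0 (ltac:(slra) : 0 < s - a).
apply: (dAB (s - x)); first by apply: below; slra.
by apply: hd; rewrite ltr0_norm; slra.
Qed.

Lemma open_conds_miss_le (A B : R -> Prop) (a b : R) : open_cond A -> open_cond B ->
  (forall x, A x -> B x -> False) -> 0 < a -> 0 < b -> A a -> B b ->
  exists2 x, 0 < x & ~ A x /\ ~ B x.
Proof.
move=> oA oB dAB a0 b0 Aa Bb; case: (ltgtP a b) => ab.
- exact: (open_conds_miss_lt A B a b).
- have [|x x0 [h1 h2]] := open_conds_miss_lt B A b a oB oA _ b0 ab Bb Aa.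
    by move=> x Bx Ax; exact: (dAB x).
  by exists x.
- by exfalso; apply: (dAB a) => //; rewrite ab.
Qed.

Lemma continuous2_gt0 (f : R * R -> R) (x y : R) : f z @[z --> (x, y)] --> f (x, y) ->
  0 < f (x, y) -> exists2 e, 0 < e & forall x' y', `|x' - x| < e -> `|y' - y| < e -> 0 < f (x', y').
Proof.
move=> /cvgrPdist_lt h f0; have := h _ f0.
move=> /nbhs_ballP[e /= e0 he]; exists e => // x' y' hx hy.
have := he (x', y'); rewrite /ball /= /prod_ball /= /ball /=.
move=> /(_ (conj _ _)); rewrite !(distrC _ x') !(distrC _ y') => /(_ hx hy).
by rewrite ltr_distlC => /andP[]; slra.
Qed.

Lemma slope_cvg (k1 k2 x y : R) : 0 < x ->
  (z.2 / z.1 + k1) / k2 @[z --> (x, y)] --> (y / x + k1) / k2.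
Proof.
move=> x0; apply: cvgM; last exact: cvg_cst.
apply: cvgD; last exact: cvg_cst.
apply: cvgM; first exact: cvg_snd.
by apply: cvgV; [exact: lt0r_neq0|exact: cvg_fst].
Qed.

Lemma slope_energy_cvg (k1 k2 k3 x y : R) : 0 < x ->
  ((z.2 / z.1 + k1) / k2) ^+ 2 + 2 * (ln z.1 + k3) @[z --> (x, y)] -->
  ((y / x + k1) / k2) ^+ 2 + 2 * (ln x + k3).
Proof.
move=> x0; apply: cvgD.
  by rewrite expr2; under eq_fun do rewrite expr2; apply: cvgM; exact: slope_cvg.
apply: cvgM; first exact: cvg_cst.
apply: cvgD; last exact: cvg_cst.
apply: (@cvg_comp _ _ _ (fun z : R * R => z.1) (@ln R)); first exact: cvg_fst.
exact: continuous_ln.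
Qed.
End OpenSets.

Section Shooting.
Context {R : realType} (P : problem R).
Local Notation n := (pn R P).
Local Notation Q := (pQ R P).
Local Notation K := (pK R P).
Local Notation kap := (pkap R P).
Local Notation H := (pH R P).
Local Notation H' := (pH' R P).
Local Notation rb := (prb R P).
Local Notation psol := (psol P).
Local Notation th := (slog P).
Local Notation sl := (sslope P).

(* [crossing al]: u must vanish; [trapped al]: the energy becomes negative where
   it is nonincreasing. *)
Definition crossing (al : R) := exists r u u1 h,
  [/\ 0 < r, psol r al u u1, forall s, r <= s <= r + 3 -> H s <= h, sl u u1 r < 0 &
      h + 2 < sl u u1 r ^+ 2 + 2 * th u r].

Definition trapped (al : R) := exists T u u1,
  [/\ psol T al u u1, rb <= T & sl u u1 T ^+ 2 + 2 * th u T - H T - 1 < 0].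

(** At fixed r and h the conditions are strict and continuous in the pair (u r, u1 r), which
    [psol_stable] controls. *)
Lemma crossing_open : open_cond crossing.
Proof.
move=> al al0 [r [u [u1 [h [r0 us hh s0 S0]]]]].
have ur : 0 < u r by have [hs _ _] := us; have [] := hs r ltac:(slra).
pose k1 := n%:R / (2 * r) + kap r / 2; pose k2 := Num.sqrt (K r).
pose k3 := n%:R / 2 * ln r + ln (K r) / 4.
have slE v v1 : sl v v1 r = (v1 r / v r + k1) / k2 by rewrite /sslope /k1 /k2 !addrA.
have thE v : th v r = ln (v r) + k3 by rewrite /slog /k3 !addrA.
rewrite slE thE in S0; rewrite slE in s0.
have [||e1 e10 he1] := @continuous2_gt0 R (fun z => - ((z.2 / z.1 + k1) / k2)) (u r) (u1 r).
- by apply: cvgN; exact: slope_cvg.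
- by rewrite /= oppr_gt0.
have [||e2 e20 he2] := @continuous2_gt0 R
  (fun z => ((z.2 / z.1 + k1) / k2) ^+ 2 + 2 * (ln z.1 + k3) - (h + 2)) (u r) (u1 r).
- by apply: cvgB; [exact: slope_energy_cvg|exact: cvg_cst].
- by rewrite /= subr_gt0.
have e0 : 0 < Num.min e1 e2 by rewrite lt_min e10.
have [d d0 hd] := psol_stable P r al u u1 _ al0 r0 e0 us.
exists d => // be /hd[v [v1 [vs]]]; rewrite !lt_min => /andP[a1 a2] /andP[b1 b2].
exists r, v, v1, h; split => //.
  by rewrite slE; have /= := he1 _ _ a1 b1; rewrite oppr_gt0.
by rewrite slE thE; have /= := he2 _ _ a2 b2; rewrite subr_gt0.
Qed.

Lemma trapped_open : open_cond trapped.
Proof.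
move=> al al0 [r [u [u1 [us rbr S0]]]].
have rb0 := prb_gt0 R P; have r0 : 0 < r by slra.
have ur : 0 < u r by have [hs _ _] := us; have [] := hs r ltac:(slra).
pose k1 := n%:R / (2 * r) + kap r / 2; pose k2 := Num.sqrt (K r).
pose k3 := n%:R / 2 * ln r + ln (K r) / 4.
have slE v v1 : sl v v1 r = (v1 r / v r + k1) / k2 by rewrite /sslope /k1 /k2 !addrA.
have thE v : th v r = ln (v r) + k3 by rewrite /slog /k3 !addrA.
rewrite slE thE in S0.
have [||e2 e20 he2] := @continuous2_gt0 R
  (fun z => (H r + 1) - (((z.2 / z.1 + k1) / k2) ^+ 2 + 2 * (ln z.1 + k3))) (u r) (u1 r).
- by apply: cvgB; [exact: cvg_cst|exact: slope_energy_cvg].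
- by rewrite /=; slra.
have [d d0 hd] := psol_stable P r al u u1 _ al0 r0 e20 us.
exists d => // be /hd[v [v1 [vs a2 b2]]].
exists r, v, v1; split => //.
by rewrite slE thE; have /= := he2 _ _ a2 b2; slra.
Qed.

Lemma energy_sign (u u1 : R -> R) r :
  (energy H (th u) (sl u u1) r < 0) = (sl u u1 r ^+ 2 + 2 * th u r - H r - 1 < 0).
Proof. by rewrite /energy pmulr_rlt0 ?expR_gt0. Qed.

Lemma energy_nonincreasing T al u u1 r s : psol T al u u1 -> rb <= r -> r <= s -> s <= T ->
  energy H (th u) (sl u u1) s <= energy H (th u) (sl u u1) r.
Proof.
move=> us rbr rs sT; have rb0 := prb_gt0 R P.
have fl := psol_flow P T al u u1 rb rb0 us.
pose f r := - energy H (th u) (sl u u1) r.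
have : f r <= f s; last by rewrite /f lerN2.
apply: (der_ge0_le f (fun r => - (- H' r * expR (2 * th u r))) _ _ rs).
- move=> x xs; apply: has_derN; apply: (energy_der rb T (fun r => Num.sqrt (K r))) => //.
    by move=> y ?; apply: pH_der; slra.
  by slra.
- move=> x xs; rewrite mulNr opprK mulr_ge0 ?expR_ge0//.
  by apply: ltW; apply: pH'_gt0; slra.
Qed.

Lemma crossing_trapped al : 0 < al -> crossing al -> trapped al -> False.
Proof.
move=> al0 [r [u [u1 [h [r0 us hh s0 S0]]]]] [T [v [v1 [vs rbT ET]]]].
have rb0 := prb_gt0 R P.
case: (leP T r) => Tr.
  have := energy_nonincreasing r al u u1 T r us rbT Tr (lexx r).
  have [e1 e2] := psol_unique P T al u u1 v v1 al0 (psol_sub P r T al u u1 Tr us) vs T ltac:(slra).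
  have ET' : energy H (th u) (sl u u1) T < 0 by rewrite energy_sign /sslope /slog e1 e2.
  move=> le; have := le_lt_trans le ET'; rewrite energy_sign => q.
  by have := hh r ltac:(slra); slra.
have fl := psol_flow P T al v v1 r r0 vs.
have [e1 e2] := psol_unique P r al u u1 v v1 al0 us (psol_sub P T r al v v1 (ltW Tr) vs) r ltac:(slra).
have s0' : sl v v1 r < 0 by move: s0; rewrite /sslope e1 e2.
have S0' : h + 2 < sl v v1 r ^+ 2 + 2 * th v r by move: S0; rewrite /sslope /slog e1 e2.
have k1 x : r <= x -> 1 <= Num.sqrt (K x).
  by move=> rx; have /andP[] := sqrtK_itv P x ltac:(slra).
case: (leP (r + 3) T) => rT.
  apply: (flow_cross r (fun r => Num.sqrt (K r)) H (th v) (sl v v1) h) => //.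
  - by apply: flow_sub fl.
  - by move=> x ?; apply: k1; slra.
have [||||p1 p2] := flow_negative r T (fun r => Num.sqrt (K r)) H (th v) (sl v v1) h fl _ _ s0' _ T.
- by move=> x ?; apply: k1; slra.
- by move=> x ?; apply: hh; slra.
- by slra.
- by slra.
have pos : 0 < slope (fun r => Num.sqrt (K r)) H (th v) (sl v v1) h T.
  by apply: lt_le_trans p2; rewrite /slope mulr_gt0 ?expR_gt0//; slra.
move: pos; rewrite /slope pmulr_rgt0 ?expR_gt0// => pos.
by have := hh T ltac:(slra); slra.
Qed.

(** The negation of [crossing] is the alternative required by [flow_bounded], whose bounds on t keep
    u in a compact part of ]0, +oo[. On ]0, c] a fixed short solution provides the bounds. *)
Lemma not_crossing_psol al S : 0 < al -> ~ crossing al -> 0 < S -> exists u u1, psol S al u u1.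
Proof.
move=> al0 ncr S0.
have [T0 T00 [u0 [u01 hu0]]] := psol_short P al al0.
have [b0 b00 hb0] := psol_bounds P T0 al u0 u01 al0 hu0.
apply: (psol_reach P S al al0 S0) => T /andP[Tp TS].
pose c := Num.min T0 (T / 2).
have c0 : 0 < c by rewrite lt_min T00; slra.
have cT0 : c <= T0 by rewrite ge_min lexx.
have cT : c < T.
  by apply: (@le_lt_trans _ _ (T / 2)); [rewrite ge_min lexx orbT|slra].
(* Up to T + 3, since a crossing at a radius x <= T needs a bound of H on [x, x + 3]. *)
have [C C0 hC] : exists2 C, 0 < C & forall r, c <= r <= T + 3 -> `|H r| <= C.
  by apply: continuous_bounded => r ?; apply: has_der_cont (pH_der R P r _); slra.
have [Cl Cl0 hCl] : exists2 C, 0 < C & forall r, c <= r <= T -> `|n%:R / 2 * ln r + ln (K r) / 4| <= C.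
  apply: continuous_bounded => r rr; have r0 : 0 < r by slra.
  have h1 := pK_der R P r r0; have h2 := K_gt0 P r r0.
  apply: (has_der_cont (fun r => n%:R / 2 * ln r + ln (K r) / 4)).
  by der => //; reflexivity.
pose S1 := Num.max (sl u0 u01 c ^+ 2 + 2 * th u0 c) (C + 2).
have S1a : sl u0 u01 c ^+ 2 + 2 * th u0 c <= S1 by rewrite le_max lexx.
have S1b : C + 2 <= S1 by rewrite le_max lexx orbT.
pose D := (S1 + 1 - 2 * th u0 c) * expR (4 * T).
have Z0 : 0 <= S1 + 1 - 2 * th u0 c by have := sqr_ge0 (sl u0 u01 c); slra.
have D0 : 0 <= D by rewrite mulr_ge0 ?expR_ge0.
exists (b0 + S1 + D + Cl); first slra.
move=> T' u u1 /andP[T'0 T'T] us r /andP[r0 rT'].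
have lnb : `|ln (u r)| <= b0 + S1 + D + Cl -> expR (- (b0 + S1 + D + Cl)) <= u r <= expR (b0 + S1 + D + Cl).
  have [hs _ _] := us; have [_ _ ur] := hs r ltac:(slra).
  by rewrite -{2 3}[u r]lnK ?posrE// !ler_expR ler_norml.
case: (leP r c) => rc.
  have [er _] := psol_unique P r al u u1 u0 u01 al0 (psol_sub P T' r al u u1 rT' us)
    (psol_sub P T0 r al u0 u01 (ltac:(slra)) hu0) r ltac:(slra).
  have /andP[h1 h2] := hb0 r ltac:(slra).
  rewrite er; apply/andP; split.
    by apply: le_trans h1; rewrite ler_expR; slra.
  by apply: le_trans h2 _; rewrite ler_expR; slra.
apply: lnb.
have usr := psol_sub P T' r al u u1 rT' us.
have fl := psol_flow P r al u u1 c c0 usr.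
have [e1 e2] := psol_unique P c al u u1 u0 u01 al0 (psol_sub P r c al u u1 (ltW rc) usr)
  (psol_sub P T0 c al u0 u01 cT0 hu0) c ltac:(slra).
have [||||||b1 b2] := flow_bounded c r (fun r => Num.sqrt (K r)) H (th u) (sl u u1) C S1 fl _ _ _ _ _ r.
- by move=> x xr; apply: sqrtK_itv; slra.
- by move=> x xr; have := hC x ltac:(slra); rewrite ler_norml => /andP[].
- move=> x xr; case: (leP 0 (sl u u1 x)) => sx; first by left.
  right; rewrite leNgt; apply/negP => q; apply: ncr.
  exists x, u, u1, C; split => //; first slra.
  + by apply: psol_sub usr; slra.
  + by move=> s ?; have := hC s ltac:(slra); rewrite ler_norml => /andP[].
- by rewrite /sslope /slog e1 e2.
- by [].
- by slra.
have e3 : th u c = th u0 c by rewrite /slog e1.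
rewrite e3 in b2.
have : (S1 + 1 - 2 * th u0 c) * expR (4 * (r - c)) <= D.
  by rewrite /D ler_wpM2l// ler_expR; slra.
have := hCl r ltac:(slra); rewrite !ler_norml => /andP[c1 c2] bD.
have e4 : ln (u r) = th u r - (n%:R / 2 * ln r + ln (K r) / 4) by rewrite /slog; ring.
by rewrite e4; clear -b1 b2 c1 c2 bD b00 S1a S1b C0 D0 Cl0 Z0; apply/andP; split; lra.
Qed.

(** The value at r is read from the solution chosen for the radius r + 1; near r all these agree
    with the one for r + 2, which gives the derivatives. *)
Lemma psol_glue al : 0 < al -> (forall T, 0 < T -> exists u u1, psol T al u u1) ->
  exists u u1, forall T, psol T al u u1.
Proof.
move=> al0 hT.
have /choice[w hw] : forall T : R, exists p : (R -> R) * (R -> R), 0 < T -> psol T al p.1 p.2.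
  move=> T; case: (ltP 0 T) => T0; last by exists (cst 0, cst 0).
  by have [u [u1 h]] := hT T T0; exists (u, u1).
have agree T r : 0 < r -> r <= T -> r + 1 <= T -> (w (r + 1)).1 r = (w T).1 r /\ (w (r + 1)).2 r = (w T).2 r.
  move=> r0 rT rT1; apply: (psol_unique P (r + 1) al _ _ _ _ al0); last by slra.
    by apply: hw; slra.
  by apply: psol_sub (hw T _) => //; slra.
exists (fun r => (w (r + 1)).1 r), (fun r => (w (r + 1)).2 r) => T; split.
- move=> r /andP[r0 _].
  have nr : \forall y \near r, 0 < y /\ y + 1 <= r + 2.
    apply/nbhs_ballP; exists (Num.min r 1) => /=; first by rewrite lt_min r0 ltr01.
    move=> y; rewrite /ball /= lt_min !ltr_distl => /andP[/andP[? ?] /andP[? ?]].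
    by split; slra.
  have [hs _ _] := hw (r + 2) ltac:(slra); have [h1 h2 h3] := hs r ltac:(slra).
  have [-> ->] := agree (r + 2) r r0 ltac:(slra) ltac:(slra).
  split => //.
    apply: has_der_near h1 _; near=> y.
    have [y0 y1] : 0 < y /\ y + 1 <= r + 2 by near: y.
    by have [-> _] := agree (r + 2) y y0 ltac:(slra) y1.
  apply: has_der_near h2 _; near=> y.
  have [y0 y1] : 0 < y /\ y + 1 <= r + 2 by near: y.
  by have [_ ->] := agree (r + 2) y y0 ltac:(slra) y1.
- have [_ h _] := hw 2 ltac:(slra); apply: (lim0_ext (w 2).1 _ _ 1) => //.
  by move=> x ?; have [-> _] := agree 2 x ltac:(slra) ltac:(slra) ltac:(slra).
- have [_ _ h] := hw 2 ltac:(slra); apply: (lim0_ext (fun r => r ^+ n * (w 2).2 r) _ _ 1) => //.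
  by move=> x ?; have [_ ->] := agree 2 x ltac:(slra) ltac:(slra) ltac:(slra).
Unshelve. all: by end_near. Qed.

Theorem decaying_solution_exists : exists al u u1,
  [/\ 0 < al, forall T, psol T al u u1 & u r @[r --> +oo] --> 0].
Proof.
have [a1 a10 ha1] := psol_large P.
have [a2 [a20 [T [w [w1 [ws rbT ET]]]]]] := psol_small P.
have cr1 : crossing a1.
  apply: contrapT => ncr; have [u [u1 us]] := not_crossing_psol a1 1 a10 ncr ltr01.
  exact: ha1 us.
have tr2 : trapped a2 by exists T, w, w1; split => //; rewrite -energy_sign.
(* Positivity is built into both conditions, because the disjointness required below holds for
   positive initial values. *)
have [al al0 [ncr ntr]] : exists2 x, 0 < x & ~ (0 < x /\ crossing x) /\ ~ (0 < x /\ trapped x).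
  apply: (open_conds_miss_le (fun x => 0 < x /\ crossing x) (fun x => 0 < x /\ trapped x) a1 a2) => //.
  - move=> x x0 [_ cx]; have [d d0 hd] := crossing_open x x0 cx.
    exists (Num.min d x); first by rewrite lt_min d0.
    move=> y; rewrite lt_min => /andP[yd]; rewrite ltr_distl => /andP[? ?].
    by split; [slra|exact: hd].
  - move=> x x0 [_ cx]; have [d d0 hd] := trapped_open x x0 cx.
    exists (Num.min d x); first by rewrite lt_min d0.
    move=> y; rewrite lt_min => /andP[yd]; rewrite ltr_distl => /andP[? ?].
    by split; [slra|exact: hd].
  - by move=> x [x0 c] [_ t]; exact: (crossing_trapped x).
have {}ncr : ~ crossing al by move=> c; apply: ncr.
have {}ntr : ~ trapped al by move=> c; apply: ntr.
have [u [u1 us]] := psol_glue al al0 (fun T T0 => not_crossing_psol al T al0 ncr T0).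
exists al, u, u1; split => //.
have rb0 := prb_gt0 R P.
have Fpos r : rb <= r -> 0 <= sl u u1 r ^+ 2 + 2 * th u r - H r - 1.
  by move=> rr; rewrite leNgt; apply/negP => q; apply: ntr; exists r, u, u1.
have fl T' : flow rb T' (fun r => Num.sqrt (K r)) H (th u) (sl u u1).
  exact: psol_flow (us T').
(* Not being trapped means H - 2 t - p^2 <= -1, hence p' <= -1 and p is eventually negative. *)
have slm r s : rb <= r -> r <= s -> sl u u1 s - sl u u1 r <= - s - - r.
  move=> rr rs; apply: (der_le_le (sl u u1) (fun r => - r)
    (fun r => Num.sqrt (K r) * (H r - 2 * th u r - sl u u1 r ^+ 2)) (fun=> -1) _ _ rs).
  - by move=> x xs; apply: (fl s x _).2; slra.
  - by move=> x _; apply: has_derN; exact: has_der_id.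
  - move=> x xs; have := Fpos x ltac:(slra).
    have /andP[k1 _] := sqrtK_itv P x ltac:(slra); move: (Num.sqrt (K x)) k1 => k k1.
    move=> F0; have F1 : H x - 2 * th u x - sl u u1 x ^+ 2 <= -1 by slra.
    move: (H x - 2 * th u x - sl u u1 x ^+ 2) F1 => Z Z1; nra.
pose r1 := Num.max (pfar R P) (Num.max 1 (rb + `|sl u u1 rb| + 1)).
have r1a : pfar R P <= r1 by rewrite le_max lexx.
have r1c : 1 <= r1 by rewrite !le_max lexx !orbT.
have r1b : rb + `|sl u u1 rb| + 1 <= r1 by rewrite !le_max lexx !orbT.
have sneg r : r1 <= r -> sl u u1 r <= 0.
  move=> rr; have := ler_norm (sl u u1 rb); have := normr_ge0 (sl u u1 rb) => a b.
  by have := slm rb r (lexx _) ltac:(slra); slra.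
have thm r : r1 <= r -> th u r <= th u r1.
  move=> rr; pose f r := - th u r; suff : f r1 <= f r by rewrite /f lerN2.
  have := normr_ge0 (sl u u1 rb) => nb.
  apply: (der_ge0_le f (fun r => - (Num.sqrt (K r) * sl u u1 r)) _ _ rr).
  - by move=> x xr; apply: has_derN; apply: (fl r x _).1; slra.
  - move=> x xr; rewrite -mulrN; apply: mulr_ge0; first by rewrite sqrtr_ge0.
    by have := sneg x ltac:(slra); slra.
(* Once t is nonincreasing and K = 1, u is at most a constant times r^(-n/2), and n >= 1. *)
have ub r : r1 <= r -> 0 < u r <= expR (th u r1) / Num.sqrt r.
  move=> rr; have r0 : 0 < r by slra.
  have [hs _ _] := us r; have [_ _ ur] := hs r ltac:(slra); rewrite ur /=.
  have := thm r rr; rewrite {1}/slog; have [-> _] := pK_far R P r ltac:(slra).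
  rewrite ln1 mul0r addr0 => h.
  have lr : 0 <= ln r by rewrite ln_ge0//; slra.
  have n1 : 1 <= n%:R :> R by rewrite ler1n pn_gt0.
  have sr0 : 0 < Num.sqrt r by rewrite sqrtr_gt0.
  have l2 : ln r = 2 * ln (Num.sqrt r).
    by rewrite -{1}[r]sqr_sqrtr ?(ltW r0)// lnXn// mulr_natl.
  have : n%:R / 2 * ln r >= ln (Num.sqrt r) by rewrite l2 in lr *; nra.
  move=> h2; have h3 : ln (u r) <= th u r1 - ln (Num.sqrt r) by slra.
  by rewrite -[u r]lnK ?posrE// (le_trans (_ : _ <= expR (th u r1 - ln (Num.sqrt r))))
    ?ler_expR// expRD expRN lnK ?posrE.
apply/cvgrPdist_lt => e e0; exists (Num.max r1 ((expR (th u r1) / e) ^+ 2)); split; first exact: num_real.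
move=> r; rewrite gt_max => /andP[rr re].
rewrite sub0r normrN; have /andP[ur ur2] := ub r (ltW rr).
have r0 : 0 < r by slra.
have sr0 : 0 < Num.sqrt r by rewrite sqrtr_gt0.
rewrite gtr0_norm//; apply: le_lt_trans ur2 _.
rewrite ltr_pdivrMr// mulrC -ltr_pdivrMr//.
have ex := expR_gt0 (th u r1).
rewrite -(ltr_pXn2r (_ : (0 < 2)%N)) ?nnegrE ?sqrtr_ge0 ?divr_ge0 ?(ltW ex) ?(ltW e0)//.
by rewrite sqr_sqrtr// ltW.
Qed.
End Shooting.

(** * Uniqueness *)

Section Uniqueness.
Context {R : realType} (P : problem R).
Local Notation n := (pn R P).
Local Notation Q := (pQ R P).
Local Notation K := (pK R P).
Local Notation kap := (pkap R P).
Local Notation H := (pH R P).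
Local Notation H' := (pH' R P).
Local Notation rb := (prb R P).
Local Notation psol := (psol P).
Local Notation th := (slog P).
Local Notation sl := (sslope P).
Local Notation E u u1 := (energy H (th u) (sl u u1)).

Definition gsol al u u1 := (forall T, psol T al u u1) /\ u r @[r --> +oo] --> 0.

Lemma vanishing_log (u : R -> R) (C : R) : u r @[r --> +oo] --> 0 -> (forall r, 0 < r -> 0 < u r) ->
  exists2 X, 0 < X & forall r, X <= r -> C <= - ln (u r).
Proof.
move=> /cvgrPdist_lt /(_ _ (expR_gt0 (- C))) [X [_ hX]] up.
exists (Num.max X 0 + 1).
  have : 0 <= Num.max X 0 by rewrite le_max lexx orbT.
  slra.
move=> r rX; have X1 : X <= Num.max X 0 by rewrite le_max lexx.
have X2 : 0 <= Num.max X 0 by rewrite le_max lexx orbT.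
have r0 : 0 < r by slra.
have := hX r ltac:(slra); rewrite sub0r normrN gtr0_norm ?up// => h.
by rewrite lerNr -[leRHS]expRK ler_ln ?posrE ?expR_gt0 ?up// ltW.
Qed.

(** Supplies the hypotheses of the asymptotic analysis. As u tends to 0 and Q is bounded below, Q -
    2 ln u becomes large; the terms n ln r cancel in H - 2 t, and p = u'/u + n / (2 r) far out. *)
Lemma gsol_decay al u u1 : 0 < al -> gsol al u u1 -> exists R0,
  [/\ 0 < R0, rb <= R0, forall b, flow R0 b (fun=> 1) H (th u) (sl u u1),
      forall r, R0 <= r -> 2 <= H r - 2 * th u r & forall r, R0 <= r -> sl u u1 r <= 1 / 2].
Proof.
move=> al0 [us u0].
have up r : 0 < r -> 0 < u r.
  by move=> r0; have [hs _ _] := us r; have [] := hs r ltac:(slra).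
have [X X0 hX] := vanishing_log u ((3 + `|pbot R P|) / 2) u0 up.
have rb0 := prb_gt0 R P; have f0 := pfar_gt0 R P.
pose X1 := Num.max (Num.max (pfar R P) X) (Num.max rb (n%:R + 1)).
have X1a : pfar R P <= X1 by rewrite !le_max lexx.
have X1b : X <= X1 by rewrite !le_max lexx !orbT.
have X1c : rb <= X1 by rewrite !le_max lexx !orbT.
have X1d : n%:R + 1 <= X1 by rewrite !le_max lexx !orbT.
have gain r : X1 <= r -> 3 <= Q r - 2 * ln (u r).
  move=> rX; have := hX r ltac:(slra); have := pQ_far R P r ltac:(slra).
  by have := ler_norm (- pbot R P); rewrite normrN => *; slra.
(* Otherwise the flux, which is nondecreasing there, stays nonnegative; u is then nondecreasing and
   cannot tend to 0. *)
have u1neg r : X1 <= r -> u1 r < 0.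
  move=> rX; rewrite ltNge; apply/negP => u1r.
  have r0 : 0 < r by slra.
  have fluxmono s : r <= s -> 0 <= s ^+ n * u1 s.
    move=> rs; apply: (@le_trans _ _ (r ^+ n * u1 r)).
      by rewrite mulr_ge0// exprn_ge0// ltW.
    apply: (der_ge0_le (fun r => r ^+ n * u1 r)
      (fun r => r ^+ n * (Q r * u r - K r * (2 * (u r * ln (u r))))) _ _ rs).
      move=> x xs; have x0 : 0 < x by slra.
      by have [hs _ _] := us x; have [_ h _] := hs x ltac:(slra); exact: flux_der.
    move=> x xs; have x0 : 0 < x by slra.
    have [-> _] := pK_far R P x ltac:(slra).
    have -> : Q x * u x - 1 * (2 * (u x * ln (u x))) = u x * (Q x - 2 * ln (u x)) by ring.
    by have := gain x ltac:(slra) => g; rewrite mulr_ge0 ?exprn_ge0 ?mulr_ge0 ?(ltW (up x x0)) ?(ltW x0)//; slra.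
  have umono s : r <= s -> u r <= u s.
    move=> rs; apply: (der_ge0_le u u1 _ _ rs).
      by move=> x xs; have [hs _ _] := us x; have [h _ _] := hs x ltac:(slra).
    move=> x xs; have := fluxmono x ltac:(slra).
    by rewrite pmulr_rge0// exprn_gt0//; slra.
  move/cvgrPdist_lt: u0 => /(_ _ (up r r0)) [Z [_ hZ]].
  pose s := Num.max Z r + 1.
  have Zs : Z < s by rewrite /s; have : Z <= Num.max Z r by [rewrite le_max lexx]; slra.
  have rs : r <= s by rewrite /s; have : r <= Num.max Z r by [rewrite le_max lexx orbT]; slra.
  have := hZ s Zs; rewrite sub0r normrN gtr0_norm ?up//; last by slra.
  by have := umono s rs; slra.
have n0 : 0 <= n%:R :> R by [].
have X10 : 0 < X1 by slra.
exists X1; split => //.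
- move=> b r rX; have [h1 h2] := psol_flow P b al u u1 X1 X10 (us b) r rX.
  by have [e _] := pK_far R P r ltac:(slra); rewrite e sqrtr1 in h1 h2.
- move=> r rX; have r0 : 0 < r by slra.
  have [e1 [e2 e3]] := pK_far R P r ltac:(slra).
  rewrite (pH_eq R P r r0) /slog e1 e2 e3 ln1 mul0r divr1 expr0n /= !mul0r.
  have := gain r rX; have n1 : 1 <= n%:R :> R by rewrite ler1n pn_gt0.
  have : -1 <= n%:R / 2 * (n%:R / 2 - 1) / r ^+ 2.
    have r1 : 1 <= r ^+ 2 by nra.
    rewrite ler_pdivlMr; last by slra.
    by nra.
  slra.
- move=> r rX; have r0 : 0 < r by slra.
  have [e1 [e2 e3]] := pK_far R P r ltac:(slra).
  rewrite /sslope e1 e2 sqrtr1 divr1 mul0r addr0.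
  have q : u1 r / u r <= 0 by rewrite pmulr_lle0 ?invr_gt0 ?up// ltW// u1neg.
  have : n%:R / (2 * r) <= 1 / 2.
    by rewrite ler_pdivrMr; slra.
  slra.
Qed.

Lemma gsol_energy al u u1 : 0 < al -> gsol al u u1 ->
  (forall r, rb <= r -> 0 <= E u u1 r) /\
  (forall r e, 0 < e -> exists2 s, r <= s & E u u1 s < e).
Proof.
move=> al0 gs; have [R0 [R00 rbR fl B2 pc]] := gsol_decay al u u1 al0 gs.
have [us u0] := gs.
have hH r : R0 <= r -> has_der H r (H' r).
  by move=> rr; apply: pH_der; slra.
have hH' r : R0 <= r -> 0 <= H' r.
  by move=> rr; apply: ltW; apply: pH'_gt0; slra.
split=> [r rbr|r e e0].
  have far := decay_energy_ge0 H H' (th u) (sl u u1) R0 fl hH hH' B2 pc.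
  case: (leP R0 r) => rR; first exact: far.
  apply: le_trans (far R0 (lexx _)) _.
  exact: (energy_nonincreasing P R0 al u u1 r R0 (us R0) rbr (ltW rR) (lexx _)).
have [|s rs Es] := decay_energy_small H (th u) (sl u u1) R0 fl B2 pc (Num.max r R0) e _ e0.
  by rewrite le_max lexx orbT.
by exists s => //; apply: le_trans rs; rewrite le_max lexx.
Qed.

(** The sign of eta' is carried by the Wronskian J = r^n u v eta', whose derivative has the sign of
    - eta. It is clear near 0, where eta < 0; later eta might become positive, and the positivity of
    J has to be proved together with that of Y. *)
Lemma gsol_le (a1 a2 : R) u u1 v v1 : 0 < a1 -> 0 < a2 -> gsol a1 u u1 -> gsol a2 v v1 ->
  (forall r, 0 < r -> 0 <= E u u1 r) -> a1 < a2 -> False.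
Proof.
move=> a10 a20 gu gv Epos a12; have [us u0] := gu; have [vs v0] := gv.
have rb0 := prb_gt0 R P.
have up r : 0 < r -> 0 < u r.
  by move=> r0; have [hs _ _] := us r; have [] := hs r ltac:(slra).
have vp r : 0 < r -> 0 < v r.
  by move=> r0; have [hs _ _] := vs r; have [] := hs r ltac:(slra).
have hu r : 0 < r -> has_der u r (u1 r).
  by move=> r0; have [hs _ _] := us r; have [] := hs r ltac:(slra).
have hv r : 0 < r -> has_der v r (v1 r).
  by move=> r0; have [hs _ _] := vs r; have [] := hs r ltac:(slra).
have hu1 r : 0 < r -> has_der u1 r (Q r * u r - K r * (2 * (u r * ln (u r))) - n%:R / r * u1 r).
  by move=> r0; have [hs _ _] := us r; have [] := hs r ltac:(slra).
have hv1 r : 0 < r -> has_der v1 r (Q r * v r - K r * (2 * (v r * ln (v r))) - n%:R / r * v1 r).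
  by move=> r0; have [hs _ _] := vs r; have [] := hs r ltac:(slra).
pose eta r := ln (u r) - ln (v r).
pose tau r := u1 r / u r - v1 r / v r.
have heta r : 0 < r -> has_der eta r (tau r).
  move=> r0; have h1 := hu r r0; have h2 := hv r r0.
  have un := lt0r_neq0 (up r r0); have vn := lt0r_neq0 (vp r r0).
  rewrite /eta; der; [exact: up|exact: vp|].
  by rewrite /tau; field; rewrite un vn.
pose J r := r ^+ n * (u1 r * v r - u r * v1 r).
pose J' r := r ^+ n * (- (2 * K r * u r * v r * eta r)).
have hJ r : 0 < r -> has_der J r (J' r).
  move=> r0; have h1 := hu r r0; have h2 := hv r r0; have h3 := hu1 r r0; have h4 := hv1 r r0.
  have rn := lt0r_neq0 r0.
  by rewrite /J; der; rewrite exprn_pred// /J' /eta; ring.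
have Jtau r : 0 < r -> J r = (r ^+ n * (u r * v r)) * tau r.
  move=> r0; have un := lt0r_neq0 (up r r0); have vn := lt0r_neq0 (vp r r0).
  by rewrite /J /tau; field; rewrite un vn.
have wpos r : 0 < r -> 0 < r ^+ n * (u r * v r).
  by move=> r0; rewrite !mulr_gt0 ?exprn_gt0 ?up ?vp.
have [_ ul uf] := us 1; have [_ vl vf] := vs 1.
have u1l := psol_lim_slope P 1 a1 u u1 a10 ltr01 (us 1).
have v1l := psol_lim_slope P 1 a2 v v1 a20 ltr01 (vs 1).
have Jl : lim0 J 0.
  apply: (lim0_ext (fun r => (r ^+ n * u1 r) * v r - u r * (r ^+ n * v1 r)) _ _ 1) => //.
    by move=> r _; rewrite /J; ring.
  apply: lim0_eq (lim0D _ _ _ _ (lim0M _ _ _ _ uf vl) (lim0N _ _ (lim0M _ _ _ _ ul vf))) _.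
  by rewrite mul0r mulr0 subrr.
have lnl : lim0 eta (ln a1 - ln a2).
  apply: lim0D; first by apply: lim0_comp => //; exact: continuous_ln.
  by apply: lim0N; apply: lim0_comp => //; exact: continuous_ln.
have l12 : ln a1 < ln a2 by rewrite ltr_ln ?posrE.
have [d d0 hd] : exists2 d, 0 < d & forall r, 0 < r < d -> eta r < 0.
  move/lim0P: lnl => /(_ (ln a2 - ln a1) ltac:(slra))[d d0 hd]; exists d => // r /hd.
  by rewrite ltr_distl => /andP[_]; slra.
have J'pos r : 0 < r -> eta r <= 0 -> 0 <= J' r.
  move=> r0 er; rewrite /J' mulr_ge0 ?exprn_ge0 ?(ltW r0)// -mulrN.
  by rewrite !mulr_ge0 ?oppr_ge0 ?(ltW (up r r0)) ?(ltW (vp r r0)) ?(ltW (K_gt0 P r r0)).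
have J'pos2 r : 0 < r -> eta r < 0 -> 0 < J' r.
  move=> r0 er; rewrite /J' mulr_gt0 ?exprn_gt0// -mulrN.
  by rewrite !mulr_gt0 ?oppr_gt0 ?up ?vp ?K_gt0.
have Jnear r : 0 < r < d -> 0 < J r.
  move=> rd; have : 0 <= J (r / 2).
    apply: (nondecreasing_lim0 J J' 0 (r / 2)) => //; last by slra.
    - by move=> x ?; apply: hJ; slra.
    - by move=> x ?; apply: ltW; apply: J'pos2; [slra|apply: hd; slra].
  move=> J2; apply: le_lt_trans J2 _.
  apply: (der_gt0_lt J J'); first slra.
  - by move=> x ?; apply: hJ; slra.
  - by move=> x ?; apply: J'pos2; [slra|apply: hd; slra].
pose Y r := E v v1 r - expR (- 2 * eta r) * E u u1 r.
have hY r : 0 < r -> has_der Y r (2 * tau r * expR (- 2 * eta r) * E u u1 r).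
  move=> r0; have h1 := heta r r0.
  have r2 : 0 < r / 2 by slra.
  have rr : r / 2 <= r <= r by slra.
  have flu := psol_flow P r a1 u u1 (r / 2) r2 (us r).
  have flv := psol_flow P r a2 v v1 (r / 2) r2 (vs r).
  have hH x : r / 2 <= x <= r -> has_der H x (H' x) by move=> ?; apply: pH_der; slra.
  have h2 := energy_der (r / 2) r _ H H' (th u) (sl u u1) flu hH r rr.
  have h3 := energy_der (r / 2) r _ H H' (th v) (sl v v1) flv hH r rr.
  have e : expR (- 2 * eta r) * expR (2 * th u r) = expR (2 * th v r).
    by rewrite -expRD /slog /eta; congr expR; ring.
  rewrite /Y; der; rewrite -e; ring.
(* K is constant near 0 and H cancels, which leaves v^2 sqrt K r^n (p_v^2 - p_u^2 - 2 eta). In p_v^2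
   - p_u^2 the pole n / r is multiplied by eta', so r^n turns it into n r^(n-1) eta', which tends to
   0 even for n = 1. *)
have Yl : lim0 Y 0.
  have K00 : 0 < K (prho R P) by apply: K_gt0; exact: prho_gt0.
  set K0 := K (prho R P) in K00.
  have K0n := lt0r_neq0 K00.
  have sK0 : 0 < Num.sqrt K0 by rewrite sqrtr_gt0.
  have sK2 : Num.sqrt K0 ^+ 2 = K0 by rewrite sqr_sqrtr// ltW.
  apply: (lim0_ext (fun r => - (v r ^+ 2 * Num.sqrt K0 * ((K0^-1 * ((u1 r / u r + v1 r / v r) * r ^+ n
     + n%:R * r ^+ n.-1)) * tau r + 2 * (r ^+ n * eta r)))) _ _ (prho R P) (prho_gt0 R P)).
    move=> r rr; have r0 : 0 < r by slra.
    have [e1 [e2 _]] := pK_near0 R P r rr.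
    rewrite /Y /energy /sslope e1 e2 -/K0.
    have ee : expR (- 2 * eta r) * (expR (2 * th u r) *
       (((u1 r / u r + n%:R / (2 * r) + 0 / 2) / Num.sqrt K0) ^+ 2 + 2 * th u r - H r - 1)) =
       expR (2 * th v r) *
       (((u1 r / u r + n%:R / (2 * r) + 0 / 2) / Num.sqrt K0) ^+ 2 + 2 * th u r - H r - 1).
      by rewrite mulrA -expRD; congr (expR _ * _); rewrite /slog /eta; ring.
    rewrite ee.
    have ev : expR (2 * th v r) = v r ^+ 2 * Num.sqrt K0 * r ^+ n.
      rewrite /slog e1 -/K0.
      have -> : 2 * (ln (v r) + n%:R / 2 * ln r + ln K0 / 4) =
         2 * ln (v r) + ln (Num.sqrt K0) + n%:R * ln r.
        have -> : ln K0 = 2 * ln (Num.sqrt K0) by rewrite -{1}sK2 lnXn// mulr_natl.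
        by field.
      by rewrite !expRD !expRM_natl !lnK ?posrE ?vp.
    rewrite ev.
    have et : 2 * th u r = 2 * th v r + 2 * eta r by rewrite /slog /eta; ring.
    have rn := lt0r_neq0 r0; have sn := lt0r_neq0 sK0.
    have en : n%:R * r ^+ n.-1 = n%:R / r * r ^+ n by rewrite exprn_pred.
    rewrite en et /tau.
    have un := lt0r_neq0 (up r r0); have vn := lt0r_neq0 (vp r r0).
    move: (Num.sqrt K0) sK2 sn => s <- sn.
    by field; rewrite rn un vn sn.
  have lu : lim0 (fun r => u1 r / u r) 0.
    apply: lim0_eq; first apply: lim0M u1l (lim0_comp u (fun x => x^-1) _ ul _).
      by apply: (has_der_cont (fun x : R => x^-1)); apply: has_derV (has_der_id _); rewrite gt_eqF.
    by rewrite mul0r.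
  have lv : lim0 (fun r => v1 r / v r) 0.
    apply: lim0_eq; first apply: lim0M v1l (lim0_comp v (fun x => x^-1) _ vl _).
      by apply: (has_der_cont (fun x : R => x^-1)); apply: has_derV (has_der_id _); rewrite gt_eqF.
    by rewrite mul0r.
  have lt : lim0 tau 0 by apply: lim0_eq (lim0D _ _ _ _ lu (lim0N _ _ lv)) _; rewrite subrr.
  have lrn := lim0X _ _ n (@lim0_id R); have lrn1 := lim0X _ _ n.-1 (@lim0_id R).
  have n0 : (0 : R) ^+ n = 0 by rewrite expr0n; have := pn_gt0 R P; case: (n).
  rewrite n0 in lrn.
  have la := lim0M _ _ _ _ (lim0_cst K0^-1) (lim0D _ _ _ _ (lim0M _ _ _ _ (lim0D _ _ _ _ lu lv) lrn)
     (lim0M _ _ _ _ (lim0_cst n%:R) lrn1)).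
  have lb := lim0D _ _ _ _ (lim0M _ _ _ _ la lt) (lim0M _ _ _ _ (lim0_cst 2) (lim0M _ _ _ _ lrn lnl)).
  have lc := lim0N _ _ (lim0M _ _ _ _ (lim0M _ _ _ _ (lim0X _ _ 2 vl) (lim0_cst (Num.sqrt K0))) lb).
  by apply: lim0_eq lc _; rewrite !mul0r !mulr0 addr0 mulr0 oppr0.
have tauJ r : 0 < r -> 0 < J r -> 0 < tau r.
  by move=> r0; rewrite Jtau// pmulr_rgt0// wpos.
have Y'0 r : 0 < r -> 0 < J r -> 0 <= 2 * tau r * expR (- 2 * eta r) * E u u1 r.
  move=> r0 Jr; have := tauJ r r0 Jr => t0.
  by apply: mulr_ge0; [rewrite !mulr_ge0 ?expR_ge0 ?(ltW t0)|exact: Epos].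
(* At a first zero t of J one has p_u = p_v, so Y(t) = - 2 eta exp (2 t_v), and Y(t) >= 0 gives
   eta(t) <= 0. As eta increases up to t, it is nonpositive before; hence J is nondecreasing there
   and cannot have come down to 0. *)
have Jpos r : 0 < r -> 0 < J r.
  move=> r0; apply: (continuity_induction J 0 r) => //; last by rewrite r0 lexx.
  - by move=> x xr; apply: has_der_cont (hJ x _); slra.
  - by exists d => // x; rewrite add0r => xd _; exact: Jnear.
  move=> t /andP[t0 tr] Js; rewrite ltNge; apply/negP => Jt.
  have Jt0 : J t = 0.
    apply/eqP; rewrite eq_le Jt /= leNgt; apply/negP => Jn.
    have c : {for t, continuous (fun x => - J x)} by apply: continuousN; exact: has_der_cont (hJ t t0).
    have [|e e0 he] := continuous_gt0 _ _ c; first slra.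
    have [x [/andP[x0 xe] /andP[_ xt]]] := small_between _ _ e0 t0.
    have := he (t - x); rewrite ltr0_norm; last by slra.
    by move=> /(_ ltac:(slra)); have := Js (t - x) ltac:(slra); slra.
  have Yt : 0 <= Y t.
    apply: (nondecreasing_lim0 Y (fun r => 2 * tau r * expR (- 2 * eta r) * E u u1 r) 0 t Yl).
    - by move=> x xt; apply: hY; slra.
    - by move=> x xt; apply: Y'0; [slra|apply: Js; slra].
    - by rewrite t0 lexx.
  have tt0 : tau t = 0.
    have := Jtau t t0; rewrite Jt0 => /esym/eqP; rewrite mulf_eq0 gt_eqF ?wpos//=.
    by move/eqP.
  have slE : sl u u1 t = sl v v1 t.
    have e : u1 t / u t = v1 t / v t by apply/eqP; rewrite -subr_eq0; apply/eqP.
    by rewrite /sslope e.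
  have YE : Y t = - (2 * eta t * expR (2 * th v t)).
    have e : expR (- 2 * eta t) * expR (2 * th u t) = expR (2 * th v t).
      by rewrite -expRD /slog /eta; congr expR; ring.
    have et : 2 * th u t = 2 * th v t + 2 * eta t by rewrite /slog /eta; ring.
    by rewrite /Y /energy slE mulrA e et; ring.
  have etat : eta t <= 0.
    move: Yt; rewrite YE oppr_ge0 pmulr_lle0 ?expR_gt0// pmulr_rle0//.
  have etas x : 0 < x < t -> eta x <= 0.
    move=> xt; apply: le_trans etat; apply: (der_ge0_le eta tau); first slra.
      by move=> y ?; apply: heta; slra.
    by move=> y ?; apply: ltW; apply: tauJ; [slra|apply: Js; slra].
  have [x [xd xt]] := small_between _ _ d0 t0.
  have : J x <= J t.
    apply: (der_ge0_le J J'); first slra.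
      by move=> y ?; apply: hJ; slra.
    by move=> y ?; apply: J'pos; [slra|apply: etas; slra].
  by have := Jnear x xd; slra.
have Ymono r s : 0 < r -> r <= s -> Y r <= Y s.
  move=> r0 rs; apply: (der_ge0_le Y (fun r => 2 * tau r * expR (- 2 * eta r) * E u u1 r) _ _ rs).
    by move=> x ?; apply: hY; slra.
  by move=> x ?; apply: Y'0; [slra|apply: Jpos; slra].
have Ypos r : 0 < r -> 0 <= Y r.
  move=> r0; apply: (nondecreasing_lim0 Y (fun r => 2 * tau r * expR (- 2 * eta r) * E u u1 r) 0 r Yl).
  - by move=> x xt; apply: hY; slra.
  - by move=> x xt; apply: Y'0; [slra|apply: Jpos; slra].
  - by rewrite r0 lexx.
(* Beyond rb the energy decreases strictly, so that its nonnegativity is strict; this makes Y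
   strictly increasing there. *)
have Estrict r : rb <= r -> 0 < E u u1 r.
  move=> rbr; apply: le_lt_trans (Epos (r + 1) ltac:(slra)) _.
  pose f r := - E u u1 r; suff : f r < f (r + 1) by rewrite /f ltrN2.
  have fl := psol_flow P (r + 1) a1 u u1 rb rb0 (us (r + 1)).
  apply: (der_gt0_lt f (fun r => - (- H' r * expR (2 * th u r)))); first slra.
  - move=> x xr; apply: has_derN; apply: (energy_der rb (r + 1) _ H H' _ _ fl); last by slra.
    by move=> y ?; apply: pH_der; slra.
  - move=> x xr; rewrite mulNr opprK mulr_gt0 ?expR_gt0//.
    by apply: pH'_gt0; slra.
have Yrb : 0 < Y (rb + 1).
  apply: le_lt_trans (Ypos rb rb0) _.
  apply: (der_gt0_lt Y (fun r => 2 * tau r * expR (- 2 * eta r) * E u u1 r)); first slra.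
  - by move=> x ?; apply: hY; slra.
  - move=> x xr; have t0 := tauJ x ltac:(slra) (Jpos x ltac:(slra)).
    by apply: mulr_gt0; [rewrite !mulr_gt0 ?expR_gt0|apply: Estrict; slra].
have [_ small] := gsol_energy a2 v v1 a20 gv.
have [s rs Es] := small (rb + 1) (Y (rb + 1)) Yrb.
have := Ymono (rb + 1) s ltac:(slra) rs.
have : Y s <= E v v1 s.
  have := Epos s ltac:(slra) => e0.
  by rewrite /Y gerBl; apply: mulr_ge0; [exact: expR_ge0|].
slra.
Qed.

End Uniqueness.

(** * Exclusion of a zero initial value *)

Section Osgood.
Context {R : realType} (P : problem R).
Local Notation n := (pn R P).
Local Notation Q := (pQ R P).
Local Notation K := (pK R P).
Local Notation kap := (pkap R P).
Local Notation H := (pH R P).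
Local Notation H' := (pH' R P).
Local Notation rb := (prb R P).
Local Notation psol := (psol P).
Local Notation th := (slog P).
Local Notation sl := (sslope P).
Local Notation E u u1 := (energy H (th u) (sl u u1)).

(* An Osgood argument: a positive solution cannot start from 0, because u log u
   is only log-Lipschitz there. *)
Lemma psol_nonzero_start al u u1 v v1 T : 0 < al -> 0 < T -> psol T al u u1 -> psol T 0 v v1 -> False.
Proof.
move=> al0 T0 us vs; have [hus ul uf] := us; have [hvs vl vf] := vs.
have [d1 d10 hd1] : exists2 d, 0 < d & forall r, 0 < r < d -> al / 2 < u r < 2 * al.
  move/lim0P: ul => /(_ (al / 2) ltac:(slra))[d d0 hd]; exists d => // r /hd.
  by rewrite ltr_distl => /andP[? ?]; apply/andP; split; slra.
(* This keeps the ratio v / u below 1 / e, where - x ln x is increasing and - ln x > 1. *)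
have [d2 d20 hd2] : exists2 d, 0 < d & forall r, 0 < r < d -> v r < expR (- 1) * (al / 2).
  move/lim0P: vl => /(_ (expR (- 1) * (al / 2))) h.
  have [|d d0 hd] := h; first by rewrite mulr_gt0 ?expR_gt0//; slra.
  by exists d => // r /hd; rewrite subr0 ltr_norml => /andP[].
pose d := Num.min (Num.min d1 d2) T / 2.
have dm : 0 < Num.min (Num.min d1 d2) T by rewrite !lt_min d10 d20.
have dT : Num.min (Num.min d1 d2) T <= T by rewrite !ge_min lexx !orbT.
have dd1 : Num.min (Num.min d1 d2) T <= d1 by rewrite !ge_min lexx.
have dd2 : Num.min (Num.min d1 d2) T <= d2 by rewrite !ge_min lexx !orbT.
have d0 : 0 < d by rewrite /d; slra.
have facts r : 0 < r <= d -> [/\ r <= T, r < d1 & r < d2] by rewrite /d => ?; split; slra.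
have up r : 0 < r <= d -> al / 2 < u r < 2 * al.
  by move=> rd; have [a b c] := facts r rd; apply: hd1; slra.
have vp r : 0 < r <= d -> 0 < v r < expR (- 1) * (al / 2).
  move=> rd; have [a b c] := facts r rd; rewrite hd2 ?andbT; last by slra.
  by have [] := hvs r ltac:(slra).
pose rho r := v r / u r.
have rp r : 0 < r <= d -> 0 < rho r < expR (- 1).
  move=> rd; have /andP[u1_ u2_] := up r rd; have /andP[v1_ v2_] := vp r rd.
  have u0 : 0 < u r by slra.
  rewrite /rho divr_gt0//= ltr_pdivrMr//; apply: lt_trans v2_ _.
  by rewrite ltr_pM2l ?expR_gt0.
have lr r : 0 < r <= d -> ln (rho r) < -1.
  by move=> /rp /andP[h1 h2]; rewrite -[ltRHS]expRK ltr_ln ?posrE ?expR_gt0.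
pose J r := r ^+ n * (v1 r * u r - v r * u1 r).
pose w r := - (rho r * ln (rho r)).
have wp r : 0 < r <= d -> 0 < w r.
  move=> rd; have /andP[h1 _] := rp r rd; have h2 := lr r rd.
  by rewrite /w -mulrN mulr_gt0//; slra.
have w1 r : 0 < r <= d -> w r <= 1.
  by move=> rd; have /andP[h1 _] := rp r rd; have := ylny_ge _ h1; rewrite /w; slra.
pose J' r := 2 * K r * u r ^+ 2 * (r ^+ n * w r).
have hJ r : 0 < r <= d -> has_der J r (J' r).
  move=> rd; have [rT _ _] := facts r rd.
  have [h1 h2 h3] := hus r ltac:(slra); have [h4 h5 h6] := hvs r ltac:(slra).
  have r0 : r != 0 by rewrite gt_eqF//; slra.
  have un := lt0r_neq0 h3.
  rewrite /J; der; rewrite exprn_pred// /J' /w /rho ln_div ?posrE//; field.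
  by rewrite r0 un.
have Jl : lim0 J 0.
  apply: (lim0_ext (fun r => (r ^+ n * v1 r) * u r - v r * (r ^+ n * u1 r)) _ _ 1) => //.
    by move=> r _; rewrite /J; ring.
  apply: lim0_eq (lim0D _ _ _ _ (lim0M _ _ _ _ vf ul) (lim0N _ _ (lim0M _ _ _ _ vl uf))) _.
  by rewrite mul0r mulr0 subrr.
have J'0 r : 0 < r <= d -> 0 <= J' r.
  move=> rd; rewrite /J'; have Kr := K_gt0 P r ltac:(slra); have wr := wp r rd.
  have r0 : 0 <= r by slra.
  apply: mulr_ge0; last by apply: mulr_ge0; [exact: exprn_ge0|exact: ltW].
  apply: mulr_ge0; last exact: sqr_ge0.
  by apply: mulr_ge0; [|exact: ltW].
have Jp r : 0 < r <= d -> 0 <= J r.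
  move=> rd; apply: (nondecreasing_lim0 J J' 0 d) => //.
  by move=> x ?; apply: J'0; slra.
have hrho r : 0 < r <= d -> has_der rho r (J r / (r ^+ n * u r ^+ 2)).
  move=> rd; have [rT _ _] := facts r rd.
  have [h1 h2 h3] := hus r ltac:(slra); have [h4 h5 h6] := hvs r ltac:(slra).
  have r0 : r != 0 by rewrite gt_eqF//; slra.
  have un := lt0r_neq0 h3.
  have rn : r ^+ n != 0 by rewrite expf_neq0.
  rewrite /rho; der => //; rewrite /J; field.
  by rewrite ?rn ?un.
have hw r : 0 < r <= d -> has_der w r (J r / (r ^+ n * u r ^+ 2) * (- ln (rho r) - 1)).
  move=> rd; have h := hrho r rd; have /andP[h1 _] := rp r rd.
  rewrite /w; der => //; field.
  have [rT _ _] := facts r rd; have [_ _ h3] := hus r ltac:(slra).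
  by rewrite ?(lt0r_neq0 h1) ?(lt0r_neq0 h3) ?expf_neq0 ?gt_eqF//; slra.
have rho'0 r : 0 < r <= d -> 0 <= J r / (r ^+ n * u r ^+ 2).
  move=> rd; apply: divr_ge0; first exact: Jp.
  by rewrite mulr_ge0 ?sqr_ge0 ?exprn_ge0//; slra.
pose C := 16 * al ^+ 2.
have C0 : 0 < C by rewrite /C mulr_gt0 ?exprn_gt0.
(* As the ratio rho increases, so does w = - rho ln rho, which can be taken out of the integral of
   J' = 2 K u^2 r^n w; C bounds 2 K u^2. *)
have Jle r : 0 < r <= d -> J r <= C * (r ^+ n.+1 * w r).
  move=> rd; pose g x := C * (x ^+ n.+1 * w x).
  have gl : lim0 g 0.
    apply: (lim0_squeeze _ (fun r => C * r ^+ n.+1) _ d d0).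
      by apply: lim0_eq (lim0M _ _ _ _ (lim0_cst C) (lim0X _ _ n.+1 lim0_id)) _; rewrite expr0n mulr0.
    move=> x xd; have xd' : 0 < x <= d by slra.
    have wx := wp x xd'; have xn : 0 <= x ^+ n.+1 by rewrite exprn_ge0//; slra.
    rewrite subr0 /g ger0_norm; last by rewrite !mulr_ge0// ltW.
    by rewrite ler_pM2l// ler_piMr// w1.
  have hg x : 0 < x <= d -> has_der g x (C * (n.+1%:R * x ^+ n * w x +
       x ^+ n.+1 * (J x / (x ^+ n * u x ^+ 2) * (- ln (rho x) - 1)))).
    by move=> xd; have h := hw x xd; rewrite /g; der; rewrite /=; ring.
  suff cmp x : 0 < x < d -> J' x <= C * (n.+1%:R * x ^+ n * w x +
       x ^+ n.+1 * (J x / (x ^+ n * u x ^+ 2) * (- ln (rho x) - 1))).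
    by have := der_le_lim0 J g J' _ 0 0 d Jl gl hJ hg cmp r rd; rewrite !subr0.
  - move=> xd; have xd' : 0 < x <= d by slra.
    have wx := wp x xd'; have /andP[u1_ u2_] := up x xd'.
    have /andP[K1 K2] := pK_itv R P x ltac:(slra).
    have xn : 0 < x ^+ n by rewrite exprn_gt0//; slra.
    have xn1 : 0 <= x ^+ n.+1 by rewrite exprn_ge0//; slra.
    have n1 : 1 <= n.+1%:R :> R by rewrite ler1n.
    have lx := lr x xd'.
    have t2 : 0 <= x ^+ n.+1 * (J x / (x ^+ n * u x ^+ 2) * (- ln (rho x) - 1)).
      by rewrite mulr_ge0// mulr_ge0 ?rho'0//; slra.
    have uu : u x ^+ 2 <= 4 * al ^+ 2.
      have -> : 4 * al ^+ 2 = (2 * al) ^+ 2 by ring.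
      by apply: sqr_le_sqr; slra.
    have k2 : 2 * K x * u x ^+ 2 <= C.
      rewrite /C; have := sqr_ge0 (u x) => s0.
      have : 2 * K x * u x ^+ 2 <= 2 * 2 * u x ^+ 2 by rewrite ler_wpM2r//; slra.
      by move=> h; clear -h uu; lra.
    have xw : 0 < x ^+ n * w x by rewrite mulr_gt0.
    rewrite /J'; apply: (@le_trans _ _ (C * (x ^+ n * w x))); first by rewrite ler_pM2r.
    rewrite ler_pM2l// -mulrA.
    have : x ^+ n * w x <= n.+1%:R * (x ^+ n * w x) by rewrite ler_peMl// ltW.
    by move=> h; clear -h t2; lra.
pose B := C * 4 / al ^+ 2.
have rho'le r : 0 < r <= d -> J r / (r ^+ n * u r ^+ 2) <= B * r * w r.
  move=> rd; have /andP[u1_ u2_] := up r rd; have wr := wp r rd.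
  have rn : 0 < r ^+ n by rewrite exprn_gt0//; slra.
  have al2 : 0 < al ^+ 2 by rewrite exprn_gt0.
  have uu : al ^+ 2 / 4 <= u r ^+ 2.
    have -> : al ^+ 2 / 4 = (al / 2) ^+ 2 by field.
    by apply: sqr_le_sqr; slra.
  rewrite ler_pdivrMr; last by rewrite mulr_gt0//; slra.
  apply: le_trans (Jle r rd) _.
  have -> : B * r * w r * (r ^+ n * u r ^+ 2) = (C * (r ^+ n.+1 * w r)) * (4 / al ^+ 2 * u r ^+ 2).
    by rewrite /B (exprS r n); ring.
  rewrite ler_peMr//.
    by apply: mulr_ge0; [exact: ltW|apply: mulr_ge0; [apply: exprn_ge0; slra|exact: ltW]].
  apply: (@le_trans _ _ (4 / al ^+ 2 * (al ^+ 2 / 4))).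
    by have <- : 1 = 4 / al ^+ 2 * (al ^+ 2 / 4) :> R by field; rewrite gt_eqF.
  by rewrite ler_wpM2l// divr_ge0// ltW.
(* The inequality rho' <= B r w says that ln (- ln rho) + B r^2 / 2 is nondecreasing. The double
   logarithm is thus bounded above near 0, although rho tends to 0. *)
have key s : 0 < s < d -> ln (- ln (rho s)) <= ln (- ln (rho d)) + B / 2 * d ^+ 2.
  move=> sd; pose f r := ln (- ln (rho r)) + B / 2 * r ^+ 2.
  have B0 : 0 < B by rewrite /B divr_gt0 ?mulr_gt0 ?exprn_gt0.
  have : f s <= f d.
    apply: (der_ge0_le f (fun r => (- ln (rho r))^-1 * - ((rho r)^-1 * (J r / (r ^+ n * u r ^+ 2))) + B * r)).
    - by slra.
    - move=> x xd; have xd' : 0 < x <= d by slra.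
      have h := hrho x xd'; have /andP[h1 _] := rp x xd'; have h2 := lr x xd'.
      by rewrite /f; der => //; [slra|congr (_ + _); field].
    - move=> x xd; have xd' : 0 < x <= d by slra.
      have /andP[h1 _] := rp x xd'; have h2 := lr x xd'; have wx := wp x xd'.
      have -> : (- ln (rho x))^-1 * - ((rho x)^-1 * (J x / (x ^+ n * u x ^+ 2))) =
         - ((J x / (x ^+ n * u x ^+ 2)) / w x).
        move: (J x / (x ^+ n * u x ^+ 2)) => z; rewrite /w; field.
        by rewrite (lt0r_neq0 h1) lt_eqF//; slra.
      have : (J x / (x ^+ n * u x ^+ 2)) / w x <= B * x by rewrite ler_pdivrMr// rho'le.
      slra.
  rewrite /f; have : 0 <= B / 2 * s ^+ 2 by rewrite mulr_ge0 ?sqr_ge0// divr_ge0// ltW.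
  slra.
pose Z := ln (- ln (rho d)) + B / 2 * d ^+ 2.
have rl : lim0 rho 0.
  apply: lim0_eq; first apply: lim0M vl (lim0_comp u (fun x => x^-1) _ ul _).
    by apply: (has_der_cont (fun x : R => x^-1)); apply: has_derV (has_der_id _); rewrite gt_eqF.
  by rewrite mul0r.
move/lim0P: rl => /(_ _ (expR_gt0 (- expR (Z + 1))))[e e0 he].
have [s [se sd]] := small_between _ _ e0 d0.
have /andP[h1 _] := rp s ltac:(slra); have h2 := lr s ltac:(slra).
have := he s se; rewrite subr0 gtr0_norm// => h3.
have : expR (Z + 1) < - ln (rho s).
  by rewrite ltrNr -[ltRHS]expRK ltr_ln ?posrE ?expR_gt0.
rewrite -ltr_ln ?posrE ?expR_gt0//; last by slra.
rewrite expRK; have := key s sd; rewrite -/Z; slra.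
Qed.
End Osgood.

(** * Perturbation of the coefficients *)

(** A head constant on which the tactic [cont] can match the shape of the function. *)
Definition cont_at {R : realType} (f : R -> R) (x : R) : Prop := {for x, continuous f}.

Section ContinuityRules.
Context {R : realType}.
Implicit Types (f g : R -> R) (x : R).

Lemma cont_cst (c : R) x : cont_at (fun=> c) x.
Proof. exact: cvg_cst. Qed.

Lemma contD f g x : cont_at f x -> cont_at g x -> cont_at (fun y => f y + g y) x.
Proof. exact: cvgD. Qed.

Lemma contN f x : cont_at f x -> cont_at (fun y => - f y) x.
Proof. exact: cvgN. Qed.

Lemma contM f g x : cont_at f x -> cont_at g x -> cont_at (fun y => f y * g y) x.
Proof. exact: cvgM. Qed.

Lemma contX f n x : cont_at f x -> cont_at (fun y => f y ^+ n) x.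
Proof.
move=> h; elim: n => [|n IH]; first exact: cont_cst.
have -> : (fun y => f y ^+ n.+1) = (fun y => f y * f y ^+ n) by apply/funext => y; rewrite exprS.
exact: contM.
Qed.

Lemma cont_inv x : x != 0 -> cont_at (fun y : R => y^-1) x.
Proof. by move=> x0; exact: has_der_cont (has_derV _ _ _ x0 (has_der_id _)). Qed.
End ContinuityRules.

Ltac cont := repeat (lazymatch goal with
  | |- cont_at (fun y => @?f y + @?g y) _ => refine (contD f g _ _ _)
  | |- cont_at (fun y => - @?f y) _ => refine (contN f _ _)
  | |- cont_at (fun y => @?f y * @?g y) _ => refine (contM f g _ _ _)
  | |- cont_at (fun y => @?f y ^+ ?k) _ => refine (contX f k _ _)
  | |- cont_at (fun _ => ?c) _ => exact (cont_cst c _)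
  | |- cont_at (fun y => y^-1) _ => apply: cont_inv; assumption
  | |- cont_at _ _ => assumption
  end).

Section UniformBounds.
Context {R : realType} (p : R -> Prop) (al be : R).

Definition bdd (f : R -> R -> R) := exists C, forall d r, p d -> al <= r <= be -> `|f d r| <= C.

Lemma bdd_cst (c : R) : bdd (fun _ _ => c).
Proof. by exists `|c|. Qed.

Lemma bddD f g : bdd f -> bdd g -> bdd (fun d r => f d r + g d r).
Proof.
move=> [C hC] [D hD]; exists (C + D) => d r pd rr.
by apply: le_trans (ler_normD _ _) _; apply: lerD; [exact: hC|exact: hD].
Qed.

Lemma bddN f : bdd f -> bdd (fun d r => - f d r).
Proof. by move=> [C hC]; exists C => d r pd rr; rewrite normrN; exact: hC. Qed.

Lemma bddM f g : bdd f -> bdd g -> bdd (fun d r => f d r * g d r).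
Proof.
by move=> [C hC] [D hD]; exists (C * D) => d r pd rr; rewrite normrM ler_pM ?hC ?hD.
Qed.

Lemma bddX f n : bdd f -> bdd (fun d r => f d r ^+ n).
Proof.
move=> h; elim: n => [|n IH]; first exact: bdd_cst.
by have [C hC] := bddM _ _ h IH; exists C => d r pd rr; rewrite exprS; exact: hC.
Qed.

Lemma bdd_fst D : (forall d, p d -> `|d| <= D) -> bdd (fun d _ => d).
Proof. by move=> h; exists D => d r /h. Qed.

Lemma bdd_snd (f : R -> R) : (forall r, al <= r <= be -> {for r, continuous f}) -> bdd (fun _ r => f r).
Proof. by move=> /continuous_bounded[C _ hC]; exists C => d r _ /hC. Qed.
End UniformBounds.

Ltac bdd := repeat (lazymatch goal with
  | |- bdd _ _ _ (fun _ _ => ?c) => exact (bdd_cst _ _ _ c)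
  | |- bdd _ _ _ (fun d r => @?f d r + @?g d r) => refine (bddD _ _ _ f g _ _)
  | |- bdd _ _ _ (fun d r => - @?f d r) => refine (bddN _ _ _ f _)
  | |- bdd _ _ _ (fun d r => @?f d r * @?g d r) => refine (bddM _ _ _ f g _ _)
  | |- bdd _ _ _ (fun d r => @?f d r ^+ ?k) => refine (bddX _ _ _ f k _)
  | |- bdd _ _ _ _ => assumption
  end).

Record coefs (R : realType) := Coefs {
  cn : nat;
  cV : R -> R; cV' : R -> R; ca : R -> R; ca' : R -> R;
  cb : R -> R; cb1 : R -> R; cb2 : R -> R; cb3 : R -> R; cM : R -> R;
  crho : R; cfar : R; cbot : R; cA : R; cB : R;
  cn_gt0 : (0 < cn)%N;
  cV_der : forall r : R, 0 < r -> has_der cV r (cV' r);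
  cV'_cont : forall r : R, 0 < r -> {for r, continuous cV'};
  ca_der : forall r : R, 0 < r -> has_der ca r (ca' r);
  ca'_cont : forall r : R, 0 < r -> {for r, continuous ca'};
  ca_le : forall r : R, 0 < r -> `|ca r| <= cA;
  ca'_le : forall r : R, 0 < r -> `|ca' r| <= cA;
  cb_der : forall r : R, 0 < r -> has_der cb r (cb1 r);
  cb1_der : forall r : R, 0 < r -> has_der cb1 r (cb2 r);
  cb2_der : forall r : R, 0 < r -> has_der cb2 r (cb3 r);
  cb3_cont : forall r : R, 0 < r -> {for r, continuous cb3};
  cb_itv : forall r : R, 0 < r -> 0 <= cb r <= cB;
  crho_gt0 : 0 < crho;
  cb_near0 : forall r : R, 0 < r < crho -> [/\ cb r = 1, cb1 r = 0, cb2 r = 0 & cb3 r = 0];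
  cfar_gt0 : 0 < cfar;
  ca_far : forall r : R, cfar <= r -> ca r = 0 /\ ca' r = 0;
  cb_far : forall r : R, cfar <= r -> [/\ cb r = 0, cb1 r = 0, cb2 r = 0 & cb3 r = 0];
  cV_far : forall r : R, cfar <= r -> cbot <= cV r;
  cM_der : forall r : R, 0 < r -> has_der cM r `|cV r|;
  cM_lim0 : lim0 cM 0
}.

Section Perturbation.
Context {R : realType} (c : coefs R).
Local Notation n := (cn R c).
Local Notation V := (cV R c).
Local Notation V' := (cV' R c).
Local Notation a := (ca R c).
Local Notation a' := (ca' R c).
Local Notation b := (cb R c).
Local Notation b1 := (cb1 R c).
Local Notation b2 := (cb2 R c).
Local Notation b3 := (cb3 R c).
Local Notation A0 := (cA R c).
Local Notation B0 := (cB R c).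

Implicit Types d r : R.

(* With the weight pk = 1 + d b one has K' / (2 K) = d k1; k2 and k3 are the derivatives
   of k1, phi is the potential H of the perturbed problem, and gder is G'. *)
Definition adm (d : R) := [/\ 0 <= d, d <= 1 & d * B0 <= 1].

Definition pk d r := 1 + d * b r.
Definition ik d r := (pk d r)^-1.
Definition k1 d r := b1 r * ik d r / 2.
Definition k2 d r := b2 r * ik d r / 2 - d * (b1 r * ik d r) ^+ 2 / 2.
Definition k3 d r := b3 r * ik d r / 2 - 3 / 2 * (d * b1 r * b2 r * ik d r ^+ 2)
  + d ^+ 2 * b1 r ^+ 3 * ik d r ^+ 3.
Definition cpole : R := n%:R / 2 * (n%:R / 2 - 1).
Definition pA d r := V r + d * a r + cpole / r ^+ 2 + d * k2 d r / 2 - (d * k1 d r) ^+ 2 / 4.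
Definition pA' d r := V' r + d * a' r - 2 * cpole * r^-1 ^+ 3 + d * k3 d r / 2
  - d ^+ 2 * k1 d r * k2 d r / 2.
Definition phi d r := pA d r / pk d r + n%:R * ln r + ln (pk d r) / 2.
Definition phi' d r := pA' d r * ik d r - 2 * d * k1 d r * pA d r * ik d r + n%:R * r^-1 + d * k1 d r.
Definition gder r := V' r - 2 * cpole * r^-1 ^+ 3 + n%:R * r^-1.

Lemma pk_itv d r : adm d -> 0 < r -> 1 <= pk d r <= 2.
Proof.
move=> [d0 d1 dB] r0; have /andP[b0 bB] := cb_itv R c r r0; rewrite /pk.
have h1 : 0 <= d * b r by rewrite mulr_ge0.
have h2 : d * b r <= d * B0 by rewrite ler_wpM2l.
by apply/andP; split; lra.
Qed.

Lemma pk_gt0 d r : adm d -> 0 < r -> 0 < pk d r.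
Proof. by move=> ad r0; have /andP[] := pk_itv d r ad r0; lra. Qed.

Lemma ik_itv d r : adm d -> 0 < r -> 0 <= ik d r <= 1.
Proof.
move=> ad r0; have /andP[h _] := pk_itv d r ad r0; have p := pk_gt0 d r ad r0.
by rewrite /ik invr_ge0 ltW//= invf_le1.
Qed.

Lemma pk_der d r : 0 < r -> has_der (pk d) r (d * b1 r).
Proof. by move=> r0; have h := cb_der R c r r0; rewrite /pk; der; ring. Qed.

Lemma ik_der d r : adm d -> 0 < r -> has_der (ik d) r (- (d * b1 r) * ik d r ^+ 2).
Proof.
move=> ad r0; have h := pk_der d r r0; have p := lt0r_neq0 (pk_gt0 d r ad r0).
by rewrite /ik; der => //; rewrite exprVn.
Qed.

Lemma k1_der d r : adm d -> 0 < r -> has_der (k1 d) r (k2 d r).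
Proof.
move=> ad r0; have h := ik_der d r ad r0; have h1 := cb1_der R c r r0.
by rewrite /k1 /k2; der; ring.
Qed.

Lemma k2_der d r : adm d -> 0 < r -> has_der (k2 d) r (k3 d r).
Proof.
move=> ad r0; have h := ik_der d r ad r0; have h1 := cb1_der R c r r0; have h2 := cb2_der R c r r0.
by rewrite /k2 /k3; der; rewrite /=; field.
Qed.

Lemma pA_der d r : adm d -> 0 < r -> has_der (pA d) r (pA' d r).
Proof.
move=> ad r0; have h1 := k1_der d r ad r0; have h2 := k2_der d r ad r0.
have h3 := cV_der R c r r0; have h4 := ca_der R c r r0; have rn := lt0r_neq0 r0.
have r2 : r ^+ 2 != 0 by rewrite expf_neq0.
by rewrite /pA /pA'; der => //; rewrite /=; field.
Qed.

Lemma pk_kap d r : adm d -> 0 < r -> d * b1 r = 2 * pk d r * (d * k1 d r).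
Proof.
move=> ad r0; have p := lt0r_neq0 (pk_gt0 d r ad r0).
by rewrite /k1 /ik; field.
Qed.

Lemma phi_der d r : adm d -> 0 < r -> has_der (phi d) r (phi' d r).
Proof.
move=> ad r0; have h := pA_der d r ad r0; have h2 := pk_der d r r0.
have p := pk_gt0 d r ad r0; have pn := lt0r_neq0 p; have rn := lt0r_neq0 r0.
rewrite /phi; der => //.
by rewrite /phi' /ik (pk_kap d r ad r0); field; rewrite pn rn.
Qed.

Lemma k3_cont d r : adm d -> 0 < r -> cont_at (k3 d) r.
Proof.
move=> ad r0; have h0 : cont_at b3 r := cb3_cont R c r r0.
have h1 : cont_at b1 r := has_der_cont _ _ _ (cb1_der R c r r0).
have h2 : cont_at b2 r := has_der_cont _ _ _ (cb2_der R c r r0).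
have h3 : cont_at (ik d) r := has_der_cont _ _ _ (ik_der d r ad r0).
by rewrite /k3; cont.
Qed.

Lemma phi'_cont d r : adm d -> 0 < r -> cont_at (phi' d) r.
Proof.
move=> ad r0; have h0 := k3_cont d r ad r0; have rn := lt0r_neq0 r0.
have h1 : cont_at (k1 d) r := has_der_cont _ _ _ (k1_der d r ad r0).
have h2 : cont_at (k2 d) r := has_der_cont _ _ _ (k2_der d r ad r0).
have h3 : cont_at (ik d) r := has_der_cont _ _ _ (ik_der d r ad r0).
have h4 : cont_at (pA d) r := has_der_cont _ _ _ (pA_der d r ad r0).
have h5 : cont_at V' r := cV'_cont R c r r0.
have h6 : cont_at a' r := ca'_cont R c r r0.
by rewrite /phi' /pA'; cont.
Qed.

Lemma gder_cont r : 0 < r -> cont_at gder r.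
Proof.
move=> r0; have rn := lt0r_neq0 r0; have h5 : cont_at V' r := cV'_cont R c r r0.
by rewrite /gder; cont.
Qed.

(** Near 0 the weight is the constant 1 + d, so only V, a and the pole are divided by it. The
    identity is exact and contains G' unperturbed, whereas V' may blow up at 0 and spoil any
    estimate uniform in r. *)
Lemma phi'_near0 d r : adm d -> 0 < r < crho R c ->
  (1 + d) * phi' d r = gder r + d * (a' r + n%:R / r).
Proof.
move=> [d0 d1 dB] rr; have [e0 e1 e2 e3] := cb_near0 R c r rr.
have q : (1 + d) * ik d r = 1 by rewrite /ik /pk e0 mulr1 mulfV// gt_eqF//; lra.
rewrite /phi' /pA' /gder /k1 /k2 /k3 e1 e2 e3.
transitivity ((V' r + d * a' r - 2 * cpole * r^-1 ^+ 3) * ((1 + d) * ik d r) + (1 + d) * (n%:R * r^-1)).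
  by ring.
by rewrite q; ring.
Qed.

Lemma phi'_far d r : cfar R c <= r -> phi' d r = gder r.
Proof.
move=> rr; have [e0 e1 e2 e3] := cb_far R c r rr; have [a0 a1] := ca_far R c r rr.
have q : ik d r = 1 by rewrite /ik /pk e0 mulr0 addr0 invr1.
by rewrite /phi' /pA' /gder /k1 /k2 /k3 e1 e2 e3 a1 q; ring.
Qed.

Section Bounds.
Variables (al be : R).
Hypothesis al0 : 0 < al.
Local Notation bdd := (bdd adm al be).

Let bdd_r (f : R -> R) : (forall r, 0 < r -> {for r, continuous f}) -> bdd (fun _ r => f r).
Proof. by move=> h; apply: bdd_snd => r /andP[r1 _]; apply: h; exact: lt_le_trans r1. Qed.

Let bdd_d : bdd (fun d _ => d).
Proof. by apply: (bdd_fst _ _ _ 1) => d [d0 d1 _]; rewrite ger0_norm. Qed.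

Let bdd_ik : bdd ik.
Proof.
exists 1 => d r ad /andP[r1 _]; have r0 := lt_le_trans al0 r1.
by have /andP[i0 i1] := ik_itv d r ad r0; rewrite ger0_norm.
Qed.

Let bdd_pk : bdd pk.
Proof.
exists 2 => d r ad /andP[r1 _]; have r0 := lt_le_trans al0 r1.
by have /andP[i0 i1] := pk_itv d r ad r0; rewrite ger0_norm//; apply: le_trans i0.
Qed.

Let bdd_b := bdd_r b (fun r rp => has_der_cont _ _ _ (cb_der R c r rp)).
Let bdd_b1 := bdd_r b1 (fun r rp => has_der_cont _ _ _ (cb1_der R c r rp)).
Let bdd_b2 := bdd_r b2 (fun r rp => has_der_cont _ _ _ (cb2_der R c r rp)).
Let bdd_b3 := bdd_r b3 (cb3_cont R c).
Let bdd_a := bdd_r a (fun r rp => has_der_cont _ _ _ (ca_der R c r rp)).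
Let bdd_a' := bdd_r a' (ca'_cont R c).
Let bdd_V := bdd_r V (fun r rp => has_der_cont _ _ _ (cV_der R c r rp)).
Let bdd_V' := bdd_r V' (cV'_cont R c).
Let bdd_inv := bdd_r (fun r => r^-1) (fun r rp => cont_inv r (lt0r_neq0 rp)).
Let bdd_inv2 : bdd (fun _ r => (r ^+ 2)^-1).
Proof.
have [C hC] := bddX _ _ _ _ 2 bdd_inv.
by exists C => d r ad rr; rewrite -exprVn; exact: (hC d).
Qed.

Let bdd_k1 : bdd k1. Proof. rewrite /k1; bdd. Qed.
Let bdd_k2 : bdd k2. Proof. rewrite /k2; bdd. Qed.
Let bdd_k3 : bdd k3. Proof. rewrite /k3; bdd. Qed.
Let bdd_A : bdd pA. Proof. rewrite /pA; bdd. Qed.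
Let bdd_A' : bdd pA'. Proof. rewrite /pA'; bdd. Qed.

Lemma phi'_bounded : bdd phi'.
Proof. rewrite /phi'; bdd. Qed.

Lemma phi_bounded : bdd phi.
Proof.
have bl := bdd_r (@ln R) (fun r rp => continuous_ln rp).
have bl2 : bdd (fun d r => ln (pk d r)).
  exists 2 => d r ad /andP[r1 _]; have r0 := lt_le_trans al0 r1.
  have /andP[i0 i1] := pk_itv d r ad r0; rewrite ger0_norm ?ln_ge0//.
  apply: le_trans (le_ln1Dx _) _; last by rewrite /pk in i1; lra.
  by rewrite /pk in i0; lra.
have bi : bdd (fun d r => (pk d r)^-1) := bdd_ik.
by rewrite /phi; bdd.
Qed.

(** The difference is exactly d times the expression below, thanks to 1 - [ik] = d b [ik]; that
    expression is bounded uniformly in d on compact intervals of ]0, +oo[. *)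
Lemma phi'_close : exists2 C, 0 < C & forall d r, adm d -> al <= r <= be -> `|phi' d r - gder r| <= d * C.
Proof.
have [C hC] : bdd (fun d r => a' r * ik d r - b r * ik d r * (V' r - 2 * cpole * r^-1 ^+ 3)
  + (k3 d r / 2 - d * k1 d r * k2 d r / 2) * ik d r - 2 * k1 d r * pA d r * ik d r + k1 d r) by bdd.
exists (Num.max C 1) => [|d r ad rr]; first by rewrite lt_max ltr01 orbT.
have r0 : 0 < r by case/andP: rr => r1 _; exact: lt_le_trans r1.
have p := lt0r_neq0 (pk_gt0 d r ad r0); have := hC d r ad rr.
set X := (X in `|X|) => hX.
have -> : phi' d r - gder r = d * X.
  have e : 1 = ik d r * (1 + d * b r) by rewrite -/(pk d r) /ik mulVf.
  have e2 : V' r - 2 * cpole * r^-1 ^+ 3 = (V' r - 2 * cpole * r^-1 ^+ 3) * (ik d r * (1 + d * b r)).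
    by rewrite -e mulr1.
  rewrite /phi' /gder {1}e2 /pA' /X; ring.
have [d0 _ _] := ad.
by rewrite normrM (ger0_norm d0) ler_wpM2l// le_max hX.
Qed.
End Bounds.

Section Construction.
Variables (d rb : R).
Hypothesis ad : adm d.
Hypothesis rb0 : 0 < rb.
Hypothesis phi'_pos : forall r, rb <= r -> 0 < phi' d r.

Let Q r := V r + d * a r.

Let Q_cont r : 0 < r -> {for r, continuous Q}.
Proof.
move=> r0; have h1 : cont_at V r := has_der_cont _ _ _ (cV_der R c r r0).
have h2 : cont_at a r := has_der_cont _ _ _ (ca_der R c r r0).
by rewrite -/(cont_at Q r) /Q; cont.
Qed.

Let M_der r : 0 < r -> has_der (fun r => cM R c r + A0 * r) r (`|V r| + A0).
Proof. by move=> r0; have h := cM_der R c r r0; der; ring. Qed.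

Let M_lim0 : lim0 (fun r => cM R c r + A0 * r) 0.
Proof.
apply: lim0_eq (lim0D _ _ _ _ (cM_lim0 R c) (lim0M _ _ _ _ (lim0_cst A0) lim0_id)) _.
by rewrite mulr0 addr0.
Qed.

Let Q_le r : 0 < r -> `|Q r| <= `|V r| + A0.
Proof.
move=> r0; apply: le_trans (ler_normD _ _) _; rewrite lerD2l normrM.
have [d0 d1 _] := ad; rewrite (ger0_norm d0); have := ca_le R c r r0.
have := normr_ge0 (a r); nra.
Qed.

Let K_der r : 0 < r -> has_der (pk d) r (2 * pk d r * (d * k1 d r)).
Proof. by move=> r0; apply: has_der_eq (pk_der d r r0) _; exact: pk_kap. Qed.

Let kap_der r : 0 < r -> has_der (fun r => d * k1 d r) r (d * k2 d r).
Proof. by move=> r0; have h := k1_der d r ad r0; der; ring. Qed.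

Let K_near0 r : 0 < r < crho R c / 2 ->
  pk d r = pk d (crho R c / 2) /\ d * k1 d r = 0 /\ d * k2 d r = 0.
Proof.
have r0 := crho_gt0 R c.
move=> rr; have [e0 e1 e2 _] := cb_near0 R c r ltac:(lra).
have [e0' _ _ _] := cb_near0 R c (crho R c / 2) ltac:(lra).
by rewrite /pk e0 e0' /k1 /k2 e1 e2; split => //; split; ring.
Qed.

Let rho0 : 0 < crho R c / 2.
Proof. by have := crho_gt0 R c; lra. Qed.

Let H_eq r : 0 < r -> phi d r = (Q r + n%:R / 2 * (n%:R / 2 - 1) / r ^+ 2 + d * k2 d r / 2
   - (d * k1 d r) ^+ 2 / 4) / pk d r + n%:R * ln r + ln (pk d r) / 2.
Proof. by []. Qed.

Let K_far r : cfar R c <= r -> pk d r = 1 /\ d * k1 d r = 0 /\ d * k2 d r = 0.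
Proof.
move=> rr; have [e0 e1 e2 _] := cb_far R c r rr.
by rewrite /pk e0 mulr0 addr0 /k1 /k2 e1 e2; split => //; split; ring.
Qed.

Let Q_far r : cfar R c <= r -> cbot R c <= Q r.
Proof.
by move=> rr; rewrite /Q; have [-> _] := ca_far R c r rr; rewrite mulr0 addr0; exact: cV_far.
Qed.

(** Half of [crho] is used because [pK_near0] evaluates K at [prho] itself, while b = 1 is given on
    an open interval. *)
Definition perturbed : problem R := @Problem R n Q (pk d) (fun r => d * k1 d r)
  (fun r => d * k2 d r) (phi d) (phi' d) (fun r => `|V r| + A0) (fun r => cM R c r + A0 * r)
  (crho R c / 2) (cfar R c) (cbot R c) rb (cn_gt0 R c) Q_cont M_der M_lim0 Q_le K_der kap_der
  (fun r rp => pk_itv d r ad rp) rho0 K_near0 H_eq (fun r rp => phi_der d r ad rp)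
  (cfar_gt0 R c) K_far Q_far rb0 phi'_pos
  (fun r rr => phi'_cont d r ad (lt_le_trans rb0 rr)).
End Construction.
End Perturbation.

(** * Nonnegativity of the energy *)

Section EnergySign.
Context {R : realType} (P : problem R).
Local Notation n := (pn R P).
Local Notation Q := (pQ R P).
Local Notation K := (pK R P).
Local Notation H := (pH R P).
Local Notation H' := (pH' R P).
Local Notation rb := (prb R P).
Local Notation psol := (psol P).
Local Notation th := (slog P).
Local Notation sl := (sslope P).
Local Notation E u u1 := (energy H (th u) (sl u u1)).

Definition nonneg_energy := forall al u u1, 0 < al -> gsol P al u u1 ->
  forall r, 0 < r -> 0 <= E u u1 r.

Lemma energy_psol_der al u u1 T r : psol T al u u1 -> 0 < r <= T ->
  has_der (E u u1) r (- H' r * expR (2 * th u r)).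
Proof.
move=> us /andP[r0 rT]; have rr : r <= r <= T by rewrite lexx.
apply: (energy_der r T _ H H' _ _ (psol_flow P T al u u1 r r0 us)) => // x /andP[rx _].
by apply: pH_der; exact: lt_le_trans rx.
Qed.

Lemma increasing_nonneg_energy : (forall r, 0 < r -> 0 < H' r) -> nonneg_energy.
Proof.
move=> H'0 al u u1 al0 gu r r0; have [us _] := gu.
have rm : r <= Num.max r rb by rewrite le_max lexx.
have [nn _] := gsol_energy P al u u1 al0 gu.
apply: le_trans (nn (Num.max r rb) _) _; first by rewrite le_max lexx orbT.
pose f r := - E u u1 r; suff : f r <= f (Num.max r rb) by rewrite /f lerN2.
apply: (der_ge0_le f (fun r => - (- H' r * expR (2 * th u r))) _ _ rm).
- move=> x /andP[rx _]; apply: has_derN; apply: (energy_psol_der al u u1 x x (us x)).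
  by rewrite lexx andbT; exact: lt_le_trans rx.
- move=> x /andP[rx _]; rewrite mulNr opprK mulr_ge0 ?expR_ge0//.
  by apply/ltW/H'0; exact: lt_trans rx.
Qed.

(* Near 0 a negative energy forces |Q| >= const / r, which is not integrable. *)
Lemma energy_ge0_near0 T al u u1 r1 : (2 < n)%N -> 0 < al -> psol T al u u1 ->
  0 < r1 <= T -> (forall r, 0 < r <= r1 -> H' r <= 0) ->
  forall r, 0 < r <= r1 -> 0 <= E u u1 r.
Proof.
move=> n3 al0 us /andP[r10 r1T] H'0 r /andP[r0 rr1]; rewrite leNgt; apply/negP => Er.
pose e := - E u u1 r; have e0 : 0 < e by rewrite /e oppr_gt0.
have Es s : 0 < s <= r -> e <= - E u u1 s.
  move=> /andP[s0 sr]; rewrite /e lerN2.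
  apply: (der_ge0_le (E u u1) (fun r => - H' r * expR (2 * th u r)) _ _ sr).
  - move=> x /andP[sx xr]; apply: (energy_psol_der al u u1 T x us); apply/andP; split.
      exact: lt_le_trans sx.
    by apply: le_trans xr _; apply: le_trans r1T.
  - move=> x /andP[sx xr]; rewrite mulr_ge0 ?expR_ge0// oppr_ge0 H'0//; apply/andP; split.
      exact: lt_trans sx.
    by apply: le_trans (ltW xr) _.
have [hs ul _] := us.
have [d d0 hd] : exists2 d, 0 < d & forall s, 0 < s < d -> al / 2 < u s < 2 * al.
  move/lim0P: ul => /(_ (al / 2) ltac:(slra))[d d0 hd]; exists d => // s /hd.
  by rewrite ltr_distl => /andP[? ?]; apply/andP; split; slra.
have rho0 := prho_gt0 R P.
have K0 : 0 < K (prho R P) by apply: K_gt0.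
set K1 := K (prho R P) in K0.
have /andP[K1a K1b] := pK_itv R P (prho R P) rho0; rewrite -/K1 in K1a K1b.
pose W := `|2 * ln (al / 2) - 1|; have W0 : 0 <= W by exact: normr_ge0.
pose cp : R := n%:R / 2 * (n%:R / 2 - 1).
have n2 : 2 < n%:R :> R by rewrite (ltr_nat R 2).
have cp0 : 0 <= cp by rewrite /cp mulr_ge0//; slra.
pose B := (2 * al) ^+ 2 * 2; have B0 : 0 < B by rewrite /B mulr_gt0 ?exprn_gt0//; slra.
pose D := Num.min (Num.min d (prho R P)) (Num.min r 1).
have D0 : 0 < D by rewrite !lt_min d0 rho0 r0 ltr01.
(* In - E the terms in ln s cancel and - p^2 is dropped. The weight exp (2 t) is at most B s^n; as n
   >= 3, both s^n and the power s^(n-2) left by the pole of H are at most s. *)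
have low s : 0 < s < D -> e <= B * (s * (W + `|Q s|) + s * cp).
  move=> /andP[s0]; rewrite !lt_min => /andP[/andP[sd srho] /andP[sr s1]].
  have sT : s <= T by apply: le_trans (ltW sr) _; apply: le_trans r1T.
  have [h1 h2 u0] := hs s ltac:(by rewrite s0).
  have /andP[ua ub] := hd s ltac:(by rewrite s0).
  have [eK [ek ek']] := pK_near0 R P s ltac:(by rewrite s0).
  have := Es s ltac:(by rewrite s0 ltW).
  have ->  : - E u u1 s = expR (2 * th u s) * (((Q s + cp / s ^+ 2) / K1 + 1 - 2 * ln (u s)) - sl u u1 s ^+ 2).
    by rewrite /energy (pH_eq R P s s0) ek' eK -/K1 ek /slog eK -/K1 /cp; field; rewrite !lt0r_neq0.
  have ev : expR (2 * th u s) = u s ^+ 2 * Num.sqrt K1 * s ^+ n.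
    rewrite /slog eK -/K1.
    have -> : 2 * (ln (u s) + n%:R / 2 * ln s + ln K1 / 4) =
         2 * ln (u s) + ln (Num.sqrt K1) + n%:R * ln s.
      have -> : ln K1 = 2 * ln (Num.sqrt K1).
        by rewrite -[in LHS](sqr_sqrtr (ltW K0)) lnXn ?sqrtr_gt0// mulr_natl.
      by field.
    by rewrite !expRD !expRM_natl !lnK ?posrE ?sqrtr_gt0.
  have evp := expR_gt0 (2 * th u s).
  move=> h; have {}h : e <= expR (2 * th u s) * ((Q s + cp / s ^+ 2) / K1 + 1 - 2 * ln (u s)).
    by apply: le_trans h _; rewrite ler_pM2l// gerBl sqr_ge0.
  apply: le_trans h _.
  have lnu : ln (al / 2) <= ln (u s) by rewrite ler_ln ?posrE//; slra.
  have W1 : - W <= 2 * ln (al / 2) - 1 by rewrite /W; have := ler_norm (- (2 * ln (al / 2) - 1)); rewrite normrN; slra.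
  have Qs : (Q s + cp / s ^+ 2) / K1 <= `|Q s| + cp / s ^+ 2.
    rewrite ler_pdivrMr//.
    have Q0 : 0 <= `|Q s| + cp / s ^+ 2 by rewrite addr_ge0// mulr_ge0// invr_ge0 exprn_ge0// ltW.
    by move: (ler_norm (Q s)) Q0 K1a; move: (cp / s ^+ 2) (`|Q s|) (Q s) => X Y Z; clear; nra.
  apply: (@le_trans _ _ (expR (2 * th u s) * (W + `|Q s| + cp / s ^+ 2))); first by rewrite ler_pM2l//; clear -Qs lnu W1; lra.
  have eB : expR (2 * th u s) <= B * s ^+ n.
    rewrite ev ler_pM2r ?exprn_gt0//; apply: ler_pM; rewrite ?sqr_ge0 ?sqrtr_ge0//.
      by rewrite ler_pXn2r ?nnegrE//; slra.
    by have /andP[] := sqrtK_itv P (prho R P) rho0.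
  apply: (@le_trans _ _ (B * s ^+ n * (W + `|Q s| + cp / s ^+ 2))).
    rewrite ler_wpM2r// !addr_ge0// mulr_ge0// invr_ge0 exprn_ge0// ltW//.
  rewrite -mulrA ler_pM2l// mulrDr; apply: lerD.
    by rewrite ler_wpM2r ?addr_ge0// -[leRHS]expr1 ler_wiXn2l ?ltW//; apply: leq_trans n3.
  have -> : s ^+ n * (cp / s ^+ 2) = s ^+ (n - 2) * cp.
    rewrite -{1}(subnK (ltnW n3)) exprD; field; exact: lt0r_neq0.
  by rewrite ler_wpM2r// -[leRHS]expr1 ler_wiXn2l ?ltW// subn_gt0.
pose c5 := e / (2 * B); have c50 : 0 < c5 by rewrite /c5 divr_gt0// mulr_gt0.
pose D' := Num.min D (e / (2 * B * (W + cp + 1))).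
have Wc : 0 < W + cp + 1 by slra.
have D'0 : 0 < D' by rewrite lt_min D0 divr_gt0// !mulr_gt0.
have low2 s : 0 < s < D' -> c5 / s <= `|Q s|.
  move=> /andP[s0]; rewrite lt_min => /andP[sD sW].
  have := low s ltac:(by rewrite s0).
  rewrite ltr_pdivlMr ?mulr_gt0// in sW.
  have h : B * (s * (W + `|Q s|) + s * cp) = s * (B * (W + cp)) + B * s * `|Q s| by ring.
  have h2 : s * (2 * B * (W + cp + 1)) = 2 * (s * (B * (W + cp))) + 2 * (s * B) by ring.
  have sB : 0 < s * B by rewrite mulr_gt0.
  move=> h3; rewrite ler_pdivrMr// /c5 ler_pdivrMr ?mulr_gt0//.
  have -> : `|Q s| * s * (2 * B) = 2 * (B * s * `|Q s|) by ring.
  rewrite h in h3; rewrite h2 in sW; clear -h3 sW sB; lra.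
have [r2 [/andP[r20 r2D] _]] := small_between _ _ D'0 ltr01.
(* The left side is unbounded as s tends to 0, while the right side is at most M(r2). *)
have grow s : 0 < s -> s <= r2 -> c5 * ln r2 - c5 * ln s <= pM R P r2 - pM R P s.
  move=> s0 sr; apply: (der_le_le (fun r => c5 * ln r) (pM R P) (fun r => c5 / r) (pm R P) _ _ sr).
  - move=> x /andP[sx _]; have x0 : 0 < x by exact: lt_le_trans sx.
    by der => //; ring.
  - by move=> x /andP[sx _]; apply: pM_der; exact: lt_le_trans sx.
  - move=> x /andP[sx xr]; have x0 : 0 < x by exact: lt_trans sx.
    by apply: le_trans (pQ_le R P x x0); apply: low2; rewrite x0 (lt_trans xr).
pose s := Num.min r2 (expR (ln r2 - (pM R P r2 + 1) / c5)).
have s0 : 0 < s by rewrite lt_min r20 expR_gt0.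
have sr : s <= r2 by rewrite ge_min lexx.
have := grow s s0 sr; have := M_pos P s s0.
have : ln s <= ln r2 - (pM R P r2 + 1) / c5.
  by rewrite -[leRHS]expRK ler_ln ?posrE ?expR_gt0// ge_min lexx orbT.
rewrite -(ler_pM2l c50) mulrBr [c5 * (_ / c5)]mulrC divfK ?gt_eqF//; slra.
Qed.
End EnergySign.

Lemma gsol_unique {R : realType} (P : problem R) al u u1 be v v1 : nonneg_energy P ->
  0 < al -> 0 < be -> gsol P al u u1 -> gsol P be v v1 -> forall r : R, 0 < r -> u r = v r.
Proof.
move=> nn al0 be0 gu gv r r0; have [us _] := gu; have [vs _] := gv.
have e : al = be.
  case: (ltgtP al be) => // h; exfalso.
  - exact: (gsol_le P al be u u1 v v1 al0 be0 gu gv (nn al u u1 al0 gu) h).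
  - exact: (gsol_le P be al v v1 u u1 be0 al0 gv gu (nn be v v1 be0 gv) h).
rewrite -e in vs; have [] := psol_unique P r al u u1 v v1 al0 (us r) (vs r) r => //.
by rewrite r0 lexx.
Qed.

(** * Choice of the perturbation threshold *)

Section SmallPerturbation.
Context {R : realType} (c : coefs R).
Local Notation n := (cn R c).
Local Notation A0 := (cA R c).
Local Notation gder := (gder c).

(** All that the conclusion needs: the coefficients of the perturbed problem and the sign of its
    energies. The radius beyond which H increases stays hidden. *)
Definition solvable (d : R) := exists P : problem R,
  [/\ pn R P = n, forall r, pQ R P r = cV R c r + d * ca R c r,
      forall r, pK R P r = 1 + d * cb R c r & nonneg_energy P].

Let A00 : 0 <= A0.
Proof. by apply: le_trans (normr_ge0 _) (ca_le R c 1 ltr01). Qed.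

Lemma adm_small : exists2 d1, 0 < d1 & forall d, 0 <= d <= d1 -> adm c d.
Proof.
have B0 : 0 <= cB R c.
  by have /andP[] := cb_itv R c 1 ltr01; exact: le_trans.
exists ((cB R c + 1)^-1); first by rewrite invr_gt0; lra.
move=> d /andP[d0 d1]; have h : d * (cB R c + 1) <= 1.
  by rewrite -ler_pdivlMr ?div1r//; lra.
by split => //; nra.
Qed.

(** Three zones: near 0 the exact formula, in which d n / r helps and d a' is absorbed by g0; a
    compact middle zone, where G' has a positive minimum and the perturbation is of size d; and the
    outer zone, where H' = G'. *)
Theorem solvable_increasing (g0 r1 : R) : 0 < g0 -> 0 < r1 -> (forall r, 0 < r -> 0 < gder r) ->
  (forall r, 0 < r < r1 -> g0 <= gder r) ->
  exists2 d0, 0 < d0 & forall d, 0 <= d <= d0 -> solvable d.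
Proof.
move=> g00 r10 gpos gnear; have [d1 d10 had] := adm_small; have A00' := A00.
have rho0 := crho_gt0 R c.
pose x1 := Num.min r1 (crho R c) / 2.
have m0 : 0 < Num.min r1 (crho R c) by rewrite lt_min r10.
have x10 : 0 < x1 by rewrite /x1; lra.
have x1r : x1 < r1 by have : Num.min r1 (crho R c) <= r1 by [rewrite ge_min lexx]; rewrite /x1; lra.
have x1rho : x1 < crho R c.
  by have : Num.min r1 (crho R c) <= crho R c by [rewrite ge_min lexx orbT]; rewrite /x1; lra.
have [gm gm0 hgm] : exists2 g, 0 < g & forall r, x1 <= r <= cfar R c -> g <= gder r.
  apply: continuous_lower_bound => r /andP[rx _]; last by apply: gpos; exact: lt_le_trans rx.
  by apply: gder_cont; exact: lt_le_trans rx.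
have [C C0 hC] := phi'_close c x1 (cfar R c) x10.
exists (Num.min d1 (Num.min (g0 / (2 * (A0 + 1))) (gm / (2 * C)))).
  by rewrite !lt_min d10 !divr_gt0// !mulr_gt0//; lra.
move=> d /andP[dge]; rewrite !le_min => /andP[dd1 /andP[]].
rewrite ler_pdivlMr; last by rewrite mulr_gt0//; lra.
rewrite ler_pdivlMr; last by rewrite mulr_gt0.
move=> dg dC; have ad : adm c d by apply: had; rewrite dge.
have pos r : 0 < r -> 0 < phi' c d r.
  move=> r0; case: (ltP r x1) => rx.
    have e := phi'_near0 c d r ad ltac:(by rewrite r0 (lt_trans rx)).
    have := gnear r ltac:(by rewrite r0 (lt_trans rx)).
    have := ca'_le R c r r0; rewrite ler_norml => /andP[h1 _] h2.
    have nr : 0 <= n%:R / r by rewrite divr_ge0// ltW.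
    have h3 : d * - A0 <= d * (ca' R c r + n%:R / r) by rewrite ler_wpM2l//; lra.
    have : 0 < (1 + d) * phi' c d r by rewrite e; lra.
    by rewrite pmulr_rgt0//; lra.
  case: (leP r (cfar R c)) => rf; last by rewrite (phi'_far c d r (ltW rf)) gpos.
  have := hC d r ad ltac:(by rewrite rx); have := hgm r ltac:(by rewrite rx).
  by rewrite ler_norml => h1 /andP[h2 _]; lra.
have pos1 r : 1 <= r -> 0 < phi' c d r by move=> h; apply: pos; lra.
exists (perturbed c d 1 ad ltr01 pos1); split => //.
by apply: increasing_nonneg_energy => r; exact: pos.
Qed.

Ltac lx := match goal with
  | xx : _ /\ _ /\ _ /\ _ /\ _ /\ _ /\ _, yx : is_true (_ <= _ <= _) |- _ => clear -xx yx; case: xx => ? [? [? [? [? [? ?]]]]]; lra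
  | xx : _ /\ _ /\ _ /\ _ /\ _ /\ _ /\ _ |- _ => clear -xx; case: xx => ? [? [? [? [? [? ?]]]]]; lra
  end.

(** After perturbation the sign of H' is known except within ep of r0. A negative energy there is
    carried by [flow_middle], directly or after reflection, over a length 4 q to a point where the
    energy is known to be nonnegative. The constants are fixed in the order h, q, c0, ep and only
    then d, so ep has to be uniform in d and in the solution. *)
Theorem solvable_decreasing_increasing (g0 r1 r0 : R) : (2 < n)%N -> 0 < g0 -> 0 < r1 -> 0 < r0 ->
  (forall r, 0 < r < r1 -> r ^+ 3 * gder r <= - g0) ->
  (forall r, 0 < r < r0 -> gder r < 0) -> (forall r, r0 < r -> 0 < gder r) ->
  exists2 d0, 0 < d0 & forall d, 0 <= d <= d0 -> solvable d.
Proof.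
move=> n3 g00 r10 r00 gnear gneg gpos; have [d1 d10 had] := adm_small.
have A00' := A00; have rho0 := crho_gt0 R c; have far0 := cfar_gt0 R c.
have gc r : 0 < r -> {for r, continuous gder} by exact: gder_cont.
have gNc r : 0 < r -> {for r, continuous (fun r => - gder r)} by move=> /gc h; exact: contN.
have [w w0 w2] : exists2 w, 0 < w & w + w = r0 by exists (r0 / 2); lra.
have [h h0 hb] : exists2 h, 0 < h & forall d x, adm c d -> w <= x <= r0 + r0 -> `|phi c d x| <= h.
  have [h hh] := phi_bounded c w (r0 + r0) w0.
  by exists (Num.max h 1) => [|d x ad xr]; rewrite ?lt_max ?ltr01 ?orbT// le_max hh.
have [C1 C10 h'b] : exists2 C1, 0 < C1 & forall d x, adm c d -> w <= x <= r0 + r0 ->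
    - C1 <= phi' c d x <= C1.
  have [h' hh] := phi'_bounded c w (r0 + r0) w0.
  by exists (Num.max h' 1) => [|d x ad xr]; rewrite ?lt_max ?ltr01 ?orbT// -ler_norml le_max hh.
have [L0 /andP[L00 L01] mid] := flow_middle h h0.
(* The window has length 4 q <= L0, and 6 q <= r0 / 2 keeps it inside [r0 / 2, 2 r0] on either side
   of r0. *)
have [q q0 [qL0 qr0]] : exists2 q, 0 < q & q + q + q + q <= L0 /\ q + q + q + q + q + q <= w.
  exists (Num.min L0 w / 6); first by rewrite divr_gt0// lt_min L00.
  have h1 : Num.min L0 w <= L0 by rewrite ge_min lexx.
  have h2 : Num.min L0 w <= w by rewrite ge_min lexx orbT.
  by have h3 : 0 < Num.min L0 w by [rewrite lt_min L00]; clear -h1 h2 h3; split; lra.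
have [ca ca0 hca] : exists2 g, 0 < g & forall r, r0 + q <= r <= r0 + r0 -> g <= gder r.
  apply: continuous_lower_bound => r rr; first by apply: gc; case/andP: rr => rr _; clear -rr r00 q0; lra.
  by apply: gpos; case/andP: rr => rr _; clear -rr q0; lra.
have [cb cb0 hcb] : exists2 g, 0 < g & forall r, w <= r <= r0 - q -> g <= - gder r.
  apply: continuous_lower_bound => r rr; first by apply: gNc; slra.
  by rewrite oppr_gt0; apply: gneg; slra.
have [c0 c00 [c0a c0b]] : exists2 c0, 0 < c0 & c0 + c0 <= ca /\ c0 + c0 <= cb.
  exists (Num.min ca cb / 2); first by rewrite divr_gt0// lt_min ca0.
  have h1 : Num.min ca cb <= ca by rewrite ge_min lexx.
  have h2 : Num.min ca cb <= cb by rewrite ge_min lexx orbT.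
  by clear -h1 h2; split; lra.
(* For x within ep of r0, the point x + 2 ep is beyond the uncertain zone, and ep <= q puts x + 2 q
   beyond r0 + q, where G' >= 2 c0. *)
have [ep ep0 [epq {}mid]] : exists2 ep, 0 < ep & ep <= q /\
    forall k H (H' : R -> R) t p x, flow x (x + (q + q + q + q)) k H t p ->
    (forall r, x <= r <= x + (q + q + q + q) -> 1 <= k r <= 2) ->
    (forall r, x <= r <= x + (q + q + q + q) -> `|H r| <= h) ->
    (forall r, x <= r <= x + (q + q + q + q) -> has_der H r (H' r)) ->
    (forall r, x <= r <= x + (ep + ep) -> - C1 <= H' r) ->
    (forall r, x + (ep + ep) <= r <= x + (q + q + q + q) -> 0 <= H' r) ->
    (forall r, x + (q + q) <= r <= x + (q + q + q + q) -> c0 <= H' r) ->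
    0 <= p x -> energy H t p x < 0 -> energy H t p (x + (q + q + q + q)) < 0.
  have [e e0 h1] := mid (q + q + q + q) c0 C1 ltac:(by rewrite qL0 !addr_gt0) c00 C10.
  exists (Num.min e q); first by rewrite lt_min e0.
  split; first by rewrite ge_min lexx orbT.
  move=> k H H' t p x fl hk hH hd h2 h3 h4; apply: (h1 (Num.min e q) k H H' t p x _ fl hk hH hd).
  - by rewrite lt_min e0 q0 ge_min lexx.
  - by move=> r; rewrite mulr_natl mulr2n; exact: h2.
  - by move=> r; rewrite mulr_natl mulr2n; exact: h3.
  - by move=> r; have -> : (q + q + q + q) / 2 = q + q by [field]; exact: h4.
have [x1 x10 [x1r x1rho x11]] : exists2 x1, 0 < x1 & [/\ x1 < r1, x1 < crho R c & x1 <= 1].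
  exists (Num.min (Num.min r1 (crho R c)) 1 / 2); first by rewrite divr_gt0// !lt_min r10 rho0 ltr01.
  have m0 : 0 < Num.min (Num.min r1 (crho R c)) 1 by rewrite !lt_min r10 rho0 ltr01.
  have m1 : Num.min (Num.min r1 (crho R c)) 1 <= r1 by rewrite !ge_min lexx.
  have m2 : Num.min (Num.min r1 (crho R c)) 1 <= crho R c by rewrite !ge_min lexx orbT.
  have m3 : Num.min (Num.min r1 (crho R c)) 1 <= 1 by rewrite !ge_min lexx orbT.
  by clear -m0 m1 m2 m3 r10 rho0; split; lra.
have [ga ga0 hga] : exists2 g, 0 < g & forall r, x1 <= r <= r0 - ep -> g <= - gder r.
  apply: continuous_lower_bound => r rr; first by apply: gNc; slra.
  by rewrite oppr_gt0; apply: gneg; slra.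
have [gb gb0 hgb] : exists2 g, 0 < g & forall r, r0 + ep <= r <= cfar R c -> g <= gder r.
  by apply: continuous_lower_bound => r rr; [apply: gc|apply: gpos]; slra.
have [lo lo0 [lo1 lo2]] : exists2 lo, 0 < lo & lo <= x1 /\ lo <= w.
  by exists (Num.min x1 w); rewrite ?lt_min ?x10// !ge_min !lexx orbT.
have [hi [hi1 hi2]] : exists hi, cfar R c <= hi /\ r0 + r0 <= hi.
  by exists (Num.max (cfar R c) (r0 + r0)); rewrite !le_max !lexx orbT.
have [C C0 hC] := phi'_close c lo hi lo0.
pose N1 := A0 + n%:R + 1; have N10 : 0 < N1 by rewrite /N1 -addrA ltr_wpDl.
exists (Num.min (Num.min d1 (g0 / (2 * N1))) (Num.min (Num.min (ga / (2 * C)) (gb / (2 * C))) (c0 / C))).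
  by rewrite !lt_min d10 !divr_gt0// !mulr_gt0.
move=> d /andP[dge]; rewrite !le_min => /andP[/andP[dd1 dg] /andP[/andP[da db] dc]].
rewrite ler_pdivlMr ?mulr_gt0// in dg; rewrite ler_pdivlMr ?mulr_gt0// in da.
rewrite ler_pdivlMr ?mulr_gt0// in db; rewrite ler_pdivlMr// in dc.
have ad : adm c d by apply: had; rewrite dge.
have {hC da db dc}[z [close za zb zc]] : exists z,
    [/\ forall r, lo <= r <= hi -> gder r - z <= phi' c d r <= gder r + z, z + z <= ga, z + z <= gb & z <= c0].
  have e2 : d * (2 * C) = d * C + d * C by ring.
  exists (d * C); rewrite -!e2; split => // r rr; have := hC d r ad rr.
  by rewrite ler_distl => /andP[u v]; apply/andP; clear -u v; split; lra.
(* Multiplied by r^3 the exact formula near 0 has leading term r^3 G' <= - g0, and the correction d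
   (r^3 a' + n r^2) is at most d N1 because r <= 1. *)
have neg_near r : 0 < r -> r < x1 -> phi' c d r < 0.
  move=> rp rx; have eq1 := phi'_near0 c d r ad ltac:(by rewrite rp (lt_trans rx)).
  have := gnear r ltac:(by rewrite rp (lt_trans rx)).
  have r3 : 0 < r ^+ 3 by rewrite exprn_gt0.
  have := ca'_le R c r rp; rewrite ler_norml => /andP[_ h1] h2.
  have : (1 + d) * r ^+ 3 * phi' c d r = r ^+ 3 * gder r + d * (r ^+ 3 * ca' R c r + n%:R * r ^+ 2).
    transitivity (r ^+ 3 * ((1 + d) * phi' c d r)); first by ring.
    by rewrite eq1; field; exact: lt0r_neq0.
  have rl1 : r <= 1 by apply: ltW; apply: lt_le_trans x11.
  have r31 : r ^+ 3 <= 1 by rewrite exprn_ile1// ltW.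
  have r21 : r ^+ 2 <= 1 by rewrite exprn_ile1// ltW.
  have k1 : r ^+ 3 * ca' R c r <= A0.
    apply: (@le_trans _ _ (r ^+ 3 * A0)); first by rewrite ler_pM2l.
    by rewrite ler_piMl.
  have k2 : n%:R * r ^+ 2 <= n%:R by rewrite ler_piMr.
  have k4 : d * (r ^+ 3 * ca' R c r + n%:R * r ^+ 2) <= d * N1.
    by rewrite ler_wpM2l// /N1; clear -k1 k2; lra.
  have p0 : 0 < (1 + d) * r ^+ 3 by rewrite mulr_gt0// ltr_wpDr.
  by move=> k3; rewrite -(pmulr_rlt0 _ p0) k3; clear -h2 k4 dg g00; lra.
have neg r : 0 < r -> r <= r0 - ep -> phi' c d r < 0.
  move=> rp rr; case: (ltP r x1) => rx; first exact: neg_near.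
  have rr0 : r <= r0 + r0 by apply: le_trans rr _; clear -ep0 r00; lra.
  have /andP[_] := close r ltac:(by rewrite (le_trans lo1 rx) (le_trans rr0)).
  by have := hga r ltac:(by rewrite rx); clear -za ga0; lra.
have pos r : r0 + ep <= r -> 0 < phi' c d r.
  move=> rr; case: (leP r (cfar R c)) => rf.
    have rw : w <= r by apply: le_trans rr; clear -ep0 w0 w2; lra.
    have /andP[] := close r ltac:(by rewrite (le_trans lo2 rw) (le_trans rf)).
    by have := hgb r ltac:(by rewrite rr); clear -zb gb0; lra.
  by rewrite (phi'_far c d r (ltW rf)); apply: gpos; clear -rr ep0; lra.
have rb0 : 0 < r0 + ep by rewrite addr_gt0.
pose P := perturbed c d (r0 + ep) ad rb0 pos.
exists P; split => // al u u1 al0 gu.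
have [us _] := gu; have [far _] := gsol_energy P al u u1 al0 gu.
pose E := energy (pH R P) (slog P u) (sslope P u u1).
have {}far x : r0 + ep <= x -> 0 <= E x by exact: far.
have near x : 0 < x -> x <= r0 - ep -> 0 <= E x.
  move=> x0 xr; apply: (energy_ge0_near0 P x al u u1 x n3 al0 (us x)); rewrite ?x0 ?lexx//.
  by move=> y /andP[y0 yx]; apply/ltW/neg => //; apply: le_trans xr.
have kb x : 0 < x -> 1 <= Num.sqrt (pK R P x) <= 2 by exact: sqrtK_itv.
have hd x : 0 < x -> has_der (phi c d) x (phi' c d x) by exact: phi_der.
have {}hb x := hb d x ad; have {}h'b x := h'b d x ad.
move=> x x0; rewrite -/(E x).
case: (lerP x (r0 - ep)) => xl; first exact: near.
case: (lerP (r0 + ep) x) => xr; first exact: far.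
rewrite leNgt; apply/negP => Ex.
have xx : r0 - ep < x /\ x < r0 + ep /\ ep <= q /\ q + q + q + q + q + q <= w /\ w + w = r0 /\ 0 < q /\ 0 < ep.
  by do !split.
have lw y : w <= y -> lo <= y by apply: le_trans.
have lh y : y <= r0 + r0 -> y <= hi by move=> /le_trans; apply.
case: (lerP 0 (sslope P u u1 x)) => px.
  have fl := psol_flow P (x + (q + q + q + q)) al u u1 x x0 (us _).
  have := far (x + (q + q + q + q)) ltac:(lx); rewrite leNgt => /negP; apply.
  apply: (mid (fun r => Num.sqrt (pK R P r)) (phi c d) (phi' c d) (slog P u) (sslope P u u1) x fl).
  - by move=> y yx; apply: kb; lx.
  - by move=> y yx; apply: hb; lx.
  - by move=> y yx; apply: hd; lx.
  - by move=> y yx; have /andP[] := h'b y ltac:(lx).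
  - by move=> y yx; apply/ltW/pos; lx.
  - move=> y yx; have /andP[] := close y ltac:(apply/andP; split; [apply: lw|apply: lh]; lx).
    by have := hca y ltac:(lx); clear -zc c0a c00; lra.
  - exact: px.
  - exact: Ex.
(* Here p < 0: reflected at x, the flow runs to the left, where - H' is eventually positive. *)
have xL : 0 < x - (q + q + q + q) by lx.
have fl := psol_flow P x al u u1 (x - (q + q + q + q)) xL (us x).
have := flow_reflect (x - (q + q + q + q)) x x _ _ _ _ fl.
have -> : 2 * x - x = x by ring.
have -> : 2 * x - (x - (q + q + q + q)) = x + (q + q + q + q) by ring.
move=> {}fl.
have er s : energy (fun r => phi c d (2 * x - r)) (fun r => slog P u (2 * x - r))
    (fun r => - sslope P u u1 (2 * x - r)) s = E (2 * x - s).
  by rewrite /energy sqrrN.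
have := near (x - (q + q + q + q)) ltac:(lx) ltac:(lx); rewrite leNgt => /negP; apply.
have -> : x - (q + q + q + q) = 2 * x - (x + (q + q + q + q)) by ring.
rewrite -er.
apply: (mid (fun r => Num.sqrt (pK R P (2 * x - r))) (fun r => phi c d (2 * x - r))
  (fun r => - phi' c d (2 * x - r)) _ _ _ fl).
- by move=> y yx; apply: kb; lx.
- by move=> y yx; apply: hb; lx.
- move=> y yx; have hy := hd (2 * x - y) ltac:(lx).
  apply: has_der_eq (has_der_comp _ (fun r => 2 * x - r) y (phi' c d (2 * x - y)) (- 1) _ hy) _; last by ring.
  by der; ring.
- by move=> y yx; rewrite lerN2; have /andP[] := h'b (2 * x - y) ltac:(lx).
- by move=> y yx; rewrite oppr_ge0; apply/ltW/neg; lx.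
- move=> y yx; have /andP[] := close (2 * x - y) ltac:(apply/andP; split; [apply: lw|apply: lh]; lx).
  by have := hcb (2 * x - y) ltac:(lx); clear -zc c0b c00; lra.
- have -> : 2 * x - x = x by ring.
  by rewrite oppr_ge0 ltW.
- by rewrite er; have -> : 2 * x - x = x by ring.
Qed.
End SmallPerturbation.

(** * Local integrability *)

Section Shells.
Context {R : realType}.

Definition normsq {k : nat} (t : k.-tuple (measurableTypeR R)) : R :=
  \sum_(i < k) (tnth t i : R) ^+ 2.

Lemma measurable_normsq k : measurable_fun setT (@normsq k : _ -> measurableTypeR R).
Proof.
apply: measurable_sum => i; apply: (measurable_funX 2).
exact: measurable_tnth.
Qed.

Lemma normsq_tcons k (z : R * k.-tuple (measurableTypeR R)) :
  normsq (tcons z) = z.1 ^+ 2 + normsq z.2.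
Proof.
rewrite /normsq big_ord_recl; congr (_ + _).
by apply: eq_bigr => i _; rewrite tnthS.
Qed.

Lemma normsq_ge0 k (t : k.-tuple (measurableTypeR R)) : 0 <= normsq t.
Proof. by apply: sumr_ge0 => i _; exact: sqr_ge0. Qed.

(** Half-open, so that adjacent shells are disjoint and integrals over them add up; stated with
    squared norms, which are measurable as polynomials. *)
Definition shell k (s t : R) : set (k.-tuple (measurableTypeR R)) :=
  normsq @^-1` `]s ^+ 2, t ^+ 2].

Lemma measurable_shell k s t : measurable (shell k s t).
Proof.
rewrite /shell -[X in measurable X]setTI; apply: measurable_normsq => //.
Qed.

Lemma shellU k (s t u : R) : 0 <= s -> s <= t -> t <= u ->
  shell k s u = shell k s t `|` shell k t u.
Proof.
move=> s0 st tu; apply/seteqP; split => x; rewrite /shell /= !in_itv /=.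
  move=> /andP[h1 h2]; case: (leP (normsq x) (t ^+ 2)) => h; [left|right].
    by rewrite h1.
  by rewrite h2.
move=> [|] /andP[h1 h2].
  rewrite h1 /= (le_trans h2)// lerXn2r// nnegrE; lra.
rewrite h2 andbT (le_lt_trans _ h1)// lerXn2r// nnegrE; lra.
Qed.

Lemma shell_disj k (s t u : R) : [disjoint shell k s t & shell k t u].
Proof.
apply/disj_setPS => x []; rewrite /shell /= !in_itv /= => /andP[_ h1] /andP[h2 _].
by move: (lt_le_trans h2 h1); rewrite ltxx.
Qed.

Definition cube k (w : R) : set (k.-tuple (measurableTypeR R)) :=
  [set y | forall i, `[0, w]%classic (tnth y i)].

Lemma measurable_cube k w : measurable (cube k w).
Proof.
rewrite /cube (_ : mkset _ = \bigcap_i ((@tnth k _ ^~ i) @^-1` `[0, w]%classic)).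
  apply: fin_bigcap_measurable => // i _.
  rewrite -[X in measurable X]setTI; apply: measurable_tnth => //.
by apply/seteqP; split => t /= At i; [move=> _|]; exact: At.
Qed.

Lemma cube_measure k (w : R) : 0 <= w -> (lebesgue k (cube k w) = (w ^+ k)%:E)%E.
Proof.
move=> w0; have h := @product_powerE _ _ R (@lebesgue_measure R) k (fun=> `[0, w]%classic).
apply: (etrans (h _)) => //; rewrite {h}.
rewrite (eq_bigr (fun=> w%:E)); last first.
  move=> i _; apply: (etrans (@lebesgue_measure_itv R `[0, w])) => /=; rewrite lte_fin.
  move: w0; rewrite le_eqVlt => /orP[/eqP<-|->]; first by rewrite ltxx.
  by rewrite oppr0 adde0.
by rewrite -(big_morph EFin EFinM erefl) prodr_const card_ord.
Qed.

Lemma cube_normsq k w y : 0 <= w -> cube k w y -> normsq y <= k%:R * w ^+ 2.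
Proof.
move=> w0 h; rewrite /normsq; apply: (@le_trans _ _ (\sum_(i < k) w ^+ 2)).
  apply: ler_sum => i _; have := h i; rewrite /= in_itv /= => /andP[h1 h2].
  by rewrite lerXn2r// nnegrE.
by rewrite sumr_const card_ord mulr_natl.
Qed.

(* Slicing along the first coordinate: over each point y of a small cube, the
   shell contains an interval of length at least t - s. *)
Lemma shell_measure k (s t : R) : 0 < s -> s < t ->
  (((t - s) * (s / k.+1%:R) ^+ k)%:E <= lebesgue k.+1 (shell k.+1 s t))%E.
Proof.
(* With this side, |y|^2 <= k w^2 < s^2 on the cube, so each slice meets both spheres. *)
move=> s0 st; pose w := s / k.+1%:R.
have w0 : 0 <= w by rewrite divr_ge0// ltW.
pose m := @lebesgue_measure R; pose mu := @lebesgue R k.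
pose A := tcons @^-1` shell k.+1 s t : set (measurableTypeR R * _).
have mA : measurable A.
  rewrite /A -[X in measurable X]setTI; apply: measurable_tcons => //.
  exact: measurable_shell.
have -> : lebesgue k.+1 (shell k.+1 s t) = (m \x^ mu)%E A.
  transitivity ((m \x mu)%E A) => //.
  apply: product_measure_unique => // B1 B2 mB1 mB2.
  exact: product_measure2E.
rewrite EFinM -(cube_measure _ _ w0) -/mu.
have mc := measurable_cube k w.
rewrite -(integral_cst mu mc) /product_measure2.
apply: (@le_trans _ _ (\int[mu]_(y in cube k w) (m \o ysection A) y)%E); last first.
  apply: ge0_subset_integral => //; exact: measurable_fun_ysection.
apply: ge0_le_integral => //.
- by move=> y _; rewrite lee_fin subr_ge0 ltW.
- by apply: (measurable_funS measurableT) => //; exact: measurable_fun_ysection.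
move=> y cy; have ny := cube_normsq _ _ _ w0 cy; have y0 := normsq_ge0 _ y.
have ys : normsq y < s ^+ 2.
  apply: le_lt_trans ny _; rewrite /w expr_div_n mulrA ltr_pdivrMr ?exprn_gt0//.
  rewrite mulrC ltr_pM2l ?exprn_gt0// -natrX ltr_nat.
  exact: (leq_pmulr k.+1 (ltn0Sn k)).
rewrite /=; set a := Num.sqrt (s ^+ 2 - normsq y); set b := Num.sqrt (t ^+ 2 - normsq y).
have a2 : a ^+ 2 = s ^+ 2 - normsq y by rewrite sqr_sqrtr// subr_ge0 ltW.
have t2 : s ^+ 2 < t ^+ 2 by rewrite ltr_pXn2r// nnegrE; lra.
have b2 : b ^+ 2 = t ^+ 2 - normsq y by rewrite sqr_sqrtr//; lra.
have a0 : 0 <= a by exact: sqrtr_ge0.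
have b0 : 0 <= b by exact: sqrtr_ge0.
(* The products (b - a) (b + a) and (t - s) (t + s) are equal, while a <= s and b <= t. *)
have ab : t - s <= b - a.
  have as_ : a <= s by rewrite -(ler_pXn2r (_ : (0 < 2)%N)) ?nnegrE//; lra.
  have bt : b <= t by rewrite -(ler_pXn2r (_ : (0 < 2)%N)) ?nnegrE//; lra.
  have : (b - a) * (b + a) = (t - s) * (t + s) by rewrite -!subr_sqr a2 b2; ring.
  nra.
apply: (@le_trans _ _ (m `]a, b]%classic)).
  by rewrite /m lebesgue_measure_itv /= lte_fin ifT ?lee_fin//; lra.
apply: le_measure; rewrite ?inE//; first exact: measurable_ysection.
move=> x /=; rewrite in_itv /= => /andP[ax xb].
apply/mem_set; rewrite /A /shell /= normsq_tcons /= in_itv /=.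
have : a ^+ 2 < x ^+ 2 by rewrite ltr_pXn2r// nnegrE; lra.
have : x ^+ 2 <= b ^+ 2 by rewrite ler_pXn2r// nnegrE; lra.
by rewrite a2 b2 => h1 h2; apply/andP; split; lra.
Qed.
End Shells.

Section SuperAdditive.
Context {R : realType}.

(* If an additive interval function dominates g locally, it dominates the
   increments of any primitive of g. *)
Lemma additive_dominates (D : R -> R -> R) (G g : R -> R) (a b : R) : a <= b ->
  (forall t, a <= t <= b -> has_der G t (g t)) ->
  (forall s t, a <= s -> s <= t -> t <= b -> D a t = D a s + D s t) ->
  D a a = 0 ->
  (forall x e, a <= x <= b -> 0 < e -> exists2 d, 0 < d & forall s t,
     a <= s <= x -> x <= t <= b -> x - d < s -> t < x + d -> s < t -> (t - s) * (g x - e) <= D s t) ->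
  G b - G a <= D a b.
Proof.
move=> ab hG Dadd Daa Dloc.
suff key e : 0 < e -> G b - G a <= D a b + e * (b - a).
  apply/ler_addgt0Pr => e e0.
  have [|h] := leP b a.
    move=> ba; have : G b - G a <= D a b + 1 * (b - a) by exact: key.
    slra.
  have := key (e / (b - a)); rewrite divfK ?subr_eq0 ?gt_eqF//; apply.
  by rewrite divr_gt0// subr_gt0.
move=> e0.
pose ok t := a <= t <= b /\ G t - G a <= D a t + e * (t - a).
have oka : ok a by split; [rewrite lexx|rewrite Daa !subrr mulr0 addr0].
have step x : a <= x <= b -> exists2 d, 0 < d & forall s t,
    a <= s <= x -> x <= t <= b -> x - d < s -> t < x + d -> s < t ->
    G t - G s <= D s t + e * (t - s).
  move=> xab; have e3 : 0 < e / 2 by slra.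
  have [d1 d10 h1] := Dloc x (e / 2) xab e3.
  have [hd hv] := hG x xab.
  have : (fun h => h^-1 *: (G (h *: 1 + x) - G x)) @ 0^' --> g x by rewrite -hv; exact: hd.
  move=> /cvgrPdist_lt /(_ _ e3) /nbhs_ballP[d2 /= d20 h2].
  have diff y : `|y - x| < d2 -> `|G y - G x - g x * (y - x)| <= e / 2 * `|y - x|.
    move=> yx; have [->|ny] := eqVneq y x; first by rewrite !subrr mulr0 subrr normr0 mulr0.
    have n0 : y - x != 0 by rewrite subr_eq0.
    have := h2 (y - x); rewrite /ball /= sub0r normrN => /(_ yx n0).
    rewrite /GRing.scale /= mulr1 subrK => /ltW.
    have yx0 : 0 < `|y - x| by rewrite normr_gt0.
    rewrite -(ler_pM2r yx0) -normrM mulrBl mulrAC mulVf// mul1r distrC.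
    by [].
  exists (Num.min d1 d2); first by rewrite lt_min d10.
  move=> s t sx xt; rewrite ltrBlDr => q1 q2 st.
  have m1 : Num.min d1 d2 <= d1 by rewrite ge_min lexx.
  have m2 : Num.min d1 d2 <= d2 by rewrite ge_min lexx orbT.
  have := h1 s t sx xt ltac:(slra) ltac:(slra) st.
  have : `|s - x| < d2 by rewrite ler0_norm; slra.
  move=> /diff; rewrite (@ler0_norm _ (s - x)); last by slra.
  have : `|t - x| < d2 by rewrite ger0_norm; slra.
  move=> /diff; rewrite (@ger0_norm _ (t - x)); last by slra.
  rewrite !ler_norml => /andP[_ u1] /andP[u2 _] u3.
  slra.
pose S := [set t | ok t].
have hs : has_sup S by split; [exists a|exists b => t [/andP[]]].
pose x := sup S.
have ax : a <= x by apply: ub_le_sup => //; case: hs.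
have xb : x <= b by apply: ge_sup; [exists a|move=> t [/andP[]]].
have xab : a <= x <= b by rewrite ax.
have [d d0 hd] := step x xab.
have okx : ok x.
  have [s [sab sok] sx] := sup_adherent d0 hs.
  have sx' : s <= x by apply: ub_le_sup; [case: hs|].
  move: sx'; rewrite le_eqVlt => /orP[/eqP<-//|sx'].
  split=> //; have := hd s x ltac:(slra) ltac:(slra) sx ltac:(slra) sx'.
  by rewrite (Dadd s x); slra.
move: xb; rewrite le_eqVlt => /orP[/eqP xb|xb].
  by have [_] := okx; rewrite xb.
have [y [/andP[y0 yd] /andP[_ yb]]] := small_between _ _ d0 (ltac:(slra) : 0 < b - x).
have : x + y <= x.
  apply: ub_le_sup; first by case: hs.
  split; first by slra.
  have [_ ox] := okx.
  have := hd x (x + y) ltac:(by rewrite ax lexx) ltac:(slra) ltac:(clear -d0; lra) ltac:(clear -yd; lra) ltac:(clear -y0; lra).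
  by rewrite (Dadd x (x + y)); slra.
slra.
Qed.

(** Either x^(q-1) r^n >= 1, and the first term dominates x, or x is below r^(-n/(q-1)), the second
    term. *)
Lemma young_power (x r n q : R) : 0 <= x -> 0 < r -> 1 < q ->
  x <= x `^ q * expR (n * ln r) + expR (- (n / (q - 1)) * ln r).
Proof.
move=> x0 r0 q1; move: x0; rewrite le_eqVlt => /orP[/eqP<-|x0].
  by rewrite addr_ge0 ?mulr_ge0 ?powR_ge0 ?expR_ge0.
have xq : x `^ q = expR (q * ln x) by rewrite /powR gt_eqF.
rewrite xq -expRD.
have [h|h] := leP 0 ((q - 1) * ln x + n * ln r).
  apply: (@le_trans _ _ (expR (q * ln x + n * ln r))); last by rewrite lerDl expR_ge0.
  by rewrite -{1}[x]lnK ?posrE// ler_expR; slra.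
apply: (@le_trans _ _ (expR (- (n / (q - 1)) * ln r))); last by rewrite lerDr expR_ge0.
rewrite -{1}[x]lnK ?posrE// ler_expR -(ler_pM2l (_ : 0 < q - 1)); last by slra.
have -> : (q - 1) * (- (n / (q - 1)) * ln r) = - (n * ln r).
  by field; rewrite subr_eq0 gt_eqF.
slra.
Qed.
End SuperAdditive.

Lemma half_error {R : realType} (v h w z k : R) :
  v - w / 2 <= z -> k < h + w / 2 -> v - h - w <= z - k.
Proof. by lra. Qed.

Section LqToL1.
Context {R : realType} (k : nat) (q : R) (V : R -> R).
Hypothesis q1 : k.+1%:R < q.
Hypothesis cV : forall r : R, 0 < r -> {for r, continuous V}.
Hypothesis VLq : Lq_loc q (radial k.+1 V).

Let K : set 'rV[R]_k.+1 := [set v | forall i, `[-1, 1]%classic (v ord0 i)].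
Let f : k.+1.-tuple (measurableTypeR R) -> R := (radial k.+1 V \_ K) \o @row_of_tuple R k.+1.
Let g (x : k.+1.-tuple (measurableTypeR R)) : \bar R := (`|(f x)%:E| `^ q)%E.
Let nu := @lebesgue R k.+1.

Let q0 : 0 < q.
Proof. by apply: lt_trans q1; rewrite ltr0n. Qed.

Let compactK : compact K.
Proof. exact: (@rV_compact R k.+1 (fun=> `[-1, 1]%classic) (fun=> @segment_compact R _ _)). Qed.

Let mf : measurable_fun setT f.
Proof. by have := VLq K compactK; rewrite inE => /andP[]; rewrite inE. Qed.

Let mg : measurable_fun setT g.
Proof.
apply: (@measurableT_comp _ _ _ _ _ _ (fun x : \bar R => (x `^ q)%E)); first exact: measurable_poweR.
apply: measurableT_comp => //; exact/measurable_EFinP.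
Qed.

Let g0 x : (0 <= g x)%E. Proof. exact: poweR_ge0. Qed.

Let g_fin : (\int[nu]_x g x < +oo)%E.
Proof.
have := VLq K compactK; rewrite inE => /andP[_]; rewrite inE /finite_norm unlock => /=.
apply: lty_poweRy; rewrite invr_eq0 gt_eqF//.
Qed.

Let D s t := fine (\int[nu]_(x in shell k.+1 s t) g x)%E.

Let int_fin A : measurable A -> ((\int[nu]_(x in A) g x)%E \is a fin_num).
Proof.
move=> mA; rewrite ge0_fin_numE; last exact: integral_ge0.
apply: le_lt_trans g_fin; apply: ge0_subset_integral => //.
Qed.

Let Dadd s t u : 0 <= s -> s <= t -> t <= u -> D s u = D s t + D t u.
Proof.
move=> s0 st tu; have ms := @measurable_shell R k.+1.
rewrite /D (shellU _ s t u)// ge0_integral_setU//.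
- by rewrite fineD// int_fin.
- by apply: measurable_funTS.
- exact: shell_disj.
Qed.

Let D_le s t : D s t <= fine (\int[nu]_x g x)%E.
Proof.
have ms := @measurable_shell R k.+1.
apply: fine_le; [exact: int_fin|exact: int_fin measurableT|].
apply: ge0_subset_integral => //.
Qed.

(** The condition t <= 1 puts the shell inside the compact cube K on which the integrability of V is
    tested. *)
Let D_lower s t z : 0 < s -> s < t -> t <= 1 -> 0 <= z ->
  (forall r, s <= r <= t -> z <= `|V r|) ->
  z `^ q * ((t - s) * (s / k.+1%:R) ^+ k) <= D s t.
Proof.
move=> s0 st t1 z0 hz; have ms := @measurable_shell R k.+1.
rewrite -lee_fin /D fineK ?int_fin// EFinM.
apply: (@le_trans _ _ ((z `^ q)%:E * nu (shell k.+1 s t))%E).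
  by apply: lee_wpmul2l; rewrite ?lee_fin ?powR_ge0//; exact: shell_measure.
rewrite -(integral_cst nu (ms s t)); apply: ge0_le_integral.
- exact: ms.
- by move=> x _; rewrite lee_fin powR_ge0.
- exact: measurable_cst.
- exact: measurable_funTS.
move=> x; rewrite /shell /= in_itv /= => /andP[h1 h2].
have xK : K (row_of_tuple x).
  move=> i; rewrite /= in_itv /= mxE -ler_norml -(ler_pXn2r (_ : (0 < 2)%N)) ?nnegrE//.
  rewrite expr1n real_normK ?num_real//.
  apply: (@le_trans _ _ (normsq x)).
    by rewrite /normsq (bigD1 i)//= lerDl sumr_ge0// => j _; exact: sqr_ge0.
  by apply: le_trans h2 _; rewrite expr_le1//; lra.
rewrite /g /f /= patchE mem_set// /radial lee_fin.
have e : enorm (row_of_tuple x) = Num.sqrt (normsq x).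
  by rewrite /enorm /normsq; congr Num.sqrt; apply: eq_bigr => i _; rewrite mxE.
rewrite e; apply: ge0_ler_powR; rewrite ?nnegrE//; first exact: ltW.
have x2 : Num.sqrt (normsq x) ^+ 2 = normsq x by rewrite sqr_sqrtr// normsq_ge0.
apply: hz; apply/andP; split.
  by rewrite -(ler_pXn2r (_ : (0 < 2)%N)) ?nnegrE ?sqrtr_ge0 ?x2 ?ltW//.
by rewrite -(ler_pXn2r (_ : (0 < 2)%N)) ?nnegrE ?sqrtr_ge0 ?x2//; lra.
Qed.

(** The integral D over shells has density at least c r^k |V|^q, hence at least c (|V| - r^(-gam))
    with gam = k / (q - 1). As D is bounded, primitives of |V| are bounded below near 0, and being
    monotone they have a limit. *)
Theorem radial_Lq_primitive : exists M : R -> R,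
  (forall r : R, 0 < r -> has_der M r `|V r|) /\ lim0 M 0.
Proof.
have keep := KeepAbove.
have cN (r : R) : 0 < r -> {for r, continuous (fun x => `|V x|)}.
  by move=> r0; apply: continuous_comp; [exact: cV|exact: norm_continuous].
have [Pr hP] := has_primitive (fun x => `|V x|) cN.
have qk := q1; have k0 : 0 <= k%:R :> R by []. 
have qk' : k%:R + 1 < q by rewrite natr1.
pose gam := k%:R / (q - 1).
(* This is where q > N enters: it makes r^(-gam) integrable at 0. *)
have gam1 : gam < 1 by rewrite /gam ltr_pdivrMr; slra.
have gam0 : 0 <= gam by rewrite divr_ge0//; slra.
pose c := (k.+1%:R ^+ k)^-1 : R.
have c0 : 0 < c by rewrite invr_gt0 exprn_gt0// ltr0n.
pose h r := expR (- gam * ln r).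
pose Hp r := expR ((1 - gam) * ln r) / (1 - gam).
have hHp r : 0 < r -> has_der Hp r (h r).
  move=> r0; have gn : 1 - gam != 0 by rewrite gt_eqF//; slra.
  rewrite /Hp; der => //; rewrite /h.
  have -> : expR ((1 - gam) * ln r) = r * expR (- gam * ln r).
    by rewrite mulrBl mul1r expRD lnK ?posrE// mulNr.
  by field; rewrite gn gt_eqF.
pose total := fine (\int[nu]_x g x)%E.
have bound s : 0 < s <= 1 -> c * (Pr 1 - Hp 1) - c * (Pr s - Hp s) <= total.
  move=> /andP[s0 s1]; apply: le_trans (D_le s 1).
  apply: (additive_dominates D (fun r => c * (Pr r - Hp r)) (fun r => c * (`|V r| - h r)) s 1 s1).
  - move=> t ts; have t0 : 0 < t by slra.
    have h1 := hP t t0; have h2 := hHp t t0.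
    by der; ring.
  - by move=> x y sx xy y1; apply: Dadd => //; exact: ltW.
  - rewrite /D (_ : shell _ s s = set0) ?integral_set0//.
    apply/seteqP; split => // x; rewrite /shell /= in_itv /= => /andP[a b].
    by move: (lt_le_trans a b); rewrite ltxx.
  - move=> x e xs e0; have x0 : 0 < x by slra.
    have ec : 0 < e / c / 2 by rewrite !divr_gt0.
    have /continuousP_dist /(_ _ ec)[d1 d10 hd1] := cN x x0.
    have ch : {for x, continuous h} by apply: has_der_cont; rewrite /h; der => //; reflexivity.
    have /continuousP_dist /(_ _ ec)[d2 d20 hd2] := ch.
    exists (Num.min d1 d2); first by rewrite lt_min d10.
    move=> a b ax xb; rewrite ltrBlDr => q2 q3 ab.
    have m1 : Num.min d1 d2 <= d1 by rewrite ge_min lexx.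
    have m2 : Num.min d1 d2 <= d2 by rewrite ge_min lexx orbT.
    have a0 : 0 < a by slra.
    have ha : h a < h x + e / c / 2.
      have := hd2 a; rewrite ler0_norm; last by slra.
      by move=> /(_ ltac:(slra)); rewrite ltr_distl => /andP[_].
    have Vr r : a <= r <= b -> `|V x| - e / c / 2 <= `|V r|.
      move=> rab; have : `|r - x| < d1 by rewrite ltr_norml; apply/andP; split; slra.
      by move=> /hd1; rewrite ltr_distl => /andP[]; slra.
    pose z := Num.max 0 (`|V x| - e / c / 2).
    have z0 : 0 <= z by rewrite le_max lexx.
    have z1 : `|V x| - e / c / 2 <= z by rewrite le_max lexx orbT.
    have zV r : a <= r <= b -> z <= `|V r| by move=> rab; rewrite ge_max normr_ge0 Vr.
    apply: le_trans (D_lower a b z a0 ab _ z0 zV); last by slra.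
    have yg := young_power z a k%:R q z0 a0 ltac:(slra).
    have ak : expR (k%:R * ln a) = a ^+ k by rewrite expRM_natl lnK.
    rewrite ak -/gam -/(h a) in yg.
    have -> : z `^ q * ((b - a) * (a / k.+1%:R) ^+ k) = (b - a) * (c * (z `^ q * a ^+ k)).
      by rewrite expr_div_n /c; ring.
    rewrite ler_pM2l ?subr_gt0//.
    have cV' : c * (`|V x| - h x - e / c) <= c * (z `^ q * a ^+ k) by rewrite ler_pM2l//; apply: le_trans (half_error _ _ _ _ _ z1 ha) _; rewrite lerBlDr.
    have ce : c * (e / c) = e by rewrite mulrC divfK// gt_eqF.
    by move: cV'; rewrite mulrBr ce.
have Hp0 s : 0 < s -> 0 <= Hp s by move=> _; rewrite /Hp divr_ge0 ?expR_ge0//; slra.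
have [|||l hl] := @nondecreasing_has_lim0 R Pr (fun r => `|V r|) (Pr 1 - Hp 1 - total / c) 1 ltr01.
- by move=> x ?; apply: hP; slra.
- by [].
- move=> x x1; have := bound x ltac:(slra); have := Hp0 x ltac:(slra) => h0.
  rewrite -mulrBr mulrC -ler_pdivlMr//; slra.
exists (fun r => Pr r - l); split.
  by move=> r r0; have hr := hP r r0; der; ring.
by apply: lim0_eq (lim0D _ _ _ _ hl (lim0_cst (- l))) _; rewrite subrr.
Qed.
End LqToL1.

(** * Radial functions *)

Section ExtendedLimits.
Context {R : realType}.

Lemma limf_esup_lt {T : choiceType} {X : filteredType T} (f : X -> R) (F : set_system X) (l : \bar R) :
  (limf_esup (fun x => (f x)%:E) F < l)%E ->
  exists2 m : R, (m%:E < l)%E & exists2 A, F A & forall x, A x -> f x <= m.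
Proof.
move=> /ereal_inf_lt[_ [A FA <-] h].
have ub x : A x -> ((f x)%:E <= ereal_sup [set (f x)%:E | x in A])%E.
  by move=> Ax; apply: ereal_sup_ubound; exists x.
move: h ub; case: (ereal_sup _) => [r| |] h ub.
- by exists r => //; exists A => // x /ub; rewrite lee_fin.
- by move: h; rewrite ltNge leey.
- have [m ml] : exists m : R, (m%:E < l)%E.
    case: l h => [l _|_|//]; first by exists (l - 1); rewrite lte_fin; slra.
    by exists 0; rewrite ltry.
  by exists m => //; exists A => // x /ub.
Qed.

Lemma limf_einf_gt {T : choiceType} {X : filteredType T} (f : X -> R) (F : set_system X) (l : \bar R) :
  (l < limf_einf (fun x => (f x)%:E) F)%E ->
  exists2 m : R, (l < m%:E)%E & exists2 A, F A & forall x, A x -> m <= f x.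
Proof.
rewrite /limf_einf lteNr.
move=> /(limf_esup_lt (fun x => - f x))[m ml [A FA hA]].
exists (- m); first by rewrite EFinN lteNr.
by exists A => // x /hA; rewrite lerNl.
Qed.
End ExtendedLimits.

Section Line.
Context {R : realType} {n : nat}.
Implicit Types F : 'rV[R]_n.+1 -> R.
Local Notation e0 := (@basis_vec R n.+1 ord0).

(** The profile is read on a coordinate axis. The partial derivative along the axis restricts to the
    derivative of the restriction, so smoothness is inherited at every order although partial
    derivatives are not radial. *)
Definition line F (t : R) : R := F (t *: e0).

Lemma enorm_line (t : R) : 0 <= t -> enorm (t *: e0) = t.
Proof.
move=> t0; rewrite /enorm big_ord_recl big1 => [|i _]; last first.
  by rewrite !mxE /= mulr0 expr0n.
by rewrite !mxE /= mulr1 addr0 sqrtr_sqr ger0_norm.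
Qed.

Lemma line_radial (f : R -> R) t : 0 <= t -> line (radial n.+1 f) t = f t.
Proof. by move=> t0; rewrite /line /radial enorm_line. Qed.

Lemma line_der F t : derivable F (t *: e0) e0 -> has_der (line F) t (line (fun x => 'D_e0 F x) t).
Proof.
move=> h; have e : (fun h : R => h^-1 *: ((line F \o shift t) (h *: (1 : R)) - line F t)) =
    (fun h : R => h^-1 *: ((F \o shift (t *: e0)) (h *: e0) - F (t *: e0))).
  by apply/funext => s; rewrite /line /= -scalerDl /GRing.scale /= mulr1.
apply: DeriveDef; first by rewrite /derivable e.
by rewrite /derive e.
Qed.

Lemma continuous_line F : continuous F -> forall t, {for t, continuous (line F)}.
Proof.
move=> cF t; apply: (continuous_comp (f := fun t : R => t *: e0)); last exact: cF.
exact: scalel_continuous.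
Qed.

Lemma C_k_continuous k F : C_k k F -> continuous F.
Proof. by case: k => [//|k] []. Qed.

Lemma C_k_line k F : C_k k.+1 F ->
  exists2 F', C_k k F' & forall t, has_der (line F) t (line F' t).
Proof. by move=> [_ /(_ ord0)[h1 h2]]; eexists; [exact: h2|move=> t; exact: line_der]. Qed.

Lemma line_support F : compactly_supported F -> exists2 X, 0 < X & forall t, X < t -> line F t = 0.
Proof.
move=> /compact_bounded [M [Mr hM]].
have := hM (M + 1) ltac:(by rewrite ltrDl ltr01) => {}hM.
exists (Num.max (M + 1) 1); first by rewrite lt_max ltr01 orbT.
move=> t; rewrite gt_max => /andP[tM t1]; apply/eqP/negPn/negP => Ft.
have /hM : closure [set f | F f != 0] (t *: e0) by exact: subset_closure.
have : `|(t *: e0) ord0 ord0| <= `|t *: e0|.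
  rewrite [leRHS]/Num.norm /= mx_normrE; apply/bigmax_geP; right => /=; by exists (ord0, ord0).
rewrite !mxE /= mulr1 ger0_norm; slra.
Qed.

Lemma line_near0 F (c : R) : (\forall x \near (0 : 'rV[R]_n.+1), F x = c) ->
  exists2 d, 0 < d & forall t, `|t| < d -> line F t = c.
Proof.
move=> h; have : \forall t \near (0 : R), line F t = c.
  have ct : (fun t : R => t *: e0) @ (0 : R) --> (0 : 'rV[R]_n.+1).
    by rewrite -[X in _ --> X](scale0r e0); exact: scalel_continuous.
  exact: ct h.
move=> /nbhs_ballP[d /= d0 hd]; exists d => // t td; apply: hd.
by rewrite /ball /= sub0r normrN.
Qed.
End Line.

Section LocallyConstant.
Context {R : realType}.

Lemma has_der_locally_cst (f : R -> R) (x l c : R) (d : R) : 0 < d ->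
  (forall y, `|y - x| < d -> f y = c) -> has_der f x l -> l = 0.
Proof.
move=> d0 fc h; have h2 : has_der f x 0.
  apply: (has_der_near (fun=> c)); first exact: has_der_cst.
  by apply/nbhs_ballP; exists d => //= y; rewrite /ball /= distrC => /fc.
by rewrite -(has_derE _ _ _ h) (has_derE _ _ _ h2).
Qed.

Lemma has_der_zero_above (f f' : R -> R) X c : (forall x, has_der f x (f' x)) ->
  (forall x, X < x -> f x = c) -> forall x, X < x -> f' x = 0.
Proof.
move=> hf fc x Xx; apply: (has_der_locally_cst f x (f' x) c (x - X)) => //; first slra.
by move=> y; rewrite ltr_distl => /andP[? ?]; apply: fc; slra.
Qed.

Lemma has_der_zero_near0 (f f' : R -> R) X c : (forall x, has_der f x (f' x)) ->
  (forall x, `|x| < X -> f x = c) -> forall x, `|x| < X -> f' x = 0.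
Proof.
move=> hf fc x Xx; apply: (has_der_locally_cst f x (f' x) c (X - `|x|)) => //; first slra.
move=> y yx; apply: fc; have := ler_normD (y - x) x; rewrite subrK; slra.
Qed.

Lemma bounded_halfline (f : R -> R) X : (forall x, {for x, continuous f}) ->
  (forall x, X < x -> f x = 0) -> exists C, forall x, 0 < x -> `|f x| <= C.
Proof.
move=> cf f0; have [C C0 hC] := continuous_bounded f 0 X (fun x _ => cf x).
exists C => x x0; case: (leP x X) => xX; first by apply: hC; rewrite ltW.
by rewrite f0// normr0 ltW.
Qed.

Lemma no_zero_lt0 (f : R -> R) a b : a <= b -> (forall x, a <= x <= b -> {for x, continuous f}) ->
  (forall x, a <= x <= b -> f x != 0) -> (f a < 0) = (f b < 0).
Proof.
move=> ab cf f0; apply/idP/idP => h; rewrite ltNge; apply/negP => h2.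
all: have [||c] := @IVT R f a b 0 ab; [by apply: continuous_within|
  by rewrite minEle maxEle; case: ifP => ?; apply/andP; split; slra|
  by rewrite in_itv /= => cab fc; have := f0 c cab; rewrite fc eqxx].
Qed.

(* The simplicity of the zero is what makes f change sign there. *)
Lemma simple_zero_sign (f : R -> R) (g0 r1 r0 l : R) : 0 < g0 -> 0 < r1 -> 0 < r0 ->
  (forall x, 0 < x -> {for x, continuous f}) -> (forall x, 0 < x < r1 -> f x <= - g0) ->
  f r0 = 0 -> has_der f r0 l -> l != 0 -> (forall x, 0 < x -> f x = 0 -> x = r0) ->
  (forall x, 0 < x < r0 -> f x < 0) /\ (forall x, r0 < x -> 0 < f x).
Proof.
move=> g00 r10 r00 cf fneg fr0 hl l0 uniq.
have nz x : 0 < x -> x != r0 -> f x != 0.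
  by move=> x0; apply: contra => /eqP /(uniq x x0) ->.
have below x : 0 < x < r0 -> f x < 0.
  move=> /andP[x0 xr]; have [s [/andP[s0 sr1] /andP[_ sx]]] := small_between _ _ r10 x0.
  rewrite -(no_zero_lt0 f s x (ltW sx)).
  - by have := fneg s ltac:(by rewrite s0); slra.
  - by move=> y /andP[sy _]; apply: cf; slra.
  - by move=> y /andP[sy yx]; apply: nz; [slra|rewrite lt_eqF//; slra].
split => // x xr.
have hq : (fun h : R => h^-1 *: ((f \o shift r0) (h *: (1 : R)) - f r0)) @ 0^' --> l.
  by case: hl => h1 <-; exact: h1.
have l1 : 0 < l.
  rewrite lt_neqAle eq_sym l0 /= leNgt; apply/negP => lneg.
  have [d /= d0 hd] : exists2 d : R, 0 < d & forall h, `|h| < d -> h != 0 -> h^-1 * f (h + r0) < 0.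
    move/cvgrPdist_lt : hq => /(_ (- l) ltac:(slra)) /nbhs_ballP[d /= d0 hd].
    exists d => // h hh h0; have := hd h; rewrite /ball /= sub0r normrN => /(_ hh h0).
    by rewrite fr0 subr0 /GRing.scale /= mulr1 distrC ltr_distl => /andP[_]; rewrite subrr.
  have [s [/andP[s0 sd] /andP[_ sr]]] := small_between _ _ d0 r00.
  have := hd (- s); rewrite normrN gtr0_norm// => /(_ sd); rewrite oppr_eq0 gt_eqF// => /(_ isT).
  rewrite invrN mulNr oppr_lt0 pmulr_rgt0 ?invr_gt0//.
  by have := below (- s + r0) ltac:(slra); slra.
have [d /= d0 hd] : exists2 d : R, 0 < d & forall h, `|h| < d -> h != 0 -> 0 < h^-1 * f (h + r0).
  move/cvgrPdist_lt : hq => /(_ l l1) /nbhs_ballP[d /= d0 hd].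
  exists d => // h hh h0; have := hd h; rewrite /ball /= sub0r normrN => /(_ hh h0).
  by rewrite fr0 subr0 /GRing.scale /= mulr1 distrC ltr_distl => /andP[+ _]; rewrite subrr.
have [s [/andP[s0 sd] /andP[_ sx]]] := small_between _ _ d0 (ltac:(slra) : 0 < x - r0).
have := hd s; rewrite gtr0_norm// => /(_ sd); rewrite gt_eqF// => /(_ isT).
rewrite pmulr_rgt0 ?invr_gt0// => fs.
have := no_zero_lt0 f (s + r0) x ltac:(slra) => /(_ _ _) h.
have {}h : (f (s + r0) < 0) = (f x < 0).
  by apply: h => y ?; [apply: cf|apply: nz; [|rewrite gt_eqF//]]; slra.
rewrite lt_neqAle eq_sym nz ?gt_eqF//=; last by slra.
by rewrite leNgt -h -leNgt ltW.
Qed.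
End LocallyConstant.

(** * The original problem *)

Section Conversion.
Context {R : realType} (P : problem R) (V a b : R -> R) (d : R).
Local Notation n := (pn R P).
Hypothesis PQ : forall r, pQ R P r = V r + d * a r.
Hypothesis PK : forall r, pK R P r = 1 + d * b r.

Let natrB1 : n.+1%:R - 1 = n%:R :> R.
Proof. by rewrite -natr1 addrK. Qed.

(** The one-sided difference quotient gives the limit v 0; continuity of the derivative at 0 with
    value 0 gives the vanishing flux. *)
Lemma solution_gsol v : is_solution n.+1 V a b d v -> gsol P (v 0) v (derive1 v).
Proof.
move=> [[[cq dv cd] c2] eq vp d0 vinf]; split; last exact: vinf.
move=> T; split.
- move=> r /andP[r0 _]; have [h1 h2 _] := c2 r r0; split; last exact: vp.
    exact: has_derP.
  apply: has_der_eq (has_derP _ _ h2) _; rewrite PQ PK.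
  have := eq r r0; have nr := natrB1; rewrite nr lnXn ?vp// => e.
  by apply/eqP; rewrite -subr_eq0 -[X in _ == X]e; apply/eqP; rewrite -mulr_natl; ring.
- apply: (lim0_ext (fun h => h * right_quotient0 v h + v 0) _ _ 1 ltr01).
    by move=> x /andP[x0 _]; rewrite /right_quotient0 mulrA mulfV ?gt_eqF// mul1r subrK.
  apply: lim0_eq (lim0D _ _ _ _ (lim0M _ _ _ _ lim0_id cq) (lim0_cst (v 0))) _.
  by rewrite mul0r add0r.
- move/continuous_within_itvcyP: cd => [_]; rewrite d0 => cd.
  apply: (lim0_ext (fun r => r ^+ n * deriv_halfline v r) _ _ 1 ltr01).
    by move=> x /andP[x0 _]; rewrite /deriv_halfline gt_eqF.
  by apply: lim0_eq (lim0M _ _ _ _ (lim0X _ _ n lim0_id) cd) _; rewrite mulr0.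
Qed.

(** The value at 0 has to be set to the limit al, since it enters the difference quotient. That u'
    vanishes at 0 and is continuous there comes from [psol_lim_slope]. *)
Lemma gsol_solution al w w1 : 0 < al -> gsol P al w w1 ->
  is_solution n.+1 V a b d (fun r => if r <= 0 then al else w r).
Proof.
move=> al0 [ws winf]; set u : R -> R := fun r => if r <= 0 then al else w r.
have uw (r : R) : 0 < r -> u r = w r by move=> r0; rewrite /u leNgt r0.
have u0 : u 0 = al by rewrite /u lexx.
have near_pos (r : R) : 0 < r -> \forall y \near r, 0 < y by move=> r0; exact: lt_nbhsr.
have hw (r : R) : 0 < r -> [/\ has_der w r (w1 r), has_der w1 r
    (pQ R P r * w r - pK R P r * (2 * (w r * ln (w r))) - n%:R / r * w1 r) & 0 < w r].
  by move=> r0; have [hs _ _] := ws r; apply: hs; rewrite r0 lexx.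
have hu (r : R) : 0 < r -> has_der u r (w1 r).
  move=> r0; have [h _ _] := hw r r0; apply: has_der_near h _.
  by near=> y; rewrite uw//; near: y; exact: near_pos.
have du (r : R) : 0 < r -> derive1 u r = w1 r by move=> /hu /has_derE.
pose w2 (r : R) := pQ R P r * w r - pK R P r * (2 * (w r * ln (w r))) - n%:R / r * w1 r.
have hdu (r : R) : 0 < r -> has_der (derive1 u) r (w2 r).
  move=> r0; have [_ h _] := hw r r0; apply: has_der_near h _.
  by near=> y; rewrite du//; near: y; exact: near_pos.
have ddu (r : R) : 0 < r -> derive1 (derive1 u) r = w2 r by move=> /hdu /has_derE.
have [_ wl _] := ws 1; have w1l := psol_lim_slope P 1 al w w1 al0 ltr01 (ws 1).
have ql : lim0 (right_quotient0 u) 0.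
  apply/lim0P => e e0; move/lim0P: w1l => /(_ (e / 2) ltac:(lra)) [r r0 hr].
  exists r => // x /andP[x0 xr].
  have bound : `|w x - al| <= e / 2 * x - 0.
    apply: (der_norm_lim0 w (fun r => e / 2 * r) w1 (fun=> e / 2) al 0 x wl).
    - by apply: lim0_eq (lim0M _ _ _ _ (lim0_cst (e / 2)) lim0_id) _; rewrite mulr0.
    - by move=> y /andP[y0 _]; have [] := hw y y0.
    - by move=> y _; der; ring.
    - move=> y /andP[y0 yx]; have := hr y ltac:(by rewrite y0 (lt_trans yx)).
      by rewrite subr0 => /ltW.
    - by rewrite x0 lexx.
  rewrite subr0 /right_quotient0 uw// u0 normrM gtr0_norm ?invr_gt0//.
  rewrite mulrC ltr_pdivrMr//; apply: le_lt_trans bound _.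
  by rewrite subr0 ltr_pM2r//; lra.
have d0 : deriv_halfline u 0 = 0 by rewrite /deriv_halfline eqxx; exact: cvg_lim ql.
split => //.
- split.
    split; first by apply/cvg_ex; exists 0.
      by move=> r /hu /has_der_derivable.
    apply/continuous_within_itvcyP; rewrite d0; split.
      move=> r; rewrite in_itv /= andbT => r0.
      apply/continuousP_dist => e e0.
      have [_ h _] := hw r r0; have := has_der_cont _ _ _ h.
      move=> /continuousP_dist /(_ e e0) [s s0 hs].
      exists (Num.min s r); first by rewrite lt_min s0.
      move=> y; rewrite lt_min => /andP[ys yr].
      have y0 : 0 < y by move: yr; rewrite ltr_distl => /andP[]; lra.
      by rewrite /deriv_halfline !gt_eqF// !du//; exact: hs.
    apply: (lim0_ext w1 _ _ 1 ltr01 _ w1l) => x /andP[x0 _].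
    by rewrite /deriv_halfline gt_eqF// du.
  move=> r r0; split; [exact: has_der_derivable (hu r r0)|exact: has_der_derivable (hdu r r0)|].
  have [h1 h2 h3] := hw r r0.
  have rn := lt0r_neq0 r0.
  have c1 : cont_at w r := has_der_cont _ _ _ h1.
  have c2 : cont_at w1 r := has_der_cont _ _ _ h2.
  have c3 : cont_at (pQ R P) r := pQ_cont R P r r0.
  have c4 : cont_at (pK R P) r := has_der_cont _ _ _ (pK_der R P r r0).
  have c5 : cont_at (fun r => ln (w r)) r := has_der_cont _ _ _ (has_der_ln w r (w1 r) h3 h1).
  have c6 : cont_at w2 r by rewrite /w2; cont.
  apply/continuousP_dist => e e0; have [s s0 hs] := (continuousP_dist _ _).1 c6 e e0.
  exists (Num.min s r); first by rewrite lt_min s0.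
  move=> y; rewrite lt_min => /andP[ys yr].
  have y0 : 0 < y by move: yr; rewrite ltr_distl => /andP[]; lra.
  by rewrite !ddu//; exact: hs.
- move=> r r0; rewrite ddu// du// uw// natrB1 /w2 -PQ -PK.
  by have [_ _ h3] := hw r r0; rewrite lnXn// -mulr_natl; ring.
- by move=> r r0; rewrite uw//; have [] := hw r r0.
- apply/cvgrPdist_lt => e e0; move/cvgrPdist_lt: winf => /(_ e e0) [X [Xr hX]].
  exists (Num.max X 0); split; first exact: num_real.
  by move=> r; rewrite gt_max => /andP[rX r0]; rewrite uw//; exact: hX.
Unshelve. all: by end_near. Qed.

(** A solution is required to be positive only for r > 0, so v 0 = 0 must be excluded first, by
    comparison with w; only then does uniqueness for positive initial values apply. *)
Lemma gsol_solution_unique al w w1 v : 0 < al -> nonneg_energy P -> gsol P al w w1 ->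
  is_solution n.+1 V a b d v -> forall r, 0 <= r -> v r = if r <= 0 then al else w r.
Proof.
move=> al0 nn gw sv r r0; have gv := solution_gsol v sv.
have [ws _] := gw; have [vs _] := gv.
have [_ wl _] := ws 1; have [hv vl _] := vs 1.
have v00 : 0 <= v 0.
  by apply: (lim0_ge v (v 0) 0 1) => // x /andP[x0 x1]; have [_ _ /ltW] := hv x ltac:(by rewrite x0 ltW).
have v0 : 0 < v 0.
  rewrite lt_neqAle v00 andbT eq_sym; apply/eqP => e.
  apply: (psol_nonzero_start P al w w1 v (derive1 v) 1 al0 ltr01 (ws 1)).
  by rewrite -e; exact: vs.
have e := gsol_unique P (v 0) v _ al w w1 nn v0 al0 gv gw.
move: r0; rewrite le_eqVlt => /orP[/eqP<-|r0]; last by rewrite leNgt r0 /= e.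
rewrite lexx; apply: (lim0_unique v) => //.
by apply: (lim0_ext w _ _ 1 ltr01) => // x /andP[x0 _]; rewrite e.
Qed.
End Conversion.

Section Coefficients.
Context {R : realType} (k : nat) (a b V : R -> R) (q : R).
Local Notation N := k.+1.
Hypothesis k0 : (0 < k)%N.
Hypothesis aC2 : C_k0 2 (radial N a).
Hypothesis bC3 : C_k0 3 (radial N b).
Hypothesis b0 : forall x : 'rV[R]_N, 0 <= radial N b x.
Hypothesis b1 : \forall x \near (0 : 'rV[R]_N), radial N b x = 1.
Hypothesis VC2 : C2_pos V.
Hypothesis qN : N%:R < q.
Hypothesis VLq : Lq_loc q (radial N V).
Hypothesis Vinf : (-oo < limf_einf (fun r => (V r)%:E) (+oo%R : set_system R))%E.

Lemma V_der r : 0 < r -> has_der V r (derive1 V r).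
Proof. by move=> /VC2[h _ _]; exact: has_derP. Qed.

Lemma V'_der r : 0 < r -> has_der (derive1 V) r (derive1 (derive1 V) r).
Proof. by move=> /VC2[_ h _]; exact: has_derP. Qed.

Lemma radial_der (f f' : R -> R) r : (forall t, has_der (line (radial N f)) t (f' t)) ->
  0 < r -> has_der f r (f' r).
Proof.
move=> h r0; apply: has_der_near (h r) _; near=> y; apply: line_radial.
by apply: ltW; near: y; exact: lt_nbhsr.
Unshelve. all: by end_near. Qed.

Lemma coefs_exist : exists c : coefs R,
  [/\ cn R c = k, cV R c = V, cV' R c = derive1 V, ca R c = a & cb R c = b].
Proof.
have [aC asupp] := aC2; have [bC bsupp] := bC3.
have [Fa aC1 ad] := C_k_line 1 _ aC.
have [F1 bC2 bd] := C_k_line 2 _ bC; have [F2 bC1 bd2] := C_k_line 1 _ bC2.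
have [F3 bC0 bd3] := C_k_line 0 _ bC1.
have a1c := continuous_line _ (C_k_continuous 1 _ aC1).
have b3c := continuous_line _ bC0.
move: (line Fa) (line F1) (line F2) (line F3) ad bd bd2 bd3 a1c b3c => a1 b1' b2 b3 ad bd bd2 bd3 a1c b3c.
have ac t : {for t, continuous (line (radial N a))} := has_der_cont _ _ _ (ad t).
have bc t : {for t, continuous (line (radial N b))} := has_der_cont _ _ _ (bd t).
have [Xa Xa0 ha] := line_support _ asupp; have [Xb Xb0 hb] := line_support _ bsupp.
have a1X := has_der_zero_above _ _ Xa 0 ad ha.
have b1X := has_der_zero_above _ _ Xb 0 bd hb.
have b2X := has_der_zero_above _ _ Xb 0 bd2 b1X.
have b3X := has_der_zero_above _ _ Xb 0 bd3 b2X.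
have [rho rho0 hrho] := line_near0 _ 1 b1.
have b1r := has_der_zero_near0 _ _ rho 1 bd hrho.
have b2r := has_der_zero_near0 _ _ rho 0 bd2 b1r.
have b3r := has_der_zero_near0 _ _ rho 0 bd3 b2r.
have [A1 hA1] := bounded_halfline _ Xa ac ha.
have [A2 hA2] := bounded_halfline _ Xa a1c a1X.
have [B hB] := bounded_halfline _ Xb bc hb.
have [M [Md Ml]] := radial_Lq_primitive k q V qN (fun r r0 => has_der_cont _ _ _ (V_der r r0)) VLq.
have [bot _ [S [X [Xr hX]] hS]] := limf_einf_gt _ _ _ Vinf.
pose far := Num.max (Num.max Xa Xb) X + 1.
have farX r : far <= r -> [/\ Xa < r, Xb < r & X < r].
  have m1 : Xa <= Num.max (Num.max Xa Xb) X by rewrite !le_max lexx.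
  have m2 : Xb <= Num.max (Num.max Xa Xb) X by rewrite !le_max lexx orbT.
  have m3 : X <= Num.max (Num.max Xa Xb) X by rewrite !le_max lexx orbT.
  by rewrite /far => fr; split; lra.
have far0 : 0 < far.
  have m1 : Xa <= Num.max (Num.max Xa Xb) X by rewrite !le_max lexx.
  by rewrite /far; lra.
have lr (f : R -> R) r : 0 < r -> line (radial N f) r = f r by move=> r0; rewrite line_radial// ltW.
have b_itv r : 0 < r -> 0 <= b r <= B.
  move=> r0; have := hB r r0; rewrite lr// ler_norml => /andP[_ ->].
  by rewrite andbT -(lr b r r0) /line b0.
have near r : 0 < r < rho -> [/\ b r = 1, b1' r = 0, b2 r = 0 & b3 r = 0].
  move=> /andP[r0 rr]; have nr : `|r| < rho by rewrite gtr0_norm.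
  by rewrite -(lr b r r0) hrho// b1r// b2r// b3r.
have afar r : far <= r -> a r = 0 /\ a1 r = 0.
  move=> fr; have [h1 _ _] := farX r fr; have r0 := lt_le_trans far0 fr.
  by rewrite -(lr a r r0) ha// a1X.
have bfar r : far <= r -> [/\ b r = 0, b1' r = 0, b2 r = 0 & b3 r = 0].
  move=> fr; have [_ h1 _] := farX r fr; have r0 := lt_le_trans far0 fr.
  by rewrite -(lr b r r0) hb// b1X// b2X// b3X.
have Vfar r : far <= r -> bot <= V r.
  by move=> fr; have [_ _ h1] := farX r fr; apply: hS; exact: hX.
have Ab r : 0 < r -> `|a r| <= Num.max A1 A2.
  by move=> r0; rewrite le_max -(lr a r r0) hA1.
have A'b r : 0 < r -> `|a1 r| <= Num.max A1 A2.
  by move=> r0; rewrite le_max hA2// orbT.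
exists (@Coefs R k V (derive1 V) a a1 b b1' b2 b3 M rho far bot (Num.max A1 A2) B k0
  V_der (fun r rp => has_der_cont _ _ _ (V'_der r rp)) (fun r => radial_der a a1 r ad)
  (fun r _ => a1c r) Ab A'b (fun r => radial_der b b1' r bd) (fun r _ => bd2 r) (fun r _ => bd3 r)
  (fun r _ => b3c r) b_itv rho0 near far0 afar bfar Vfar Md Ml).
by [].
Qed.
End Coefficients.

Section Potential.
Context {R : realType} (c : coefs R).
Local Notation N := (cn R c).+1.
Local Notation V := (cV R c).

Lemma G_der r : 0 < r -> has_der (G N V) r (gder c r).
Proof.
move=> r0; have h := cV_der R c r r0; have rn := lt0r_neq0 r0.
have r4 : 4 * r ^+ 2 != 0 by rewrite mulf_neq0// expf_neq0.
rewrite /G; der => //; rewrite /gder /cpole -natr1 /=; field.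
by [].
Qed.

Lemma G_derE r : 0 < r -> derive1 (G N V) r = gder c r.
Proof. by move=> /G_der /has_derE. Qed.

Lemma r3G'E r : 0 < r -> r3G' N V r = r ^+ 3 * gder c r.
Proof. by move=> r0; rewrite /r3G' G_derE. Qed.

Lemma r3gder_der r v : 0 < r -> has_der (cV' R c) r v -> exists l,
  has_der (fun r => r ^+ 3 * gder c r) r l.
Proof.
move=> r0 h; have rn := lt0r_neq0 r0.
eexists; rewrite /gder; der => //; reflexivity.
Qed.
End Potential.

Theorem corollary1p1 (R : realType) (N : nat) (a b V : R -> R) :
  (2 <= N)%N ->
  C_k0 2 (radial N a) ->
  C_k0 3 (radial N b) ->
  (forall x : 'rV[R]_N, 0 <= radial N b x) ->
  (\forall x \near (0 : 'rV[R]_N), radial N b x = 1) ->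
  C2_pos V ->
  ((1 - N%:R)%:E < limf_einf (fun r => (V r / ln r)%:E) (+oo%R : set_system R))%E ->
  (exists2 q : R, N%:R < q & Lq_loc q (radial N V)) ->
  (-oo < limf_einf (fun r => (V r)%:E) (+oo%R : set_system R))%E ->
  (N = 2%N \/ N = 3%N ->
     (forall r, 0 < r -> 0 < derive1 (G N V) r) /\
     (0 < limf_einf (fun r => (derive1 (G N V) r)%:E) (0 : R)^'+)%E) ->
  ((4 <= N)%N ->
     (limf_esup (fun r => (r3G' N V r)%:E) (0 : R)^'+ < 0)%E /\
     unique_simple_zero_pos (r3G' N V)) ->
  exists2 delta0 : R, 0 < delta0 &
    forall delta, 0 <= delta <= delta0 ->
      exists u, is_solution N V a b delta u /\
        forall v, is_solution N V a b delta v -> forall r, 0 <= r -> v r = u r.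
Proof.
case: N => [//|k] k0 aC bC b0 b1 VC2 _ [q qN VLq] Vinf G23 G4.
have [c [ck cVE cV'E caE cbE]] := coefs_exist k a b V q k0 aC bC b0 b1 VC2 qN VLq Vinf.
suff [d0 d00 h] : exists2 d0, 0 < d0 & forall d, 0 <= d <= d0 -> solvable c d.
  exists d0 => // d dd; have [P [Pn PQ PK nn]] := h d dd.
  have [al [u [u1 [al0 us uinf]]]] := decaying_solution_exists P.
  rewrite -ck -Pn; exists (fun r => if r <= 0 then al else u r); rewrite cVE caE in PQ; rewrite cbE in PK.
  split; first exact: (gsol_solution P V a b d PQ PK al u u1 al0).
  by move=> v sv; exact: (gsol_solution_unique P V a b d PQ PK al u u1 v al0 nn).
(* Here N is n + 1, and the two cases differ by the sign of G' near 0. *)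
rewrite -cVE -ck in G23 G4; case: (leqP 4 (cn R c).+1) => N4.
  have [sup0 [r0 [r00 z0 s0 uz]]] := G4 N4.
  have [m m0 [A /near0P[r1 r10 hA] hm]] := limf_esup_lt _ _ _ sup0.
  rewrite lte_fin in m0.
  have neg r : 0 < r < r1 -> r ^+ 3 * gder c r <= - - m.
    by move=> rr; rewrite opprK -r3G'E; [apply: hm; exact: hA|case/andP: rr].
  have hV := V'_der V VC2 r0 r00; rewrite -cV'E in hV.
  have [l hl] := r3gder_der c r0 _ r00 hV.
  have l0 : l != 0.
    rewrite -(has_derE (r3G' (cn R c).+1 (cV R c)) r0 l)//.
    apply: has_der_near hl _; near=> y; rewrite r3G'E//.
    by near: y; exact: lt_nbhsr.
  (* The hypothesis concerns the zero of r^3 G'; as r^3 > 0, the signs obtained on both sides of r0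
     pass to G'. *)
  have [||||hneg hpos] := simple_zero_sign (fun r => r ^+ 3 * gder c r) (- m) r1 r0 l _ r10 r00 _ neg _ hl l0.
  - by rewrite oppr_gt0.
  - move=> x x0; have h : cont_at (gder c) x := gder_cont c x x0.
    have h2 : cont_at (fun y : R => y) x by exact: cvg_id.
    exact: (contM _ _ _ (contX _ 3 _ h2) h).
  - by rewrite -r3G'E.
  - by move=> x x0; rewrite -r3G'E//; exact: uz.
  apply: (solvable_decreasing_increasing c (- m) r1 r0) => //; first by rewrite oppr_gt0.
  - move=> r rr; have := hneg r rr; rewrite pmulr_rlt0// exprn_gt0//.
    by case/andP: rr.
  - by move=> r rr; have := hpos r rr; rewrite pmulr_rgt0// exprn_gt0// (lt_trans r00).
have [|G'0 Ginf] := G23.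
  by case: (cn R c) N4 ck => [|[|[|//]]] // _ ek; [move: k0; rewrite -ek|left|right].
have [m m0 [A /near0P[r1 r10 hA] hm]] := limf_einf_gt _ _ _ Ginf.
rewrite lte_fin in m0.
apply: (solvable_increasing c m r1) => // r.
- by move=> r0; rewrite -G_derE//; exact: G'0.
- by move=> rr; rewrite -G_derE; [apply: hm; exact: hA|case/andP: rr].
Unshelve. all: by end_near. Qed.
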